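(* Let $\mathfrak{L}=L_{\boldsymbol m}(\mathfrak g,\boldsymbol\sigma,\mathfrak h)$ and $\mathfrak{L}'=L_{\boldsymbol m'}(\mathfrak g',\boldsymbol\sigma',\mathfrak h')$ be multiloop Lie algebras of nullity $n$ (graded by $Q_{\mathfrak h}\times\mathbb Z^n$ and $Q_{\mathfrak h'}\times\mathbb Z^n$ respectively). Then the following are equivalent: (a) $\mathfrak L$ and $\mathfrak L'$ are support-isomorphic. (b) There exist $s=(s_1,\dots,s_n)\in\mathrm{Hom}(Q_{\mathfrak h},\mathbb Q^n)$, $P\in GL_n(\mathbb Z)$ and a Lie algebra isomorphism $\varphi:\mathfrak g\to\mathfrak g'$ such that, defining $\tau_i\in\mathrm{Aut}(\mathfrak g)$ by $\tau_i(x_\alpha)=\zeta^{-s_i(\alpha)}x_\alpha$ for $\alpha\in Q_{\mathfrak h}$, $x_\alpha\in\mathfrak g_\alpha$, and $\boldsymbol\tau=(\tau_1,\dots,\tau_n)$, one has $\boldsymbol\sigma'=\varphi(\boldsymbol\tau\boldsymbol\sigma)^P\varphi^{-1}$. (c) There exists a finite sequence of $Q_{\mathfrak h}\times\mathbb Z^n$-graded Lie algebras $\mathfrak L_0,\mathfrak L_1,\dots,\mathfrak L_p$ such that (i) $\mathfrak L_0=\mathfrak L$; (ii) $\mathfrak L_p$ and $\mathfrak L'$ are $\mathbb Z^n$-isograded-isomorphic; (iii) for each $0\le i\le p-1$, $\mathfrak L_{i+1}$ is either $(\mathfrak L_i)_{(\rho_i)}$ for some group monomorphism $\rho_i:\langle\mathrm{supp}_{\mathbb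 Z^n}(\mathfrak L_i)\rangle\to\mathbb Z^n$, or $\mathfrak L_i^{(s_i)}$ for some $s_i\in\mathrm{Hom}(Q_{\mathfrak h},\mathbb Z^n)$.
   Context: Throughout, $k$ is an algebraically closed field of characteristic $0$; for each $n\in\mathbb Z_{>0}$ a primitive $n$-th root of unity $\zeta_n\in k$ is fixed so that $\zeta_{mn}^m=\zeta_n$ for all $m,n$. For $q\in\mathbb Q$ written $q=a/b$ with $a\in\mathbb Z$, $b\in\mathbb Z_{>0}$, put $\zeta^q=\zeta_b^a$ (well defined). Multiloop Lie algebras: let $\mathfrak g$ be a finite-dimensional simple Lie algebra over $k$; $\mathrm{Aut}^n_{\mathrm{cfo}}(\mathfrak g)$ is the set of $n$-tuples $\boldsymbol\sigma=(\sigma_1,\dots,\sigma_n)$ of pairwise commuting finite-order automorphisms. Let $\boldsymbol m=(m_1,\dots,m_n)\in\mathbb Z^n_{>0}$ with $\sigma_i^{m_i}=\mathrm{id}$ for all $i$. For $\lambda=(l_1,\dots,l_n)\in\mathbb Z^n$ put $\mathfrak g^{\bar\lambda}=\{g\in\mathfrak g:\sigma_i(g)=\zeta_{m_i}^{l_i}g\ \text{for }1\le i\le n\}$ and $\mathfrak g^{\boldsymbol\sigma}=\mathfrak g^{\bar 0}$ (common fixed points). If $\mathfrak g^{\boldsymbol\sigma}\neq0$, $\mathfrak h$ is a Cartan subalgebra (maximal ad-diagonalizable subalgebra) of the reductive algebra $\mathfrak g^{\boldsymbol\sigma}$; $\mathfrak h$ acts diagonalizably on $\mathfrak g$, giving $\mathfrak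 g=\bigoplus_{\alpha\in\mathfrak h^*}\mathfrak g_\alpha$; $\Delta=\{\alpha\ne0:\mathfrak g_\alpha\ne0\}$, $Q_{\mathfrak h}=\sum_{\alpha\in\Delta}\mathbb Z\alpha$, $\mathfrak g^{\bar\lambda}_\alpha=\mathfrak g_\alpha\cap\mathfrak g^{\bar\lambda}$, and $L_{\boldsymbol m}(\mathfrak g,\boldsymbol\sigma,\mathfrak h)=\bigoplus_{(\alpha,\lambda)\in Q_{\mathfrak h}\times\mathbb Z^n}\mathfrak g^{\bar\lambda}_\alpha\otimes t^\lambda\subseteq\mathfrak g\otimes k[t_1^{\pm1},\dots,t_n^{\pm1}]$, a $Q_{\mathfrak h}\times\mathbb Z^n$-graded Lie algebra with $(\alpha,\lambda)$-component $\mathfrak L^\lambda_\alpha=\mathfrak g^{\bar\lambda}_\alpha\otimes t^\lambda$. If $\mathfrak g^{\boldsymbol\sigma}=0$, set $\mathfrak h=0$, $Q_{\mathfrak h}=\{0\}$ and $L_{\boldsymbol m}(\mathfrak g,\boldsymbol\sigma,\mathfrak h)=\bigoplus_\lambda\mathfrak g^{\bar\lambda}\otimes t^\lambda$, graded by $Q_{\mathfrak h}\times\mathbb Z^n$. $n$ is the nullity. Write $\mathfrak L^\lambda=\bigoplus_\alpha\mathfrak L^\lambda_\alpha$. Notation: for $P=(p_{ij})\in GL_n(\mathbb Z)$, $\boldsymbol\sigma^P=(\prod_i\sigma_i^{p_{i1}},\dots,\prod_i\sigma_i^{p_{in}})$; $\boldsymbol\tau\boldsymbol\sigma=(\tau_1\sigma_1,\dots,\tau_n\sigma_n)$;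 $\varphi\boldsymbol\sigma\varphi^{-1}=(\varphi\sigma_1\varphi^{-1},\dots,\varphi\sigma_n\varphi^{-1})$. Graded isomorphisms: for an abelian group $\Lambda$ and a $\Lambda$-graded algebra $B$, $\mathrm{supp}_\Lambda(B)=\{\lambda:B^\lambda\neq0\}$ and $\langle\mathrm{supp}_\Lambda(B)\rangle$ is the subgroup it generates. A $\Lambda$-graded $B$ and a $\Lambda'$-graded $B'$ are isograded-isomorphic if there are an algebra isomorphism $\varphi:B\to B'$ and a group isomorphism $\varphi_\Lambda:\Lambda\to\Lambda'$ with $\varphi(B^\lambda)=B'^{\varphi_\Lambda(\lambda)}$ for all $\lambda$; support-isomorphic if there are an algebra isomorphism $\varphi$ and a group isomorphism $\varphi_{\mathrm{su}}:\langle\mathrm{supp}_\Lambda(B)\rangle\to\langle\mathrm{supp}_{\Lambda'}(B')\rangle$ with $\varphi(B^\lambda)=B'^{\varphi_{\mathrm{su}}(\lambda)}$ for all $\lambda\in\langle\mathrm{supp}_\Lambda(B)\rangle$. Two multiloop Lie algebras of nullity $n$ are $\mathbb Z^n$-isograded-isomorphic if they are isograded-isomorphic when regarded only as $\mathbb Z^n$-graded. Regradings: for abelian groups $Q,\Lambda$ and a $Q\times\Lambda$-graded Lie algebra $\mathfrak B$: for a group monomorphism $\rho:\langle\mathrm{supp}_\Lambda(\mathfrak B)\rangle\to\Lambda$ (support w.r.t. the $\Lambda$-grading), $\mathfrak B_{(\rho)}$ is $\mathfrak B$ with grading $(\mathfrak B_{(\rho)})^\lambda_\alpha=\mathfrak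 B^{\rho^{-1}(\lambda)}_\alpha$ if $\lambda\in\mathrm{Im}\,\rho$ and $\{0\}$ otherwise; for $s\in\mathrm{Hom}(Q,\Lambda)$, $\mathfrak B^{(s)}$ is $\mathfrak B$ with grading $(\mathfrak B^{(s)})^\lambda_\alpha=\mathfrak B^{\lambda+s(\alpha)}_\alpha$. *)

(* Defs.v *)
From HB Require Import structures.
From mathcomp Require Import all_boot all_order all_algebra.
From Stdlib Require Import ClassicalEpsilon.
Set Implicit Arguments. Unset Strict Implicit. Unset Printing Implicit Defensive.
Import Order.TTheory GRing.Theory Num.Theory.
Local Open Scope ring_scope.

Definition zeta_pow (k : fieldType) (zeta : nat -> k) (q : rat) : k :=
  zeta `|denq q|%N ^ numq q.

Section Lie.
Variables (k : fieldType) (g : vectType k) (br : g -> g -> g).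

Definition is_lie : Prop :=
  [/\ (forall a x y z, br (a *: x + y) z = a *: br x z + br y z),
      (forall a x y z, br z (a *: x + y) = a *: br z x + br z y),
      (forall x, br x x = 0) &
      (forall x y z, br x (br y z) + br y (br z x) + br z (br x y) = 0)].

Definition is_simple_lie : Prop :=
  [/\ is_lie,
      (exists x y, br x y != 0) &
      (forall I : {vspace g}, (forall x y, y \in I -> br x y \in I) ->
         I = 0%VS \/ I = fullv)].

Definition lie_aut (f : 'End(g)) : Prop :=
  bijective (fun x => f x) /\ forall x y, f (br x y) = br (f x) (f y).

Definition endpow (f : 'End(g)) (z : int) : 'End(g) :=
  match z with
  | Posz m => iter m (fun u => f \o u)%VF \1%VF
  | Negz m => iter m.+1 (fun u => f^-1 \o u)%VF \1%VF
  end.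

Definition tuple_powP n (sig : 'I_n -> 'End(g)) (P : 'M[int]_n) (j : 'I_n)
  : 'End(g) :=
  \big[@comp_lfun _ g g g/id_lfun g]_(i < n) endpow (sig i) (P i j).

Definition cfo_tuple n (sig : 'I_n -> 'End(g)) (m : 'I_n -> nat) : Prop :=
  [/\ (forall i, lie_aut (sig i)),
      (forall i j, (sig i \o sig j)%VF = (sig j \o sig i)%VF),
      (forall i, exists N, (0 < N)%N /\ endpow (sig i) N = \1%VF),
      (forall i, (0 < m i)%N) &
      (forall i, endpow (sig i) (m i) = \1%VF)].

Definition fixed n (sig : 'I_n -> 'End(g)) (x : g) : Prop :=
  forall i, sig i x = x.

Definition ad_diag (M : g -> Prop) (H : g) : Prop :=
  forall x, M x -> exists s : seq g,
    (forall v, v \in s -> M v /\ exists c : k, br H v = c *: v) /\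
    x = \sum_(v <- s) v.

Definition toral (M : g -> Prop) (h : {vspace g}) : Prop :=
  [/\ (forall x, x \in h -> M x),
      (forall x y, x \in h -> y \in h -> br x y \in h) &
      (forall H, H \in h -> ad_diag M H)].

Definition cartan_of_fixed n (sig : 'I_n -> 'End(g)) (h : {vspace g}) : Prop :=
  ((exists x, x != 0 /\ fixed sig x) ->
     toral (fixed sig) h /\
     (forall h' : {vspace g}, toral (fixed sig) h' -> (h <= h')%VS -> h' = h)) /\
  ((forall x, fixed sig x -> x = 0) -> h = 0%VS).

Definition hdual (h : {vspace g}) := 'Hom(subvs_of h, k^o).

Definition rootsp (h : {vspace g}) (al : hdual h) (x : g) : Prop :=
  forall H : subvs_of h, br (vsval H) x = (al H : k) *: x.

Definition sigsp (zeta : nat -> k) n (sig : 'I_n -> 'End(g)) (m : 'I_n -> nat)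
  (l : 'rV[int]_n) (x : g) : Prop :=
  forall i, sig i x = zeta (m i) ^ (l 0 i) *: x.
End Lie.

Definition gen_subgroup (G : zmodType) (S : G -> Prop) (x : G) : Prop :=
  exists l : seq (int * G), (forall p, p \in l -> S p.2) /\
    x = \sum_(p <- l) p.2 *~ p.1.

Definition in_Qh (k : fieldType) (g : vectType k) (br : g -> g -> g)
  (h : {vspace g}) (al : hdual h) : Prop :=
  gen_subgroup (fun be : hdual h => be != 0 /\ exists x, x != 0 /\ rootsp br be x) al.

Definition hom_on (G H : zmodType) (S : G -> Prop) (f : G -> H) : Prop :=
  forall x y, S x -> S y -> f (x + y) = f x + f y.

(* The ambient algebra  V (x) k[t_1^{+-1},...,t_n^{+-1}]  realised as  *)
(* finitely supported functions Z^n -> V.                              *)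
Section Loop.
Variables (k : fieldType) (V : lmodType k) (n : nat).
Definition LA := 'rV[int]_n -> V.
Definition la0 : LA := fun _ => 0.
Definition la_add (f f' : LA) : LA := fun l => f l + f' l.
Definition la_scale (a : k) (f : LA) : LA := fun l => a *: f l.
Definition la_supp (f : LA) : seq 'rV[int]_n :=
  epsilon (inhabits [::]) (fun s => forall l, f l != 0 -> l \in s).
(* [x t^mu, y t^nu] = [x,y] t^(mu+nu), extended bilinearly *)
Definition la_br (br : V -> V -> V) (f f' : LA) : LA :=
  fun l => \sum_(mu <- undup (la_supp f)) br (f mu) (f' (l - mu)).

Definition supp_of (G : zmodType) (comp : G -> LA -> Prop) (x : G) : Prop :=
  exists f, comp x f /\ f <> la0.

Definition coarse (Q : zmodType) (comp : Q * 'rV[int]_n -> LA -> Prop)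
  (l : 'rV[int]_n) (f : LA) : Prop :=
  exists (s : seq Q) (x : Q -> LA),
    (forall al, al \in s -> comp (al, l) (x al)) /\
    forall mu, f mu = \sum_(al <- s) x al mu.

Definition regrade_rho (Q : zmodType) (comp : Q * 'rV[int]_n -> LA -> Prop)
  (rho : 'rV[int]_n -> 'rV[int]_n) (x : Q * 'rV[int]_n) (f : LA) : Prop :=
  (exists mu, gen_subgroup (supp_of (coarse comp)) mu /\ rho mu = x.2 /\
     comp (x.1, mu) f) \/ f = la0.

Definition regrade_s (Q : zmodType) (comp : Q * 'rV[int]_n -> LA -> Prop)
  (s : Q -> 'rV[int]_n) (x : Q * 'rV[int]_n) (f : LA) : Prop :=
  comp (x.1, x.2 + s x.1) f.
End Loop.

Definition lie_iso (k : fieldType) (V V' : lmodType k) n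
  (br : V -> V -> V) (br' : V' -> V' -> V')
  (B : LA V n -> Prop) (B' : LA V' n -> Prop) (phi : LA V n -> LA V' n) : Prop :=
  [/\ (forall x, B x -> B' (phi x)),
      (forall y, B' y -> exists x, B x /\ phi x = y),
      (forall x y, B x -> B y -> phi x = phi y -> x = y),
      (forall a x y, B x -> B y ->
          phi (la_add (la_scale a x) y) = la_add (la_scale a (phi x)) (phi y)) &
      (forall x y, B x -> B y -> phi (la_br br x y) = la_br br' (phi x) (phi y))].

Definition support_iso (k : fieldType) (V V' : lmodType k) n
  (G G' : zmodType) (br : V -> V -> V) (br' : V' -> V' -> V')
  (B : LA V n -> Prop) (comp : G -> LA V n -> Prop)
  (B' : LA V' n -> Prop) (comp' : G' -> LA V' n -> Prop) : Prop :=
  exists (phi : LA V n -> LA V' n) (psi : G -> G'),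
  let S := gen_subgroup (supp_of comp) in
  let S' := gen_subgroup (supp_of comp') in
  [/\ lie_iso br br' B B' phi,
      hom_on S psi,
      (forall x y, S x -> S y -> psi x = psi y -> x = y),
      (forall y, S' y <-> exists x, S x /\ psi x = y) &
      (forall x, S x -> forall f', comp' (psi x) f' <->
                   exists f, comp x f /\ phi f = f')].

Definition isograded_iso (k : fieldType) (V V' : lmodType k) n
  (G G' : zmodType) (br : V -> V -> V) (br' : V' -> V' -> V')
  (B : LA V n -> Prop) (comp : G -> LA V n -> Prop)
  (B' : LA V' n -> Prop) (comp' : G' -> LA V' n -> Prop) : Prop :=
  exists (phi : LA V n -> LA V' n) (psi : G -> G'),
  [/\ lie_iso br br' B B' phi,
      {morph psi : x y / x + y},
      bijective psi &
      (forall x f', comp' (psi x) f' <-> exists f, comp x f /\ phi f = f')].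

Section Multiloop.
Variables (k : fieldType) (zeta : nat -> k) (g : vectType k) (br : g -> g -> g)
  (n : nat) (sig : 'I_n -> 'End(g)) (m : 'I_n -> nat) (h : {vspace g}).

(* the (alpha, lambda)-component  g^{lambda bar}_alpha (x) t^lambda *)
Definition ml_comp (x : hdual h * 'rV[int]_n) (f : LA g n) : Prop :=
  [/\ (forall mu, mu != x.2 -> f mu = 0),
      sigsp zeta sig m x.2 (f x.2),
      rootsp br x.1 (f x.2) &
      (in_Qh br x.1 \/ f x.2 = 0)].

Definition ml_alg (f : LA g n) : Prop :=
  exists (s : seq (hdual h * 'rV[int]_n)) (x : hdual h * 'rV[int]_n -> LA g n),
    (forall y, y \in s -> ml_comp y (x y)) /\
    forall mu, f mu = \sum_(y <- s) x y mu.
End Multiloop.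

(* Main.v *)
(* Both (a) and (c) yield an isomorphism Phi of the loop algebras and an additive map psi, on
   the group generated by the support of L, such that Phi sends the component of degree
   (al, mu) into degree psi (al, mu).  For ga in Gamma = (m_i Z)_i the shift by t^ga is a
   centroid element, hence by Schur's lemma it becomes a scalar after composing Phi with the
   evaluation of g' at t = 1.  Rescaling by a character makes this composite factor through
   g, which gives phi : g -> g' carrying the bigraded pieces of g to eigenvectors of sigma'.
   On Gamma the map psi is a bijection onto Gamma', which defines P, and the discrepancy
   between psi and its linear extension from Gamma is s.

   Conversely, given (b), the subspaces phi(h) and h' are maximal among the sigma'-fixed
   subspaces of commuting ad-diagonalizable elements.  These are conjugate under automorphisms
   commuting with sigma': one moves generic elements H1, H2 with rational eigenvalues by
   correcting H1 within the positive part N1 so that it lands in the nonnegative part P2, which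
   is possible since N1 + P2 is the Killing-orthogonal of a subspace P1 /\ N2 of elements z
   with tr (ad H1 ad z) = 0.  An element X with X - H1 in N1 is the image of H1 under an
   automorphism identifying the eigenspaces of ad H1 and ad X, so no exponentials are needed.
   Once phi(h) = h', the formula (mu/m - s(al)) P m' defines psi, hence Phi, and multiplying
   degrees by a common denominator N of s, shifting by N s, and then applying the linear map
   A/N with A = diag(1/m) P diag(m') is the required chain of regradings. *)
Require Import Defs.
From HB Require Import structures.
From mathcomp Require Import all_boot all_order all_algebra.
From mathcomp Require boolp classical_sets.
From Stdlib Require ClassicalEpsilon.
Set Implicit Arguments. Unset Strict Implicit. Unset Printing Implicit Defensive.
Import Order.TTheory GRing.Theory Num.Theory.
Local Open Scope ring_scope.

(** * Direct sum decompositions and joint eigenspaces *)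

(** The ground field carries no order and no distinguished rational structure. Where an ordering
    argument is wanted, the substitute is an additive map to [rat] that is nonzero on finitely many
    prescribed nonzero elements. On [k] it turns a vanishing trace into a vanishing sum of squares,
    which gives nondegeneracy of the Killing form; on the dual of a toral subalgebra it produces an
    element with rational eigenvalues whose centralizer is that of the whole subalgebra.
    Nondegeneracy makes every derivation inner, and this is how semisimple parts, and derivations
    prescribed on a grading, are realized by elements of [g]. Two features of the degrees shape the
    rest. Degrees in Z^n that agree modulo Gamma give the same eigenspace of [g], so direct sum
    decompositions are indexed by eigenvalues, and degrees are kept as nonunique labels. And (c)
    controls only the Z^n-degree of the final isomorphism, so the reconstruction of (b) works with a
    degree map into Z^n alone and assumes no injectivity of it. *)

Definition lin_closed (k : fieldType) (V : lmodType k) (W : V -> Prop) : Prop :=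
  W 0 /\ forall a x y, W x -> W y -> W (a *: x + y).

Section LinClosed.
Variables (k : fieldType) (V : lmodType k) (W : V -> Prop).
Hypothesis WP : lin_closed W.

Lemma lin_closedD x y : W x -> W y -> W (x + y).
Proof. by move=> Wx Wy; rewrite -[x]scale1r; apply: WP.2. Qed.

Lemma lin_closedZ a x : W x -> W (a *: x).
Proof. by move=> Wx; rewrite -[_ *: x]addr0; apply: WP.2 => //; case: WP. Qed.

Lemma lin_closedN x : W x -> W (- x).
Proof. by move=> Wx; rewrite -scaleN1r; apply: lin_closedZ. Qed.

Lemma lin_closedB x y : W x -> W y -> W (x - y).
Proof. by move=> Wx Wy; apply: lin_closedD => //; apply: lin_closedN. Qed.

Lemma lin_closed_sum (I : eqType) (r : seq I) (P : pred I) (F : I -> V) :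
  (forall i, i \in r -> P i -> W (F i)) -> W (\sum_(i <- r | P i) F i).
Proof.
move=> WF; rewrite big_seq_cond; elim/big_ind: _.
- by case: WP.
- by move=> x y; apply: lin_closedD.
- by move=> i /andP[]; apply: WF.
Qed.

Lemma lin_closedZV a x : a != 0 -> W (a *: x) -> W x.
Proof. by move=> a0 Wx; rewrite -[x](scalerK a0); apply: lin_closedZ. Qed.
End LinClosed.

Section Decomposition.
Variables (k : fieldType) (V : vectType k) (I : eqType) (E : I -> V -> Prop).

Definition sumof (x : V) : Prop :=
  exists s : seq (I * V), (forall p, p \in s -> E p.1 p.2) /\ x = \sum_(p <- s) p.2.

Definition indep : Prop := forall (s : seq I) (v : I -> V), uniq s ->
  (forall i, i \in s -> E i (v i)) -> \sum_(i <- s) v i = 0 ->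
  forall i, i \in s -> v i = 0.

Definition projections (s : seq I) (p : I -> 'End(V)) : Prop :=
  [/\ uniq s, forall x, x = \sum_(i <- s) p i x, forall i x, E i (p i x),
      forall i x, E i x -> p i x = x &
      forall i j x, E j x -> i != j -> p i x = 0].

Lemma sumof_in i x : E i x -> sumof x.
Proof.
move=> Eix; exists [:: (i, x)]; split; last by rewrite big_seq1.
by move=> p; rewrite inE => /eqP ->.
Qed.

Hypothesis Elin : forall i, lin_closed (E i).

Lemma sumof_lin : lin_closed sumof.
Proof.
split; first by exists [::]; rewrite big_nil.
move=> a x y [s [sE ->]] [t [tE ->]].
exists ([seq (p.1, a *: p.2) | p <- s] ++ t); split.
  move=> p; rewrite mem_cat => /orP[/mapP[q qs ->]|/tE//].
  by rewrite /=; apply: lin_closedZ => //; apply: sE.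
by rewrite big_cat big_map /= scaler_sumr.
Qed.

Lemma sumof_family x : sumof x -> exists (s : seq I) (c : I -> V),
  [/\ uniq s, forall i, E i (c i), forall i, i \notin s -> c i = 0 &
      x = \sum_(i <- s) c i].
Proof.
case=> s [sE ->].
exists (undup (map fst s)), (fun i => \sum_(p <- s | p.1 == i) p.2); split.
- exact: undup_uniq.
- move=> i; apply: lin_closed_sum => // p /sE Ep /eqP <-; exact: Ep.
- move=> i; rewrite mem_undup => /mapP nis.
  rewrite big_seq_cond big1 // => p /andP[ps /eqP pi].
  by case: nis; exists p.
- rewrite (exchange_big_dep predT) //= big_seq [RHS]big_seq.
  apply: eq_bigr => p ps.
  rewrite -big_filter (_ : [seq _ <- _ | _] = [:: p.1]) ?big_seq1 //.
  rewrite (eq_filter (a2 := pred1 p.1)) => [|i]; last by rewrite /= eq_sym.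
  by rewrite filter_pred1_uniq ?undup_uniq // mem_undup map_f.
Qed.

Hypothesis Eindep : indep.

(** Each basis vector is decomposed by choice and [p i] is extended linearly from the chosen
    [i]-components. Independence makes the result insensitive to the choices. Only finitely many
    indices occur, even if [I] is infinite. *)
Lemma exists_projections : (forall x, sumof x) ->
  exists (s : seq I) (p : I -> 'End(V)), projections s p.
Proof.
move=> Espan; pose b := vbasis (fullv : {vspace V}).
have /boolp.choice[f fP] : forall j : 'I_(\dim (fullv : {vspace V})),
  exists sc : seq I * (I -> V),
  [/\ uniq sc.1, forall i, E i (sc.2 i), forall i, i \notin sc.1 -> sc.2 i = 0 &
      b`_j = \sum_(i <- sc.1) sc.2 i].
  by move=> j; have [s [c ?]] := sumof_family (Espan b`_j); exists (s, c).
pose s := undup (flatten [seq (f j).1 | j <- enum 'I_(\dim (fullv : {vspace V}))]).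
have sf j i : i \notin s -> (f j).2 i = 0.
  move=> nis; have [_ _ + _] := fP j; apply; apply: contra nis => fji.
  by rewrite mem_undup; apply/flatten_mapP; exists j; rewrite ?mem_enum.
have us : uniq s by apply: undup_uniq.
pose p i := linfun (fun x => \sum_j coord b j x *: (f j).2 i).
have plin i : linear (fun x : V => \sum_j coord b j x *: (f j).2 i).
  move=> a x y; rewrite scaler_sumr -big_split; apply: eq_bigr => j _ /=.
  by rewrite linearP /= scalerDl scalerA.
have pE i x : p i x = \sum_j coord b j x *: (f j).2 i.
  pose L := GRing.isLinear.Build _ _ _ _ _ (plin i).
  pose F : {linear V -> V} := HB.pack (fun x : V => \sum_j coord b j x *: (f j).2 i) L.
  exact: (lfunE F).
have psum x : x = \sum_(i <- s) p i x.
  rewrite {1}(coord_vbasis (memvf x)) (eq_bigr _ (fun i _ => pE i x)) exchange_big /=.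
  apply: eq_bigr => j _; rewrite -scaler_sumr; congr (_ *: _).
  have [uf _ f0 ->] := fP j.
  rewrite [RHS](bigID (fun i => i \in (f j).1)) /= [X in _ = _ + X]big1 ?addr0; last first.
    by move=> i; apply: f0.
  rewrite -[RHS]big_filter; apply: perm_big; apply: uniq_perm => //.
    by rewrite filter_uniq.
  move=> i; rewrite mem_filter; case fji: (i \in (f j).1) => //=.
  by rewrite mem_undup; apply/esym/flatten_mapP; exists j; rewrite ?mem_enum.
have pin i x : E i (p i x).
  rewrite pE; apply: lin_closed_sum => // j _ _; apply: lin_closedZ => //.
  by have [_ + _ _] := fP j.
have pns i x : i \notin s -> p i x = 0.
  by move=> nis; rewrite pE big1 // => j _; rewrite sf // scaler0.
(* Two decompositions of [x] are compared: the one given by [p], and the single term [x] at index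
   [i]. Their difference sums to 0. *)
have key i x j : E i x -> p j x = if j == i then x else 0.
  move=> Eix; have [js|njs] := boolP (j \in i :: s); last first.
    move: njs; rewrite inE => /norP[/negPf-> /pns ->//].
  pose s' := undup (i :: s).
  pose v j := p j x - (if j == i then x else 0).
  suff /eqP: v j = 0 by rewrite subr_eq0 => /eqP.
  have js' : j \in s' by rewrite mem_undup.
  apply: (Eindep _ _ _ js'); rewrite ?undup_uniq //.
    move=> l _; apply: lin_closedB => //; case: eqP => [->//|_]; exact: (Elin l).1.
  rewrite sumrB; apply/eqP; rewrite subr_eq0; apply/eqP.
  rewrite -big_mkcond -big_filter filter_pred1_uniq ?undup_uniq ?mem_undup ?mem_head //.
  rewrite big_seq1 [RHS]psum (bigID (fun i => i \in s)) /= [X in _ + X]big1 ?addr0; last first.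
    by move=> l; apply: pns.
  rewrite -big_filter; apply: perm_big; apply: uniq_perm; rewrite ?filter_uniq ?undup_uniq //.
  by move=> l; rewrite mem_filter (mem_undup (i :: s)) inE; case: (l \in s); rewrite ?orbT.
exists s, p; split=> //.
  by move=> i x Ex; rewrite (key _ _ i Ex) eqxx.
by move=> i j x Ex /negPf ij; rewrite (key _ _ i Ex) ij.
Qed.
End Decomposition.

Lemma indep_sub (k : fieldType) (V : vectType k) (I : eqType) (E E' : I -> V -> Prop) :
  (forall i x, E i x -> E' i x) -> indep E' -> indep E.
Proof. by move=> EE' Eind s v us vE; apply: Eind => // i /vE/EE'. Qed.

Section Projections.
Variables (k : fieldType) (V : vectType k) (I : eqType) (E : I -> V -> Prop).
Variables (s : seq I) (p : I -> 'End(V)).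
Hypothesis pP : projections E s p.

Lemma proj_out i x : i \notin s -> p i x = 0.
Proof.
have [_ psum pin pid p0] := pP => nis; rewrite (psum x) linear_sum big_seq big1 // => j js.
by apply: (p0 _ j) => //; apply: contraNneq nis => ->.
Qed.

Lemma proj_comm (u : 'End(V)) : (forall i x, E i x -> E i (u x)) ->
  forall i x, p i (u x) = u (p i x).
Proof.
have [us psum pin pid p0] := pP => uE i x.
rewrite {1}(psum x) !linear_sum.
have [is_|nis] := boolP (i \in s); last first.
  rewrite (proj_out _ nis) linear0 big_seq big1 // => j js.
  by apply: (p0 _ j); [apply: uE|apply: contraNneq nis => ->].
rewrite (bigD1_seq i) //= big1 ?addr0 => [|j ji]; first by rewrite pid //; apply: uE.
by apply: (p0 _ j); [apply: uE|rewrite eq_sym].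
Qed.

Lemma proj_neq0 x : x != 0 -> exists2 i, i \in s & p i x != 0.
Proof.
have [us psum _ _ _] := pP => x0.
have [/hasP[i is_ pi]|/hasPn n] := boolP (has (fun i => p i x != 0) s); first by exists i.
by case/negP: x0; rewrite (psum x) big_seq big1 // => i /n; rewrite negbK => /eqP.
Qed.

Lemma projK i j x : p i (p j x) = if i == j then p j x else 0.
Proof.
have [_ _ pin pid p0] := pP.
by case: eqP => [->|/eqP]; [apply: pid|apply: (p0 _ j)].
Qed.

Lemma lfun_eq_on_pieces (u v : 'End(V)) :
  (forall i x, E i x -> u x = v x) -> u = v.
Proof.
have [us psum pin _ _] := pP => uv; apply/lfunP => x.
by rewrite (psum x) !linear_sum; apply: eq_bigr => i _; apply: uv.
Qed.
End Projections.

Section JointEigenspaces.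
Variables (k : fieldType) (V : vectType k) (I : eqType) (J : Type).
Variables (f : J -> 'End(V)) (ev : I -> J -> k).
Definition joint_eigen (i : I) (x : V) : Prop := forall j, f j x = ev i j *: x.

Lemma joint_eigen_lin i : lin_closed (joint_eigen i).
Proof.
split=> [j|a x y Ex Ey j]; first by rewrite linear0 scaler0.
by rewrite linearP /= Ex Ey scalerDr !scalerA mulrC.
Qed.

Hypothesis ev_sep : forall i i', (forall j, ev i j = ev i' j) -> i = i'.

(** Applying [f j - ev i0 j], for a [j] separating [i0] from [i], removes the [i0]-summand and
    multiplies the [i]-summand by a nonzero scalar, so induction applies. With [W] zero this is
    independence; for an invariant [W] it shows that [W] contains the components of its elements. *)
Lemma joint_eigen_sub (W : V -> Prop) : lin_closed W ->
  (forall j x, W x -> W (f j x)) ->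
  forall (s : seq I) (v : I -> V), uniq s ->
  (forall i, i \in s -> joint_eigen i (v i)) -> W (\sum_(i <- s) v i) ->
  forall i, i \in s -> W (v i).
Proof.
move=> WP Wf; elim=> [//|i0 s IHs] v /= /andP[ni0 us] vE Wsum.
have Ws i : i \in s -> W (v i).
  move=> is_; have /boolp.existsNP[j evj] : ~ forall j, ev i0 j = ev i j.
    by move=> /ev_sep e; rewrite e is_ in ni0.
  have evj' : ev i j - ev i0 j != 0 by rewrite subr_eq0 eq_sym; apply/eqP.
  apply: (lin_closedZV WP evj').
  apply: (IHs (fun i => (ev i j - ev i0 j) *: v i)) => //.
    by move=> l ls; apply: (lin_closedZ (joint_eigen_lin l)); apply: vE; rewrite inE ls orbT.
  have := lin_closedB WP (Wf j _ Wsum) (lin_closedZ WP (ev i0 j) Wsum).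
  rewrite !big_cons (linearD (f j)) /= scalerDr (vE i0 (mem_head _ _) j) opprD addrACA subrr add0r.
  rewrite (linear_sum (f j)) scaler_sumr -sumrB; congr (W _).
  rewrite [LHS]big_seq [RHS]big_seq; apply: eq_bigr => l ls.
  by rewrite /= (vE l) ?scalerBl // inE ls orbT.
move=> i; rewrite inE => /orP[/eqP ->|]; last exact: Ws.
move: Wsum; rewrite big_cons => Wsum; rewrite -[v i0](addrK (\sum_(j <- s) v j)).
by apply: lin_closedB => //; apply: lin_closed_sum => // l ls _; apply: Ws.
Qed.

Lemma joint_eigen_indep : indep joint_eigen.
Proof.
move=> s v us vE s0 i is_.
apply: (joint_eigen_sub (W := fun x => x = 0) _ _ us vE _ is_) => //.
  by split=> // a x y -> ->; rewrite scaler0 addr0.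
by move=> j x ->; rewrite linear0.
Qed.

Lemma joint_proj_sub (W : V -> Prop) s p : lin_closed W ->
  (forall j x, W x -> W (f j x)) -> projections joint_eigen s p ->
  forall i x, W x -> W (p i x).
Proof.
move=> WP Wf pP i x Wx; have [us psum pin _ _] := pP.
have [is_|nis] := boolP (i \in s); last by rewrite (proj_out pP) //; case: WP.
apply: (joint_eigen_sub WP Wf us (v := fun i => p i x)) => //.
by rewrite -psum.
Qed.
End JointEigenspaces.

(** * Additive maps from torsion-free abelian groups to the rationals *)

Section AdditiveFunctional.
Variable (V : zmodType).
Hypothesis V_tf : forall (n : nat) (x : V), x *+ n.+1 = 0 -> x = 0.

Let graph := V * rat -> Prop.
(** Graphs of partial additive maps to [rat] with value 1 at [a]; given closure under differences,
    the last clause makes the relation single-valued. *)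
Let good (a : V) (G : graph) : Prop :=
  [/\ G (a, 1), (forall x q y r, G (x, q) -> G (y, r) -> G (x - y, q - r)) &
      forall q, G (0, q) -> q = 0].

Let goodZ a G x q (m : int) : good a G -> G (x, q) -> G (x *~ m, q *~ m).
Proof.
case=> Ga GB G0 Gx; have G00 : G (0, 0) by have := GB _ _ _ _ Ga Ga; rewrite !subrr.
have GN y r : G (y, r) -> G (- y, - r) by rewrite -(sub0r y) -(sub0r r); apply: GB.
have Gn n : G (x *+ n, q *+ n).
  elim: n => [//|n IHn]; rewrite !mulrSr.
  by have := GB _ _ _ _ IHn (GN _ _ Gx); rewrite !opprK.
by case: m => n; [exact: Gn|rewrite NegzE !mulrNz; apply: GN; apply: Gn].
Qed.

Let tfz (m : int) (x : V) : m != 0 -> x *~ m = 0 -> x = 0.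
Proof.
case: m => [[|n]|n] // _; first exact: V_tf.
by move=> /eqP; rewrite NegzE mulrNz oppr_eq0 => /eqP; apply: V_tf.
Qed.

(** If a nonzero multiple [v *~ m] already has a value [q], the value at [v] must be [q / m];
    otherwise any value works and 0 is taken. *)
Let good_extend a G v : good a G -> exists G', [/\ good a G',
  forall x, G x -> G' x & exists q, G' (v, q)].
Proof.
move=> gG; have [Ga GB G0] := gG.
have [r rP] : exists r : rat, forall m q, m != 0 -> G (v *~ m, q) -> q = r *~ m.
  have [[[m q] /= m0 Gmq]|no] :=
      boolp.EM (exists2 mq : int * rat, mq.1 != 0 & G (v *~ mq.1, mq.2)); last first.
    by exists 0 => m q m0 Gmq; case: no; exists (m, q).
  exists (q / m%:~R) => m' q' m'0 Gm'.
  have := GB _ _ _ _ (goodZ m' gG Gmq) (goodZ m gG Gm').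
  rewrite -!mulrzA [m * m']mulrC subrr => /G0/eqP; rewrite subr_eq0 => /eqP e.
  have mr0 : m%:~R != 0 :> rat by rewrite intr_eq0.
  by apply: (mulIf mr0); rewrite mulrzAl divfK // mulrzr e.
exists (fun y => exists x q m, G (x, q) /\ y = (x + v *~ m, q + r *~ m)); split.
- split; first by exists a, 1, 0; rewrite !mulr0z !addr0.
    move=> _ _ _ _ [x [q [m [Gx [-> ->]]]]] [y [t [l [Gy [-> ->]]]]].
    exists (x - y), (q - t), (m - l); split; first exact: GB.
    by congr pair; rewrite mulrzBr opprD addrACA.
  move=> _ [x [q [m [Gx [/esym xm ->]]]]].
  have [m0|m0] := eqVneq m 0.
    by move: xm Gx; rewrite m0 !mulr0z !addr0 => -> /G0.
  move/eqP: xm; rewrite addr_eq0 -mulrNz => /eqP xm; rewrite xm in Gx.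
  by rewrite (rP (- m) q) ?oppr_eq0 // mulrNz addNr.
- by move=> [x q] Gx; exists x, q, 0; rewrite !mulr0z !addr0.
- by exists r, 0, 0, 1; rewrite !mulr1z !add0r; split=> //; have := GB _ _ _ _ Ga Ga; rewrite !subrr.
Qed.

Let additive_at (a : V) : a != 0 ->
  exists F : V -> rat, {morph F : x y / x + y} /\ F a = 1.
Proof.
move=> a0; pose P (G : graph) := (forall x, ~ G x) \/ good a G.
have [G [PG Gmax]] : exists G : graph, P G /\
    forall G' : graph, classical_sets.proper G G' -> ~ P G'.
  apply: (classical_sets.Zorn_bigcup (P := P)) => F FP Ftot.
  have [[G FG nG]|no] := boolp.EM (exists2 G, F G & exists x, G x); last first.
    by left=> x [G FG Gx]; case: no; exists G => //; exists x.
  right; have gG G' x : F G' -> G' x -> good a G'.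
    by move=> /FP[/(_ x)//|].
  split.
  - by case: nG => x Gx; exists G => //; have [] := gG G x FG Gx.
  - move=> x q y r [G1 F1 Gx] [G2 F2 Gy].
    have [s12|s21] := Ftot _ _ F1 F2.
      by exists G2 => //; have [_ + _] := gG _ _ F2 Gy; apply => //; apply: s12.
    by exists G1 => //; have [_ + _] := gG _ _ F1 Gx; apply => //; apply: s21.
  - by move=> q [G1 F1 Gx]; have [_ _] := gG _ _ F1 Gx; apply.
have gG : good a G.
  case: PG => // nG; case: (Gmax (fun x => exists m, x = (a *~ m, m%:~R))).
    split; first by move=> x /nG.
    by move=> /(_ (a, 1)) h; apply: (nG (a, 1)); apply: h; exists 1; rewrite !mulr1z.
  right; split; first by exists 1; rewrite !mulr1z.
    move=> _ _ _ _ [m [-> ->]] [l [-> ->]]; exists (m - l).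
    by rewrite !mulrzBr.
  move=> _ [m [/esym am ->]]; have [->//|m0] := eqVneq m 0.
  by move: a0; rewrite (tfz m0 am) eqxx.
have tot v : exists q, G (v, q).
  have [G' [gG' sG [q Gq]]] := good_extend v gG; exists q.
  apply: boolp.contrapT => nGq; apply: (Gmax G'); last by right.
  by split=> // /(_ _ Gq).
have [F FP] := boolp.choice tot; have [Ga GB G0] := gG.
have funG x q : G (x, q) -> F x = q.
  by move=> Gx; apply/eqP; rewrite -subr_eq0; apply/eqP/G0; rewrite -(subrr x); apply: GB.
have FB x y : F (x - y) = F x - F y by apply: funG; apply: GB.
have FN x : F (- x) = - F x by rewrite -sub0r FB (_ : F 0 = 0) ?sub0r // -(subrr a) FB subrr.
exists F; split; last exact: funG.
by move=> x y; rewrite -[y in LHS]opprK FB FN opprK.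
Qed.

(** A functional [F] that works for [s] is corrected by [c * G] with [G a = 1]. Only the finitely
    many values [c = - F b / G b] create a zero, and some natural number avoids them. *)
Lemma additive_functional (s : seq V) :
  exists F : V -> rat, {morph F : x y / x + y} /\
    forall a, a \in s -> a != 0 -> F a != 0.
Proof.
elim: s => [|a s [F [Fadd Fs]]].
  by exists (fun=> 0); split=> // x y; rewrite addr0.
have [->|a0] := eqVneq a 0.
  by exists F; split=> // b; rewrite inE => /orP[/eqP ->|/Fs//]; rewrite eqxx.
have [G [Gadd Ga]] := additive_at a0.
pose bad := [seq - (F b / G b) | b <- a :: s].
have [c cbad] : exists c : nat, c%:R \notin bad.
  have [/hasP[c _ cP]|/hasPn h] := boolP (has (fun c : nat => c%:R \notin bad) (iota 0 (size bad).+1)).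
    by exists c.
  have : (size (iota 0 (size bad).+1) <= size bad)%N.
    rewrite -(size_map (fun c : nat => c%:R : rat)); apply: uniq_leq_size.
      rewrite map_inj_uniq ?iota_uniq // => x y /eqP; rewrite eqr_nat => /eqP//.
    by move=> _ /mapP[i /h + ->]; rewrite negbK.
  by rewrite size_iota ltnn.
exists (fun x => F x + c%:R * G x); split.
  by move=> x y; rewrite Fadd Gadd mulrDr addrACA.
move=> b bs b0; have [Gb0|Gb0] := eqVneq (G b) 0.
  rewrite Gb0 mulr0 addr0; move: bs; rewrite inE => /orP[/eqP ba|/Fs]; last exact.
  by move: Gb0; rewrite ba Ga => /eqP; rewrite oner_eq0.
apply: contra cbad => /eqP e; apply/mapP; exists b => //.
by apply: (mulIf Gb0); rewrite mulNr divfK //; apply/eqP; rewrite -addr_eq0 addrC e.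
Qed.
End AdditiveFunctional.

Section Ratr.
Variable (k : fieldType).
Hypothesis k0 : [pchar k] =i pred0.

Lemma pchar0_intr_eq0 (z : int) : (z%:~R == 0 :> k) = (z == 0).
Proof.
case: z => n; first by rewrite ((pcharf0P k).1 k0).
by rewrite NegzE mulrNz oppr_eq0 ((pcharf0P k).1 k0).
Qed.

Let den0 q : (denq q)%:~R != 0 :> k.
Proof. by rewrite pchar0_intr_eq0 denq_neq0. Qed.

(** Nonzero integers stay invertible in [k], so passing to the reduced fraction changes nothing;
    additivity of [ratr] then follows with common denominators. *)
Lemma ratr_frac (a b : int) : b != 0 -> ratr (a%:~R / b%:~R) = a%:~R / b%:~R :> k.
Proof.
move=> b0; have b0' : b%:~R != 0 :> rat by rewrite intr_eq0.
set q := _ / _; have : numq q * b = a * denq q.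
  apply/eqP; rewrite -(eqr_int rat) !rmorphM /= -[X in _ == _ * X]/((denq q)%:~R).
  by rewrite [(numq q)%:~R]numqE mulrAC divfK.
move/(congr1 (fun z : int => z%:~R : k)); rewrite !rmorphM /= => e.
by apply: (mulIf (den0 q)); rewrite divfK // mulrAC -e mulfK // pchar0_intr_eq0.
Qed.

Lemma pchar0_ratrD : {morph (@ratr k) : x y / x + y}.
Proof.
move=> x y; have dx := den0 x; have dy := den0 y.
rewrite -{1}[x]divq_num_den -{1}[y]divq_num_den addf_div ?intr_eq0 ?denq_neq0 //.
rewrite -!rmorphM -rmorphD /= ratr_frac ?mulf_neq0 ?denq_neq0 //.
by rewrite rmorphD !rmorphM /= -addf_div.
Qed.

Lemma pchar0_ratr_eq0 q : (ratr q == 0 :> k) = (q == 0).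
Proof.
by rewrite /ratr mulf_eq0 invr_eq0 (negPf (den0 q)) orbF pchar0_intr_eq0 numq_eq0.
Qed.

Lemma pchar0_ratrB : {morph (@ratr k) : x y / x - y}.
Proof.
have r0 : ratr 0 = 0 :> k by apply/eqP; rewrite pchar0_ratr_eq0.
move=> x y; apply/eqP; rewrite eq_sym subr_eq -pchar0_ratrD subrK //.
Qed.

Lemma pchar0_ratr_inj : injective (@ratr k).
Proof.
by move=> x y /eqP; rewrite -subr_eq0 -pchar0_ratrB pchar0_ratr_eq0 subr_eq0 => /eqP.
Qed.

Lemma additive_ratrM (F : k -> rat) : {morph F : x y / x + y} ->
  forall q a, F (a * ratr q) = F a * q.
Proof.
move=> FD; have F0 : F 0 = 0 by apply: (@addrI _ (F 0)); rewrite -FD !addr0.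
have FN a : F (- a) = - F a by apply: (@addrI _ (F a)); rewrite -FD !subrr.
have Fn n a : F (a *+ n) = F a *+ n by elim: n => [//|n IHn]; rewrite !mulrS FD IHn.
have Fz z a : F (a * z%:~R) = F a * z%:~R.
  by rewrite !mulrzr; case: z => n; rewrite ?Fn // NegzE !mulrNz FN Fn.
move=> q a; have dq : (denq q)%:~R != 0 :> rat by rewrite intr_eq0 denq_neq0.
apply: (mulIf dq); rewrite -Fz -mulrA divfK ?den0 // Fz -mulrA.
by rewrite -{2}[q]divq_num_den divfK.
Qed.

Lemma pchar0_lmod_tf (V : lmodType k) (n : nat) (x : V) : x *+ n.+1 = 0 -> x = 0.
Proof.
by move/eqP; rewrite -scaler_nat scaler_eq0 ((pcharf0P k).1 k0) => /eqP.
Qed.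
End Ratr.

(** * Traces of endomorphisms *)

Section Trace.
Variables (k : fieldType) (V : vectType k).
Let b := vbasis (fullv : {vspace V}).

Definition lmx (f : 'End(V)) : 'M[k]_(\dim (fullv : {vspace V})) :=
  \matrix_(i, j) coord b j (f b`_i).

Definition ltr (f : 'End(V)) : k := \tr (lmx f).

Lemma lmx_is_linear : linear lmx.
Proof. by move=> a f g; apply/matrixP=> i j; rewrite !mxE !lfunE /= lfunE linearP. Qed.
HB.instance Definition _ := GRing.isLinear.Build _ _ _ _ lmx lmx_is_linear.

Lemma lmx_comp f g : lmx (f \o g)%VF = lmx g *m lmx f.
Proof.
apply/matrixP=> i j; rewrite !mxE comp_lfunE {1}(coord_vbasis (memvf (g b`_i))).
rewrite !linear_sum; apply: eq_bigr => l _.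
by rewrite !mxE !linearZ.
Qed.

Lemma ltr_is_linear : linear_for *%R ltr.
Proof. by move=> a f g; rewrite /ltr linearP /= linearD linearZ. Qed.
HB.instance Definition _ := GRing.isLinear.Build _ _ _ *%R ltr ltr_is_linear.

Lemma ltrC f g : ltr (f \o g)%VF = ltr (g \o f)%VF.
Proof. by rewrite /ltr !lmx_comp mxtrace_mulC. Qed.

Lemma lmx_coord (f : 'End(V)) x : (\row_j coord b j (f x)) = (\row_j coord b j x) *m lmx f.
Proof.
apply/rowP=> j; rewrite !mxE {1}(coord_vbasis (memvf x)) !linear_sum.
by apply: eq_bigr => l _; rewrite !mxE !linearZ.
Qed.

(** In the rank factorization [A = C R], idempotence cancels to [R C = 1], so the trace is that of
    an identity matrix whose size is the rank. *)
Lemma mxtrace_idempotent n (A : 'M[k]_n) : A *m A = A -> \tr A = (\rank A)%:R.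
Proof.
move: (col_base_full A) (row_base_free A) (mulmx_base A).
move: (col_base A) (row_base A) => C R Cf Rf CR AA.
have RC : R *m C = 1%:M.
  by apply: (row_free_inj Rf); apply: (row_full_inj Cf); rewrite mul1mx !mulmxA CR -mulmxA CR.
by rewrite -{1}CR mxtrace_mulC RC mxtrace1.
Qed.

Lemma ltr_idempotent (f : 'End(V)) : (f \o f)%VF = f -> f != 0 -> exists n : nat, ltr f = n.+1%:R.
Proof.
move=> ff f0; rewrite /ltr mxtrace_idempotent -?lmx_comp ?ff //.
suff: (0 < \rank (lmx f))%N by case: (\rank _) => // n _; exists n.
rewrite lt0n mxrank_eq0; apply: contra f0 => /eqP m0; apply/eqP/lfunP => x.
have := lmx_coord f x; rewrite m0 mulmx0 lfunE /= => /rowP h.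
rewrite (coord_vbasis (memvf (f x))) big1 // => i _.
by have := h i; rewrite !mxE => ->; rewrite scale0r.
Qed.
End Trace.

Section SpanBy.
Variables (k : fieldType) (V : vectType k).

Definition span_by (P : V -> Prop) (x : V) : Prop :=
  exists s : seq V, (forall v, v \in s -> P v) /\ x = \sum_(v <- s) v.

Lemma span_by_sub (P P' : V -> Prop) x : (forall v, P v -> P' v) -> span_by P x -> span_by P' x.
Proof. by move=> PP' [s [sP ->]]; exists s; split=> // v /sP/PP'. Qed.

Lemma span_by_sum (P : V -> Prop) (I : Type) (r : seq I) (F : I -> V) :
  (forall i, span_by P (F i)) -> span_by P (\sum_(i <- r) F i).
Proof.
move=> FP; elim: r => [|i r [s [sP e]]]; first by rewrite big_nil; exists [::]; rewrite big_nil.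
have [t [tP ti]] := FP i; exists (t ++ s); rewrite big_cons big_cat -ti -e; split=> // v.
by rewrite mem_cat => /orP[/tP|/sP].
Qed.

End SpanBy.

(** * Generalized eigenspaces and simultaneous diagonalization *)

Section Spectral.
Variables (k : closedFieldType) (V : vectType k).

(** All eigenvalues are 0, so the characteristic polynomial is a power of X and its subleading
    coefficient vanishes. *)
Lemma mxtrace_nilpotent n (A : 'M[k]_n) :
  (exists N, forall u : 'rV_n, iter N (fun u => u *m A) u = 0) -> \tr A = 0.
Proof.
case: n A => [|n] A [N AN]; first by rewrite /mxtrace big_ord0.
have eig0 a : root (char_poly A) a -> a = 0.
  rewrite -eigenvalue_root_char => /eigenvalueP[u uA u0].
  have : iter N (fun u => u *m A) u = a ^+ N *: u.
    elim: N {AN} => [|N IHN]; first by rewrite expr0 scale1r.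
    by rewrite /= IHN -scalemxAl uA scalerA exprSr.
  rewrite AN => /esym/eqP; rewrite scaler_eq0 (negPf u0) orbF expf_eq0 => /andP[_ /eqP//].
have [r rP] := closed_field_poly_normal (char_poly A).
have := char_poly_trace A (ltn0Sn n); rewrite /=.
move: rP; rewrite (monicP (char_poly_monic A)) scale1r => rP.
have : r = nseq (size r) 0.
  apply/all_pred1P/allP => a ar; apply/eqP/eig0.
  by rewrite rP root_prod_XsubC.
move=> rE; have sr : size r = n.+1.
  by apply: succn_inj; rewrite -(size_char_poly A) rP size_prod_XsubC.
have -> : char_poly A = 'X^(n.+1).
  rewrite rP rE sr; elim: n.+1 => [|m IHm]; first by rewrite big_nil.
  by rewrite big_cons IHm subr0 exprS.
by rewrite coefXn /= (ltn_eqF (ltnSn n)) => /esym/eqP; rewrite oppr_eq0 => /eqP.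
Qed.

Lemma ltr_nilpotent (f : 'End(V)) (N : nat) :
  (forall x, iter N f x = 0) -> ltr f = 0.
Proof.
move=> fN; apply: mxtrace_nilpotent; exists N => u.
pose x := \sum_i u 0 i *: (vbasis (fullv : {vspace V}))`_i.
have xE y (v : 'rV_(\dim (fullv : {vspace V}))) :
    y = \sum_i v 0 i *: (vbasis (fullv : {vspace V}))`_i ->
    \row_j coord (vbasis (fullv : {vspace V})) j y = v.
  by move=> ->; apply/rowP => j; rewrite mxE coord_sum_free // (basis_free (vbasisP _)).
have <- : \row_j coord (vbasis (fullv : {vspace V})) j (iter N f x) =
    iter N (fun u => u *m lmx f) u.
  by elim: N {fN} => [|N IHN]; [apply: xE|rewrite /= lmx_coord IHN].
by rewrite fN; apply/rowP => j; rewrite !mxE linear0.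
Qed.

Definition shift (f : 'End(V)) (a : k) : 'End(V) := (f - a *: \1)%VF.

Lemma shiftE f a x : shift f a x = f x - a *: x.
Proof. by rewrite !lfunE /= opp_lfunE !lfunE /= lfunE. Qed.

Lemma shift0 f : shift f 0 =1 f.
Proof. by move=> x; rewrite shiftE scale0r subr0. Qed.

Lemma shiftC f a x : shift f a (f x) = f (shift f a x).
Proof. by rewrite !shiftE (linearB f) (linearZZ f). Qed.

Definition gen_eigen (f : 'End(V)) (a : k) (x : V) : Prop :=
  exists N, iter N (shift f a) x = 0.

Lemma iter_lfunP (u : 'End(V)) N : linear (iter N u).
Proof. by elim: N => [//|N IHN] a x y; rewrite /= IHN linearP. Qed.

Lemma iter_lfun0 (u : 'End(V)) N : iter N u 0 = 0.
Proof. by elim: N => [//|N IHN] /=; rewrite IHN linear0. Qed.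

Lemma iter_lfun_le (u : 'End(V)) N M x : (N <= M)%N -> iter N u x = 0 -> iter M u x = 0.
Proof. by move=> /subnK <- e; rewrite iterD e iter_lfun0. Qed.

Lemma gen_eigen_lin f a : lin_closed (gen_eigen f a).
Proof.
split; first by exists 0%N.
move=> c x y [N xN] [M yM]; exists (maxn N M).
rewrite iter_lfunP (iter_lfun_le _ xN) ?leq_maxl // (iter_lfun_le _ yM) ?leq_maxr //.
by rewrite scaler0 addr0.
Qed.

Lemma gen_eigen_comm (f u : 'End(V)) a x : (forall y, u (f y) = f (u y)) ->
  gen_eigen f a x -> gen_eigen f a (u x).
Proof.
move=> uf [N xN]; exists N.
suff -> : iter N (shift f a) (u x) = u (iter N (shift f a) x) by rewrite xN linear0.
by elim: N {xN} => [//|N /= ->]; rewrite !shiftE (linearB u) (linearZZ u) /= uf.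
Qed.

Lemma gen_eigen_disjoint (f : 'End(V)) a b x : a != b -> gen_eigen f a x -> gen_eigen f b x -> x = 0.
Proof.
move=> ab + [N]; elim: N x => [//|N IHN] x xa; rewrite iterSr => xN.
have /eqP : shift f b x = 0.
  by apply: IHN => //; apply: gen_eigen_comm xa => y; apply: shiftC.
rewrite shiftE subr_eq0 => /eqP fx; case: xa => M.
have -> : iter M (shift f a) x = (b - a) ^+ M *: x.
  elim: M => [|M /= ->]; first by rewrite expr0 scale1r.
  by rewrite shiftE (linearZZ f) /= fx !scalerA -scalerBl exprSr mulrBr [a * _]mulrC.
by move/eqP; rewrite scaler_eq0 expf_eq0 subr_eq0 [b == a]eq_sym (negPf ab) andbF => /eqP.
Qed.

(** A power of [f - a] kills the [a]-summand and preserves the other generalized eigenspaces. By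
    induction it kills every summand, so the other summands lie in two generalized eigenspaces at
    once. *)
Lemma gen_eigen_indep f : indep (gen_eigen f).
Proof.
elim=> [//|a s IHs] v /= /andP[nas us] vE; rewrite big_cons => v0.
have [N vaN] := vE a (mem_head _ _).
have vs b : b \in s -> v b = 0.
  move=> bs; apply: (@gen_eigen_disjoint f a b); first by apply: contraNneq nas => ->.
    exists N; apply: (IHs (fun b => iter N (shift f a) (v b))) => //.
      move=> c cs; elim: (N) => [|M IHM]; first by apply: vE; rewrite inE cs orbT.
      by apply: gen_eigen_comm IHM => y; apply: shiftC.
    have := congr1 (iter N (shift f a)) v0; rewrite iter_lfun0 -[v a]scale1r iter_lfunP vaN.
    rewrite scaler0 add0r => e; apply: etrans e; elim: s {IHs nas us vE v0 bs} => [|c s IHs].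
      by rewrite !big_nil iter_lfun0.
    by rewrite !big_cons IHs -[v c in RHS]scale1r iter_lfunP scale1r.
  by apply: vE; rewrite inE bs orbT.
move=> b; rewrite inE => /orP[/eqP ->|/vs//]; move: v0.
by rewrite big_seq big1 ?addr0.
Qed.

(** The vector [(f - b) y] is killed by a lower power of [f - b], and [(f - a) z = (f - b) y]
    implies [(f - a) (y - z) = (b - a) y]. *)
Lemma gen_eigen_solve (f : 'End(V)) a b y : a != b -> gen_eigen f b y ->
  exists z, gen_eigen f b z /\ shift f a z = y.
Proof.
move=> ab [N]; elim: N y => [|N IHN] y.
  by move=> /= ->; exists 0; split; [exists 0%N|rewrite linear0].
rewrite iterSr => yN; have [z [bz zy]] := IHN _ yN.
have ba : b - a != 0 by rewrite subr_eq0 eq_sym.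
have by_ : gen_eigen f b y by exists N.+1; rewrite iterSr.
exists ((b - a)^-1 *: (y - z)); split.
  by apply: (lin_closedZ (gen_eigen_lin f b)); apply: (lin_closedB (gen_eigen_lin f b)).
rewrite linearZ linearB /= zy !shiftE opprB addrACA addrC addrA subrK.
by rewrite addrC -scalerBl scalerA mulVf // scale1r.
Qed.

(** Cayley-Hamilton, with the characteristic polynomial split into linear factors. *)
Lemma annihilating_shifts (f : 'End(V)) : exists l, forall x, foldl (fun y a => shift f a y) x l = 0.
Proof.
have [l lP] : exists l, forall u, foldl (fun (u : 'rV_(\dim (fullv : {vspace V}))) a =>
    u *m lmx f - a *: u) u l = 0.
  case: (\dim _) (lmx f) => [|n] A; first by exists [::] => u; rewrite thinmx0.
  have [l lP] := closed_field_poly_normal (char_poly A).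
  rewrite (monicP (char_poly_monic A)) scale1r in lP.
  exists l => u; have -> : foldl (fun u a => u *m A - a *: u) u l =
      u *m horner_mx A (\prod_(z <- l) ('X - z%:P)).
    elim: l u {lP} => [|a l IHl] u; first by rewrite big_nil rmorph1 mulmx1.
    rewrite /= IHl big_cons rmorphM /= rmorphB /= horner_mx_X horner_mx_C -mulmxE mulmxA.
    by rewrite mulmxBr mul_mx_scalar.
  by rewrite -lP Cayley_Hamilton mulmx0.
exists l => x; pose c (y : V) := \row_j coord (vbasis (fullv : {vspace V})) j y.
have cinj y : c y = 0 -> y = 0.
  move=> /rowP h; rewrite (coord_vbasis (memvf y)) big1 // => i _.
  by have := h i; rewrite !mxE => ->; rewrite scale0r.
apply: cinj; rewrite -(lP (c x)).
elim: l x {lP} => [//|a l IHl] x /=; rewrite IHl; congr foldl.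
rewrite shiftE -lmx_coord; apply/rowP => j; rewrite !mxE linearB linearZ //.
Qed.

(** The annihilating shifts are peeled off one at a time. When [(f - a) x] is a sum of generalized
    eigenvectors, its terms for eigenvalues other than [a] lift through [f - a], and what remains of
    [x] is a generalized eigenvector for [a]. *)
Lemma gen_eigen_span f x : sumof (gen_eigen f) x.
Proof.
have slin := sumof_lin (gen_eigen_lin f).
have [l lP] := annihilating_shifts f; move: (lP x) => {lP}.
elim: l x => [|a l IHl] x /= xl; first by rewrite xl; case: slin.
have [s [sE yE]] := IHl _ xl.
have [z [zS zy]] : exists z, sumof (gen_eigen f) z /\ gen_eigen f a (shift f a x - shift f a z).
  rewrite yE; elim: s {xl yE} sE => [|[b y] s IHs] sE.
    by exists 0; rewrite big_nil linear0 subrr; split; [case: slin|exists 0%N].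
  have [|z [zS zy]] := IHs; first by move=> q qs; apply: sE; rewrite inE qs orbT.
  have /= yb := sE _ (mem_head _ _); rewrite big_cons /=.
  have [e|ab] := eqVneq a b.
    exists z; split=> //; rewrite -addrA; apply: (lin_closedD (gen_eigen_lin f a)) => //.
    by rewrite e.
  have [w [wb wy]] := gen_eigen_solve ab yb.
  exists (w + z); split; first by apply: (lin_closedD slin) => //; apply: sumof_in wb.
  by rewrite linearD /= wy opprD addrACA subrr add0r.
rewrite -[x](subrK z); apply: (lin_closedD slin) => //; apply: (@sumof_in _ _ _ _ a).
by case: zy => N; rewrite -linearB -iterSr => xz; exists N.+1.
Qed.

Lemma gen_eigen_projections f : exists s p, projections (gen_eigen f) s p.
Proof.
by apply: exists_projections; [exact: gen_eigen_lin|exact: gen_eigen_indep|exact: gen_eigen_span].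
Qed.

Definition diagonal (f : 'End(V)) : Prop :=
  forall x, span_by (fun v => exists c : k, f v = c *: v) x.

Definition eigen (f : 'End(V)) : k -> V -> Prop :=
  joint_eigen (fun _ : unit => f) (fun a _ => a).

Lemma eigenE f a x : eigen f a x <-> f x = a *: x.
Proof. by split=> [/(_ tt)//|fx []]. Qed.

Lemma eigen_proj_sub (f : 'End(V)) s p (W : V -> Prop) : projections (eigen f) s p ->
  lin_closed W -> (forall x, W x -> W (f x)) -> forall a x, W x -> W (p a x).
Proof.
move=> pP Wlin Wf a x; apply: (joint_proj_sub _ Wlin _ pP) => [b c /(_ tt)//|_].
exact: Wf.
Qed.

Lemma span_by_sumof (I : eqType) (E : I -> V -> Prop) :
  (forall i, lin_closed (E i)) ->
  (forall x, span_by (fun v => exists i, E i v) x) -> forall x, sumof E x.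
Proof.
move=> Elin fd x; have [s [sE ->]] := fd x.
apply: lin_closed_sum; first exact: sumof_lin.
by move=> v /sE[c vc] _; apply: sumof_in vc.
Qed.

Lemma diagonal_projections f : diagonal f -> exists s p, projections (eigen f) s p.
Proof.
move=> fd; apply: exists_projections; first by move=> a; apply: joint_eigen_lin.
  by apply: joint_eigen_indep => a b /(_ tt).
apply: span_by_sumof => // [a|x]; first exact: joint_eigen_lin.
by apply: span_by_sub (fd x) => v [c fv]; exists c; apply/eigenE.
Qed.

(** The eigenprojections of [f] commute with the other operators, so they split a joint eigenvector
    of those into joint eigenvectors of all. *)
Lemma joint_diagonal (fs : seq 'End(V)) :
  (forall f, f \in fs -> diagonal f) ->
  (forall f f', f \in fs -> f' \in fs -> forall x, f (f' x) = f' (f x)) ->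
  forall x, span_by (fun v => forall f, f \in fs -> exists c : k, f v = c *: v) x.
Proof.
elim: fs => [_ _ x|f fs IHfs fd fc x].
  by exists [:: x]; rewrite big_seq1.
have [||s [sP ->]] := IHfs _ _ x.
- by move=> u us; apply: fd; rewrite inE us orbT.
- by move=> u u' us us'; apply: fc; rewrite inE ?us ?us' orbT.
have [t [p pP]] := diagonal_projections (fd f (mem_head _ _)).
rewrite big_seq; elim/big_ind: _ => [|y z [r [rP ->]] [r' [r'P ->]]|v vs].
- by exists [::]; rewrite big_nil.
- exists (r ++ r'); rewrite big_cat; split=> // v.
  by rewrite mem_cat => /orP[/rP|/r'P].
have [_ psum pin _ _] := pP; rewrite (psum v); apply: span_by_sum => a.
exists [:: p a v]; rewrite big_seq1; split=> // w; rewrite inE => /eqP -> u.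
rewrite inE => /orP[/eqP ->|us]; first by exists a; apply/eigenE.
have [c uv] := sP _ vs _ us; exists c; rewrite -(proj_comm pP) ?uv ?linearZ //.
move=> b y /eigenE fy; apply/eigenE.
by rewrite -fc ?mem_head ?inE ?us ?orbT // fy linearZ.
Qed.
End Spectral.

(** * Subspaces, nilpotency and functionals in finite dimension *)

Section FiniteDimension.
Variables (k : fieldType) (V : vectType k).

(** A subspace of maximal dimension inside [W] exhausts [W], since any further vector would enlarge
    it. *)
Lemma lin_closed_vspace (W : V -> Prop) : lin_closed W ->
  exists U : {vspace V}, forall x, x \in U <-> W x.
Proof.
move=> WP; pose Q n := boolp.asbool (exists U : {vspace V},
  (\dim U = n) /\ forall x, x \in U -> W x).
have exQ : exists n, Q n.
  exists 0%N; apply/boolp.asboolP; exists 0%VS; rewrite dimv0; split=> // x.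
  by rewrite memv0 => /eqP ->; case: WP.
have bQ n : Q n -> (n <= \dim (fullv : {vspace V}))%N.
  by move=> /boolp.asboolP[U [<- _]]; rewrite dimvS ?subvf.
have [n /boolp.asboolP[U [dU UW]] nmax] := ex_maxnP exQ bQ.
exists U => x; split=> [/UW//|Wx]; apply: contraT => nxU.
have : Q (\dim (U + <[x]>)%VS).
  apply/boolp.asboolP; exists (U + <[x]>)%VS; split=> // y /memv_addP[u uU [v /vlineP[c ->] ->]].
  by apply: lin_closedD => //; [apply: UW|apply: lin_closedZ].
rewrite -dU in nmax *; move/nmax => dle.
have /eqP e : U == (U + <[x]>)%VS by rewrite eqEdim addvSl.
by case/negP: nxU; rewrite e -{1}[x]add0r memv_add ?mem0v ?memv_line.
Qed.

Lemma uniform_nilpotent (u : 'End(V)) :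
  (forall x, exists N, iter N u x = 0) -> exists N, forall x, iter N u x = 0.
Proof.
move=> /boolp.choice[N NP]; pose e (i : 'I_(\dim (fullv : {vspace V}))) : V := (vbasis fullv)`_i.
have it0 M : iter M u 0 = 0 by elim: M => [//|M /= ->]; rewrite linear0.
have itlin M : linear (iter M u) by elim: M => [//|M IHM] a y z; rewrite /= IHM linearP.
exists (\max_i N (e i)) => x; rewrite (coord_vbasis (memvf x)); set m := \max_i _.
have h i : iter m u (e i) = 0.
  have /subnK <- : (N (e i) <= m)%N by apply: (leq_bigmax (F := fun i => N (e i))).
  by rewrite iterD NP it0.
elim/big_ind: _ => [|y z hy hz|i _]; first exact: it0.
- by rewrite -[y]scale1r itlin hy hz scaler0 addr0.
- by rewrite -[_ *: _]addr0 itlin it0 addr0 h scaler0.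
Qed.

Lemma scalar_on_pieces (I : eqType) (E : I -> V -> Prop) s p (c : I -> k) :
  projections E s p -> exists D : 'End(V),
    D = \sum_(i <- s) c i *: p i /\ forall i x, E i x -> D x = c i *: x.
Proof.
move=> pP; exists (\sum_(i <- s) c i *: p i); split=> // i x Ex.
have [us psum pin pid p0] := pP; rewrite sum_lfunE.
rewrite [in RHS](psum x) scaler_sumr big_seq [RHS]big_seq; apply: eq_bigr => j _.
rewrite lfunE /=; have [->//|ji] := eqVneq j i; by rewrite (p0 _ i) ?scaler0.
Qed.

Lemma represent_functional (B : V -> 'Hom(V, k^o)) : linear B ->
  (forall x, (forall y, B x y = 0) -> x = 0) ->
  forall l : 'Hom(V, k^o), exists d, forall y, B d y = l y.
Proof.
move=> Blin Bnd l.
pose L : {linear V -> 'Hom(V, k^o)} := HB.pack B (GRing.isLinear.Build _ _ _ _ B Blin).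
have Linj : lker (linfun L) == 0%VS.
  apply/eqP/vspaceP => x; rewrite memv0 memv_ker lfunE /=; apply/eqP/eqP => [Bx|->].
    by apply: Bnd => y; rewrite Bx lfunE.
  exact: (linear0 L).
have /eqP Lfull : limg (linfun L) == fullv.
  rewrite eqEdim subvf /= limg_dim_eq ?(eqP Linj) ?capv0 // !dimvf /=.
  by rewrite /dim /= muln1.
have /memv_imgP[d _ ->] : l \in limg (linfun L) by rewrite Lfull memvf.
by exists d => y; rewrite lfunE.
Qed.

Lemma separating_functional (U : {vspace V}) x : x \notin U ->
  exists l : 'Hom(V, k^o), (forall y, y \in U -> l y = 0) /\ l x != 0.
Proof.
move=> xU; set b := vbasis (fullv : {vspace V}).
have y0 : x - projv U x != 0.
  by apply: contra xU; rewrite subr_eq0 => /eqP ->; apply: memv_proj.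
have [i bi] : exists i, coord b i (x - projv U x) != 0.
  apply/existsP; apply: contraNT y0; rewrite negb_exists => /forallP h.
  rewrite (coord_vbasis (memvf (x - projv U x))) big1 // => i _.
  by have := h i; rewrite negbK => /eqP ->; rewrite scale0r.
pose f (z : V) : k^o := coord b i (z - projv U z).
have flin : linear f.
  by move=> a y z; rewrite /f [projv U _]linearP /= opprD addrACA -scalerBr linearP.
pose L : {linear V -> k^o} := HB.pack f (GRing.isLinear.Build _ _ _ _ f flin).
exists (linfun L); split=> [y yU|]; last by rewrite lfunE.
by rewrite lfunE /= /f projv_id // subrr linear0.
Qed.
End FiniteDimension.

(** * Engel, the Killing form and inner derivations *)

Section LieBasics.
Variables (k : fieldType) (g : vectType k) (br : g -> g -> g).
Hypothesis brL : is_lie br.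

Lemma br_linl y : linear (br^~ y). Proof. by case: brL => h _ _ _ a x z; apply: h. Qed.
Lemma br_linr x : linear (br x). Proof. by case: brL => _ h _ _ a y z; apply: h. Qed.

Let Rr x : {linear g -> g} := HB.pack (br x) (GRing.isLinear.Build _ _ _ _ (br x) (br_linr x)).
Let Rl y : {linear g -> g} := HB.pack (br^~ y) (GRing.isLinear.Build _ _ _ _ (br^~ y) (br_linl y)).

Lemma br0r x : br x 0 = 0. Proof. exact: (linear0 (Rr x)). Qed.
Lemma br0l x : br 0 x = 0. Proof. exact: (linear0 (Rl x)). Qed.
Lemma brDr x y z : br x (y + z) = br x y + br x z. Proof. exact: (linearD (Rr x)). Qed.
Lemma brDl x y z : br (x + y) z = br x z + br y z. Proof. exact: (linearD (Rl z)). Qed.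
Lemma brNr x y : br x (- y) = - br x y. Proof. exact: (linearN (Rr x)). Qed.
Lemma brBr x y z : br x (y - z) = br x y - br x z. Proof. exact: (linearB (Rr x)). Qed.
Lemma brBl x y z : br (x - y) z = br x z - br y z. Proof. exact: (linearB (Rl z)). Qed.
Lemma brZr a x y : br x (a *: y) = a *: br x y. Proof. exact: (linearZZ (Rr x)). Qed.
Lemma brZl a x y : br (a *: x) y = a *: br x y. Proof. exact: (linearZZ (Rl y)). Qed.
Lemma br_sumr I (r : seq I) (P : pred I) F x :
  br x (\sum_(i <- r | P i) F i) = \sum_(i <- r | P i) br x (F i).
Proof. exact: (linear_sum (Rr x)). Qed.
Lemma br_suml I (r : seq I) (P : pred I) F y :
  br (\sum_(i <- r | P i) F i) y = \sum_(i <- r | P i) br (F i) y.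
Proof. exact: (linear_sum (Rl y)). Qed.

Lemma brxx x : br x x = 0. Proof. by case: brL. Qed.

Lemma br_anti x y : br x y = - br y x.
Proof.
apply/eqP; rewrite -addr_eq0; apply/eqP.
by have := brxx (x + y); rewrite brDl !brDr !brxx add0r addr0.
Qed.

Lemma br_leibniz x y z : br x (br y z) = br (br x y) z + br y (br x z).
Proof.
case: brL => _ _ _ /(_ x y z) /eqP.
rewrite -addrA addr_eq0 => /eqP ->.
by rewrite opprD addrC -(br_anti (br x y)) (br_anti z x) brNr opprK.
Qed.

Definition ad (x : g) : 'End(g) := linfun (Rr x).

Lemma adE x y : ad x y = br x y. Proof. by rewrite lfunE. Qed.

Lemma ad_linear : linear ad.
Proof. by move=> a x y; apply/lfunP => z; rewrite add_lfunE scale_lfunE !adE brDl brZl. Qed.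
HB.instance Definition _ := GRing.isLinear.Build _ _ _ _ ad ad_linear.

Definition derivation (D : 'End(g)) : Prop :=
  forall x y, D (br x y) = br (D x) y + br x (D y).

Lemma ad_derivation x : derivation (ad x).
Proof. by move=> y z; rewrite !adE br_leibniz. Qed.

Lemma ad_br x y : ad (br x y) = ((ad x \o ad y) - (ad y \o ad x))%VF.
Proof.
apply/lfunP => z; rewrite add_lfunE opp_lfunE !comp_lfunE !adE.
by rewrite (br_leibniz x) addrK.
Qed.

(** The source of the derivations used below: semisimple parts of [ad], and operators with rational
    eigenvalues prescribed on a grading. *)
Lemma graded_derivation (I : zmodType) (E : I -> g -> Prop) s p (D : 'End(g)) (c : I -> k) :
  projections E s p -> (forall i j x y, E i x -> E j y -> E (i + j) (br x y)) ->
  {morph c : i j / i + j} -> (forall i x, E i x -> D x = c i *: x) -> derivation D.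
Proof.
move=> pP EB cD DE x y; have [us psum pin _ _] := pP.
rewrite (psum x) (psum y) !br_suml !linear_sum br_suml -big_split; apply: eq_bigr => i _ /=.
rewrite !br_sumr linear_sum -big_split; apply: eq_bigr => j _ /=.
rewrite (DE (i + j)) ?(DE i (p i x)) ?(DE j (p j y)) //; last exact: EB.
by rewrite cD scalerDl brZl brZr.
Qed.

Hypothesis brS : is_simple_lie br.

(** Ideals are taken as predicates, so that kernels, radicals and eigenspaces can be fed in
    directly. *)
Lemma simple_ideal (I : g -> Prop) : lin_closed I ->
  (forall x y, I y -> I (br x y)) -> (exists x, I x /\ x != 0) -> forall x, I x.
Proof.
move=> Ilin Iid [x [Ix x0]] y; have [U UI] := lin_closed_vspace Ilin.
have [_ _ /(_ U)[|U0|UT]] := brS.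
- by move=> a b /UI Ib; apply/UI/Iid.
- by move/UI: Ix; rewrite U0 memv0 (negPf x0).
- by apply/UI; rewrite UT memvf.
Qed.

Lemma center_trivial x : (forall y, br x y = 0) -> x = 0.
Proof.
move=> xz; apply/eqP/negPn/negP => x0; have [_ [a [b /eqP ab]] _] := brS; apply: ab.
suff : forall c, forall y, br c y = 0 by apply.
apply: simple_ideal; last by exists x.
  by split=> [y|c u v hu hv y]; rewrite ?br0l // brDl brZl hu hv scaler0 addr0.
by move=> u v hv y; rewrite (br_anti u) hv oppr0 br0l.
Qed.

Lemma ad_inj : injective ad.
Proof.
move=> x y /lfunP e; apply/eqP; rewrite -subr_eq0; apply/eqP/center_trivial => z.
by rewrite brBl -!adE e subrr.
Qed.

Lemma simple_perfect x : span_by (fun v => exists y z, v = br y z) x.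
Proof.
move: x; apply: simple_ideal.
- split; first by exists [::]; rewrite big_nil.
  move=> a x y [s [sP ->]] [t [tP ->]]; exists ([seq a *: v | v <- s] ++ t).
  rewrite big_cat big_map scaler_sumr; split=> // v; rewrite mem_cat => /orP[|/tP//].
  by move=> /mapP[w /sP[b [c ->]] ->]; exists (a *: b), c; rewrite brZl.
- by move=> x y _; exists [:: br x y]; rewrite big_seq1; split=> // v; rewrite inE => /eqP ->; exists x, y.
- have [_ [a [b ab]] _] := brS; exists (br a b); split=> //.
  by exists [:: br a b]; rewrite big_seq1; split=> // v; rewrite inE => /eqP ->; exists a, b.
Qed.
End LieBasics.

(** * Engel's theorem *)

Section Engel.
Variables (k : fieldType) (g : vectType k) (br : g -> g -> g).
Hypothesis brL : is_lie br.

Let subalg (K : {vspace g}) := forall x y, x \in K -> y \in K -> br x y \in K.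

(* Engel's theorem for the action of [K] on the quotient [W / U]; the induction applies it
   to a maximal proper subalgebra [K'] acting on [K / K']. *)
Lemma engel_step n (K : {vspace g}) : (\dim K <= n)%N -> subalg K ->
  (forall x, x \in K -> exists N, forall y, iter N (br x) y = 0) ->
  forall U W : {vspace g}, (forall x y, x \in K -> y \in U -> br x y \in U) ->
  (forall x y, x \in K -> y \in W -> br x y \in W) -> (U <= W)%VS -> ~~ (W <= U)%VS ->
  exists w, [/\ w \in W, w \notin U & forall x, x \in K -> br x w \in U].
Proof.
elim: n K => [|n IHn] K dK sK nilK U W KU KW UW nWU.
  have /subvPn[w wW wU] := nWU; exists w; split=> // x.
  by move: dK; rewrite leqn0 dimv_eq0 => /eqP ->; rewrite memv0 => /eqP ->; rewrite br0l ?mem0v.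
have [K0|K0] := eqVneq (\dim K) 0%N.
  by apply: IHn => //; rewrite K0.
pose Q d := boolp.asbool (exists K' : {vspace g},
  [/\ subalg K', (K' <= K)%VS, (\dim K' < \dim K)%N & \dim K' = d]).
have exQ : exists d, Q d.
  exists 0%N; apply/boolp.asboolP; exists 0%VS; rewrite dimv0 lt0n sub0v; split=> // x y.
  by rewrite !memv0 => /eqP -> _; rewrite br0l.
have bQ d : Q d -> (d <= \dim K)%N.
  by move=> /boolp.asboolP[K' [_ _ + <-]]; apply: ltnW.
have [d /boolp.asboolP[K' [sK' K'K dK' dE]] dmax] := ex_maxnP exQ bQ.
have dK'n : (\dim K' <= n)%N by rewrite -ltnS (leq_trans dK').
have nilK' x : x \in K' -> exists N, forall y, iter N (br x) y = 0.
  by move=> /(subvP K'K); apply: nilK.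
have nKK' : ~~ (K <= K')%VS by apply: contraTN dK' => /dimvS; rewrite ltnNge => ->.
have [x [xK xK' K'x]] := IHn K' dK'n sK' nilK' K' K sK'
  (fun x y xK' => sK x y (subvP K'K x xK')) K'K nKK'.
have xlt : (\dim K' < \dim (K' + <[x]>)%VS)%N.
  rewrite ltnNge; apply: contra xK' => le.
  have /eqP -> : K' == (K' + <[x]>)%VS by rewrite eqEdim addvSl.
  by rewrite -{1}[x]add0r memv_add ?mem0v ?memv_line.
have sKx : (K' + <[x]> <= K)%VS.
  by rewrite subv_add K'K; apply/subvP => y /vlineP[c ->]; apply: memvZ.
(* As [K'] maps [x] into [K'], the sum is a subalgebra, and maximality of [K'] forces equality. *)
have KE : K = (K' + <[x]>)%VS.
  apply/esym/eqP; rewrite eqEdim sKx leqNgt /=; apply/negP => lt.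
  suff /dmax : Q (\dim (K' + <[x]>)%VS) by rewrite -dE leqNgt xlt.
  apply/boolp.asboolP; exists (K' + <[x]>)%VS; split=> // y z.
  move=> /memv_addP[a aK [_ /vlineP[c ->] ->]] /memv_addP[b bK [_ /vlineP[e ->] ->]].
  apply: (subvP (addvSl K' <[x]>%VS)); rewrite (brDl brL) !(brDr brL) !(brZl brL) !(brZr brL) (brxx brL) !scaler0 addr0.
  by apply: memvD; [apply: memvD; [apply: sK'|apply/memvZ/K'x]|apply/memvZ; rewrite (br_anti brL) memvN; apply: K'x].
have [w [wW wU wK']] := IHn K' dK'n sK' nilK' U W
  (fun x y xK' => KU x y (subvP K'K x xK')) (fun x y xK' => KW x y (subvP K'K x xK')) UW nWU.
have [N xN] := nilK x xK.
(* [K'] annihilates [w] modulo [U], and this persists along the iterates of [ad x]. The last iterate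
   outside [U] is then annihilated modulo [U] by [x] as well. *)
pose bad j := (iter j (br x) w \in U).
have exbad : exists j, bad j by exists N; rewrite /bad xN mem0v.
have [[|j] jU jmin] := ex_minnP exbad; first by rewrite /bad /= (negPf wU) in jU.
exists (iter j (br x) w).
have itW i : iter i (br x) w \in W by elim: i => [//|i IHi]; apply: KW.
have itK i y : y \in K' -> br y (iter i (br x) w) \in U.
  elim: i y => [|i IHi] y yK'; first exact: wK'.
  rewrite /= (br_leibniz brL); apply: memvD; first by apply: IHi; apply: K'x.
  by apply: KU => //; apply: IHi.
split=> //; first by apply/negP => /jmin; rewrite ltnn.
move=> y; rewrite KE => /memv_addP[a aK [_ /vlineP[c ->] ->]].
by rewrite (brDl brL) (brZl brL); apply: memvD; [apply: itK|apply: memvZ].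
Qed.

(** The vector provided by [engel_step] for [U = 0] and [W = g] would be a nonzero central
    element. *)
Lemma engel_simple : is_simple_lie br ->
  ~ (forall x, exists N, forall y, iter N (br x) y = 0).
Proof.
move=> brS nil; have [_ [a [b ab]] _] := brS.
have [|||||||w [_ w0 wc]] := @engel_step (\dim (fullv : {vspace g})) fullv _ _ _ 0%VS fullv.
- by [].
- by move=> x y _ _; rewrite memvf.
- by move=> x _; apply: nil.
- by move=> x y _; rewrite !memv0 => /eqP ->; rewrite br0r.
- by move=> x y _ _; rewrite memvf.
- exact: sub0v.
- apply/subvPn; exists (br a b); rewrite ?memvf ?memv0 //.
case/negP: w0; rewrite memv0; apply/eqP/(center_trivial brL brS) => y.
by apply/eqP; rewrite (br_anti brL) oppr_eq0 -memv0 wc ?memvf.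
Qed.
End Engel.

(** * Nondegeneracy of the Killing form; derivations are inner *)

Section Killing.
Variables (k : closedFieldType) (k0 : [pchar k] =i pred0).
Variables (g : vectType k) (br : g -> g -> g).
Hypotheses (brL : is_lie br) (brS : is_simple_lie br).
Notation ad := (ad brL).

Definition killing (x y : g) : k := ltr (ad x \o ad y)%VF.

Lemma killing_linear x : linear_for *%R (killing x).
Proof. by move=> a y z; rewrite /killing linearP /= comp_lfunDr -comp_lfunZr linearP. Qed.
HB.instance Definition _ x := GRing.isLinear.Build _ _ _ *%R (killing x) (killing_linear x).

Lemma killingC x y : killing x y = killing y x.
Proof. exact: ltrC. Qed.

Lemma ad_derivationE D x : derivation br D -> ad (D x) = ((D \o ad x) - (ad x \o D))%VF.
Proof.
by move=> Dder; apply/lfunP => y; rewrite add_lfunE opp_lfunE !comp_lfunE !adE Dder addrK.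
Qed.

Lemma killing_derivation D x y : derivation br D -> killing (D x) y = - killing x (D y).
Proof.
move=> Dder; rewrite /killing !ad_derivationE // comp_lfunDl comp_lfunNl comp_lfunDr comp_lfunNr !linearB /= opprB.
by rewrite -!comp_lfunA [X in X - _]ltrC -!comp_lfunA.
Qed.

Lemma ltr_ad_br D y z : derivation br D -> ltr (ad (br y z) \o D)%VF = - killing y (D z).
Proof.
move=> Dder; rewrite ad_br /killing ad_derivationE // comp_lfunDl comp_lfunNl comp_lfunDr comp_lfunNr !linearB /= opprB.
congr (_ - _); first by rewrite comp_lfunA.
by rewrite -comp_lfunA ltrC -comp_lfunA.
Qed.

Lemma killing_aut (f : 'End(g)) x y : lie_aut br f -> killing (f x) (f y) = killing x y.
Proof.
case=> [[f' fK f'K] fbr]; rewrite /killing.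
have kerf : (lker f == 0)%VS by apply/lker0P => u v /(congr1 f'); rewrite !fK.
have fad u : (ad (f u) \o f = f \o ad u)%VF.
  by apply/lfunP => v; rewrite !comp_lfunE !adE fbr.
have e : (ad (f x) \o ad (f y) = f \o (ad x \o ad y \o f^-1))%VF.
  rewrite -[LHS]comp_lfun1r -(lker0_compfV kerf) 2!comp_lfunA -[(_ \o f)%VF]comp_lfunA.
  by rewrite fad comp_lfunA fad !comp_lfunA.
by rewrite e [LHS]ltrC lker0_compfVK.
Qed.

(** [D - (a + b)] obeys the Leibniz rule with [D - a] on the left factor and [D - b] on the right,
    so each term of its (N + M)-th power has N of the former or M of the latter. *)
Lemma gen_eigen_br (D : 'End(g)) a b x y : derivation br D ->
  gen_eigen D a x -> gen_eigen D b y -> gen_eigen D (a + b) (br x y).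
Proof.
move=> Dder [N xN] [M yM]; exists (N + M)%N.
have sh u v : shift D (a + b) (br u v) = br (shift D a u) v + br u (shift D b v).
  by rewrite !shiftE Dder brBl // brBr // brZl // brZr // addrACA -opprD -scalerDl.
have : (N + M <= N + M)%N by [].
move: {2 3}(N + M)%N => n; elim: n N M x y xN yM => [|n IHn] [|N] [|M] x y xN yM //.
- by move: xN => /= -> _; rewrite br0l.
- by move: xN => /= -> _; rewrite br0l // iter_lfun0 linear0.
- by move: xN => /= -> _; rewrite br0l // iter_lfun0 linear0.
- by move: yM => /= -> _; rewrite br0r // iter_lfun0 linear0.
move=> le; rewrite iterSr sh -[br (shift _ _ _) _]scale1r iter_lfunP scale1r.
have l1 : (N + M.+1 <= n)%N by move: le; rewrite addSn ltnS.
have l2 : (N.+1 + M <= n)%N by move: le; rewrite addnS ltnS.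
rewrite (IHn N M.+1 _ _ _ yM l1) -?iterSr // (IHn N.+1 M _ _ xN _ l2) -?iterSr //.
by rewrite addr0.
Qed.

(** The radical is an ideal, so a nonzero radical makes the form vanish identically. Let [D] act by
    [F a] on the generalized eigenspace of [ad x] for [a], with [F : k -> rat] additive. As [x] is a
    sum of brackets, tr (ad x D) = 0, while this trace is the sum of the a F(a) dim. Applying [F]
    gives a vanishing sum of F(a)^2 dim, so every [ad x] is nilpotent, against Engel's theorem. *)
Lemma killing_nondegenerate x : (forall y, killing x y = 0) -> x = 0.
Proof.
move=> xK; apply/eqP/negPn/negP => x0.
have K0 : forall y z, killing y z = 0.
  apply: (simple_ideal brS (I := fun y => forall z, killing y z = 0)); last by exists x.
    split=> [z|a y z yK zK u]; first by rewrite killingC linear0.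
    by rewrite killingC linearP /= ![killing u _]killingC yK zK mulr0 addr0.
  by move=> y z zK u; rewrite -adE killing_derivation ?zK ?oppr0 //; apply: ad_derivation.
apply: (engel_simple brL brS) => {x0 xK}x.
suff eig0 : forall a y, gen_eigen (ad x) a y -> y != 0 -> a = 0.
  have [s [p pP]] := gen_eigen_projections (ad x).
  have [N NP] : exists N, forall y, iter N (ad x) y = 0.
    apply: uniform_nilpotent => y.
    suff [N yN] : gen_eigen (ad x) 0 y.
      by exists N; rewrite -(eq_iter (shift0 (ad x))).
    have [_ psum pin _ _] := pP; rewrite (psum y).
    apply: (lin_closed_sum (gen_eigen_lin _ _)) => a _ _.
    have [->|py0] := eqVneq (p a y) 0; first by exists 0%N.
    by have a0 := eig0 _ _ (pin a y) py0; rewrite -{1}a0; apply: pin.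
  by exists N => y; rewrite -(NP y); apply: eq_iter => z; rewrite adE.
have [s [p pP]] := gen_eigen_projections (ad x).
have [F [Fadd Fs]] := additive_functional (@pchar0_lmod_tf k k0 k^o) s.
have F0 : F 0 = 0 by apply: (@addrI _ (F 0)); rewrite -Fadd !addr0.
have [D [DE Dpiece]] := scalar_on_pieces (fun a => ratr (F a)) pP.
have Dder : derivation br D.
  apply: (graded_derivation brL pP _ _ Dpiece).
    by move=> a b y z; apply: gen_eigen_br; apply: ad_derivation.
  by move=> a b; rewrite Fadd pchar0_ratrD.
have trD : ltr (ad x \o D)%VF = 0.
  have [r [rP ->]] := simple_perfect brL brS x.
  rewrite linear_sum /= big_seq (big_morph (fun u => (u \o D)%VF)
    (fun u v => comp_lfunDl u v D) (comp_lfun0l _ D)) linear_sum big1 //= => v vr.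
  by have [y [z ->]] := rP v vr; rewrite ltr_ad_br // K0 oppr0.
(* On the piece for [a], the operators [ad x] and [a] differ by a nilpotent one, which has trace
   0. *)
have trp a : ltr (ad x \o p a)%VF = a * ltr (p a).
  have [us psum pin pid p0] := pP.
  have -> : (ad x \o p a = (shift (ad x) a \o p a) + a *: p a)%VF.
    by apply/lfunP => y; rewrite add_lfunE !comp_lfunE scale_lfunE shiftE subrK.
  rewrite linearD linearZ /=; have [N NP] : exists N, forall y, iter N (shift (ad x) a \o p a)%VF y = 0.
    apply: uniform_nilpotent => y; have [N pN] := pin a y; exists N.+1.
    suff e j : p a (iter j (shift (ad x) a \o p a)%VF y) = iter j (shift (ad x) a) (p a y).
      by rewrite /= comp_lfunE e pN linear0.
    elim: j => [//|j IHj] /=; rewrite comp_lfunE IHj pid //.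
    apply: (gen_eigen_comm (u := shift (ad x) a)) => [z|]; first exact: shiftC.
    elim: j {IHj} => [|j IHj] /=; first exact: pin.
    by apply: gen_eigen_comm IHj => z; apply: shiftC.
  by rewrite (ltr_nilpotent NP) add0r.
(* [w a] is the dimension of the piece for [a], read off as the trace of the projection onto it. *)
have /boolp.choice[w wP] : forall a, exists n : nat, ltr (p a) = n%:R /\ (n = 0%N -> p a = 0).
  move=> a.
  have [->|pa0] := eqVneq (p a) 0; first by exists 0%N; rewrite linear0.
  have [|n nE] := ltr_idempotent _ pa0; last by exists n.+1.
  by apply/lfunP => y; rewrite comp_lfunE (projK pP) eqxx.
have wsum : \sum_(a <- s) F a * F a * (w a)%:R = 0.
  apply: (etrans _ F0); rewrite -trD DE (big_morph (fun u => (ad x \o u)%VF)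
    (fun u v => comp_lfunDr (ad x) u v) (comp_lfun0r _ (ad x))) linear_sum (big_morph F Fadd F0).
  apply: eq_bigr => a _; rewrite -comp_lfunZr linearZ /= trp (wP a).1.
  by rewrite [_ * (a * _)]mulrC -(ratr_nat k) !additive_ratrM // mulrAC.
move=> a y ya y0.
have [us _ _ pid _] := pP.
have as_ : a \in s.
  by apply: contraNT y0 => nas; rewrite -(pid a y ya) (proj_out pP) //.
have pa0 : p a != 0 by apply: contraNneq y0 => pa0; rewrite -(pid a y ya) pa0 zero_lfunE.
have w0 : (w a)%:R != 0 :> rat.
  by rewrite pnatr_eq0; apply: contra_neq pa0; apply: (wP a).2.
have Fa0 : F a = 0.
  have ge0 b : 0 <= F b * F b * (w b)%:R by rewrite mulr_ge0 ?ler0n // -expr2 sqr_ge0.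
  move/eqP: wsum; rewrite (bigD1_seq a) //= paddr_eq0 ?sumr_ge0 //.
  by rewrite !mulf_eq0 (negPf w0) orbF orbb => /andP[/eqP].
by apply/eqP; apply: contraT => a0; have := Fs a as_ a0; rewrite Fa0 eqxx.
Qed.

Lemma killing_represent (l : 'Hom(g, k^o)) : exists d, forall y, killing d y = l y.
Proof.
pose B x := linfun (killing x : g -> k^o).
have BE x y : B x y = killing x y.
  pose L : {linear g -> k^o} := HB.pack (killing x : g -> k^o)
    (GRing.isLinear.Build _ _ _ _ (killing x : g -> k^o) (killing_linear x)).
  exact: (lfunE L).
have Blin : linear B.
  move=> a x y; apply/lfunP => z; rewrite add_lfunE scale_lfunE !BE.
  by rewrite ![killing _ z]killingC linearP.
have Bnd x : (forall y, B x y = 0) -> x = 0.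
  by move=> h; apply: killing_nondegenerate => y; rewrite -BE.
by have [d dP] := represent_functional Blin Bnd l; exists d => y; rewrite -BE.
Qed.

(** The Killing form represents the functional sending [y] to tr (D ad y), say by [d]. Then
    [G = D - ad d] satisfies tr (G ad y) = 0 for all [y], whence K (G x, y) = tr (G ad [x, y]) =
    0. *)
Lemma derivation_inner (D : 'End(g)) : derivation br D -> exists d, D = ad d.
Proof.
move=> Dder; pose l (y : g) : k^o := ltr (D \o ad y)%VF.
have llin : linear l by move=> a y z; rewrite /l linearP /= comp_lfunDr -comp_lfunZr linearP.
pose L : {linear g -> k^o} := HB.pack l (GRing.isLinear.Build _ _ _ _ l llin).
have [d dP] := killing_represent (linfun L).
exists d; pose G := D - ad d.
have Gder : derivation br G.
  move=> x y; rewrite /G !add_lfunE !opp_lfunE Dder (ad_derivation brL).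
  by rewrite brBl // brBr // opprD addrACA.
have Gtr y : ltr (G \o ad y)%VF = 0.
  rewrite /G comp_lfunDl comp_lfunNl linearB /= -/(killing d y) dP lfunE /= subrr //.
suff G0 : G = 0 by apply/eqP; rewrite -subr_eq0 -/G G0.
apply/lfunP => x; rewrite zero_lfunE; apply: killing_nondegenerate => y.
rewrite /killing ad_derivationE // comp_lfunDl comp_lfunNl linearB /=.
rewrite -!comp_lfunA [X in _ - X]ltrC -comp_lfunA -linearB /= -comp_lfunNr -comp_lfunDr.
by rewrite -ad_br Gtr.
Qed.

Lemma inner_fixed d (D f : 'End(g)) : lie_aut br f -> D = ad d ->
  (forall x, f (D x) = D (f x)) -> f d = d.
Proof.
move=> [[f' fK f'K] fbr] DE fD; apply: (@ad_inj _ _ _ brL brS); apply/lfunP => x.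
by rewrite !adE -[x]f'K -fbr -!(adE brL) -DE fD.
Qed.
End Killing.

(** * Maximal toral subalgebras of the fixed algebra *)

Section Toral.
Variables (k : closedFieldType) (k0 : [pchar k] =i pred0).
Variables (g : vectType k) (br : g -> g -> g).
Hypotheses (brL : is_lie br) (brS : is_simple_lie br).
Notation ad := (ad brL).

Lemma endpow_nat (f : 'End(g)) (N : nat) x : endpow f N x = iter N f x.
Proof. by elim: N => [|N IHN] /=; rewrite ?id_lfunE // comp_lfunE -IHN. Qed.

Lemma diagonal_sq0 (f : 'End(g)) x : diagonal f -> f (f x) = 0 -> f x = 0.
Proof.
move=> /diagonal_projections[s [p pP]] ffx; have [us psum pin pid p0] := pP.
have fE a y : f (p a y) = a *: p a y by apply/eigenE; apply: pin.
rewrite (psum x) linear_sum big1 // => a _ /=.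
have pf y : p a (f y) = f (p a y).
  apply: (proj_comm pP) => b z /eigenE fz; apply/eigenE; rewrite fz linearZ /=; congr (_ *: _).
  by rewrite fz.
have := congr1 (p a) ffx; rewrite !pf !fE linear0 linearZ /= fE.
by case: (eqVneq a 0) => [->|a0] /eqP; rewrite ?scale0r // scalerA scaler_eq0 mulf_eq0 (negPf a0) => /eqP ->; rewrite scaler0.
Qed.

Lemma diagonal_lin (f f' : 'End(g)) c : diagonal f -> diagonal f' ->
  (forall x, f (f' x) = f' (f x)) -> diagonal (f + c *: f').
Proof.
move=> fd f'd ff' x.
have [||s [sP ->]] := @joint_diagonal _ _ [:: f; f'] _ _ x.
- by move=> u; rewrite !inE => /orP[/eqP ->|/eqP ->].
- by move=> u u'; rewrite !inE => /orP[/eqP ->|/eqP ->] /orP[/eqP ->|/eqP ->] y //; rewrite ff'.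
exists s; split=> // v /sP vP.
have [a fa] := vP f (mem_head _ _); have [|b fb] := vP f'; first by rewrite !inE eqxx orbT.
by exists (a + c * b); rewrite add_lfunE scale_lfunE fa fb scalerA -scalerDl.
Qed.

Variables (n : nat) (sig : 'I_n -> 'End(g)) (m : 'I_n -> nat).
Hypothesis sig_cfo : cfo_tuple br sig m.

Lemma cfo_aut i : lie_aut br (sig i). Proof. by case: sig_cfo. Qed.

Lemma cfo_br i x y : sig i (br x y) = br (sig i x) (sig i y).
Proof. by have [_] := cfo_aut i; apply. Qed.

Lemma cfo_comm i j x : sig i (sig j x) = sig j (sig i x).
Proof. by case: sig_cfo => _ /(_ i j)/lfunP/(_ x) + _ _ _; rewrite !comp_lfunE. Qed.

Lemma cfo_gt0 i : (0 < m i)%N. Proof. by case: sig_cfo. Qed.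

Lemma cfo_iter i x : iter (m i) (sig i) x = x.
Proof. by case: sig_cfo => _ _ _ _ /(_ i)/lfunP/(_ x); rewrite endpow_nat id_lfunE. Qed.

Lemma fixed_lin : lin_closed (fixed sig).
Proof.
split=> [i|a x y xf yf i]; first by rewrite linear0.
by rewrite linearP /= xf yf.
Qed.

(** The average is taken over the powers of one [sig i] at a time; the [sig i] commute, so the
    invariance already obtained is preserved. Closure under means suffices, which allows affine
    conditions. *)
Lemma fixed_average (C : g -> Prop) :
  (forall i x, C x -> C (sig i x)) ->
  (forall N (x : 'I_N.+1 -> g), (forall j, C (x j)) -> C (N.+1%:R^-1 *: \sum_j x j)) ->
  (exists x, C x) -> exists x, C x /\ fixed sig x.
Proof.
move=> Csig Cavg Cex.
suff: forall l, (l <= n)%N -> exists x, C x /\ forall i : 'I_n, (i < l)%N -> sig i x = x.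
  by move=> /(_ n (leqnn n))[x [Cx xf]]; exists x; split=> // i; apply: xf.
elim=> [_|l IHl ln]; first by case: Cex => x Cx; exists x.
have [x [Cx xf]] := IHl (ltnW ln); pose i := Ordinal ln.
have [N mN] : exists N, m i = N.+1 by have := cfo_gt0 i; case: (m i) => // N _; exists N.
exists (N.+1%:R^-1 *: \sum_(j < N.+1) iter j (sig i) x); split.
  by apply: Cavg => j; elim: (nat_of_ord j) => [//|M IHM]; apply: Csig.
move=> j; rewrite ltnS leq_eqVlt => /orP[/eqP jl|jl].
  have -> : j = i by apply: val_inj.
  rewrite linearZ linear_sum /=; congr (_ *: _).
  rewrite big_ord_recr [RHS]big_ord_recl /= addrC; congr (_ + _).
  by rewrite -[LHS]/(iter N.+1 (sig i) x) -mN cfo_iter.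
rewrite linearZ linear_sum /=; congr (_ *: _); apply: eq_bigr => r _.
elim: (nat_of_ord r) => [|M IHM] /=; first exact: xf.
by rewrite cfo_comm IHM.
Qed.

(** Diagonalizability on the fixed algebra extends to all of [g]: the semisimple part of [ad H] is
    [ad Hs] with [Hs] fixed, and [Hn = H - Hs] centralizes the fixed algebra. For fixed [z] the
    operator [ad Hn \o ad z] is nilpotent, so K (Hn, z) = 0; averaging extends this to all of [g],
    and [Hn = 0]. *)
Lemma toral_diagonal H : fixed sig H -> ad_diag br (fixed sig) H -> diagonal (ad H).
Proof.
move=> Hf Hd; have [s [p pP]] := gen_eigen_projections (ad H).
have [us psum pin pid p0] := pP.
have [D [DE Dpiece]] := scalar_on_pieces (fun a => a) pP.
have Dder : derivation br D.
  apply: (graded_derivation brL pP _ _ Dpiece) => // a b y z.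
  by apply: gen_eigen_br => //; apply: (ad_derivation brL).
have [Hs DHs] := derivation_inner k0 brL brS Dder.
have sigD i x : sig i (D x) = D (sig i x).
  have comm a y : gen_eigen (ad H) a y -> gen_eigen (ad H) a (sig i y).
    by apply: gen_eigen_comm => z; rewrite !adE cfo_br Hf.
  suff /lfunP/(_ x) : (sig i \o D = D \o sig i)%VF by rewrite !comp_lfunE.
  apply: (lfun_eq_on_pieces pP) => a y ya; rewrite !comp_lfunE (Dpiece a y ya).
  by rewrite (Dpiece a _ (comm a y ya)) linearZ.
have Hsf : fixed sig Hs by move=> i; apply: inner_fixed (cfo_aut i) DHs (sigD i).
pose Hn := H - Hs.
have Hn_fixed : fixed sig Hn by apply: (lin_closedB fixed_lin).
have Hn_cent y : fixed sig y -> br Hn y = 0.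
  move=> /Hd[r [rP ->]]; rewrite br_sumr // big_seq big1 // => v /rP[_ [c Hv]].
  rewrite brBl // -(adE brL Hs) -DHs (Dpiece c) ?Hv ?subrr //.
  by exists 1%N; rewrite /= shiftE adE Hv subrr.
have adHn x : ad Hn x = ad H x - D x by rewrite DHs !adE brBl.
have [N NP] : exists N, forall x, iter N (ad Hn) x = 0.
  apply: uniform_nilpotent => x.
  have [M MP] : exists M, forall a, a \in s -> iter M (shift (ad H) a) (p a x) = 0.
    elim: (s) => [|a r [M MP]]; first by exists 0%N.
    have [L LP] := pin a x; exists (maxn M L) => b; rewrite inE => /orP[/eqP ->|/MP bM].
      by apply: iter_lfun_le LP; rewrite leq_maxr.
    by apply: iter_lfun_le bM; rewrite leq_maxl.
  exists M; rewrite (psum x) big_seq.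
  have : forall a, a \in s -> iter M (ad Hn) (p a x) = 0.
    move=> a /MP <-; have := pin a x; elim: M {MP} (p a x) => [//|M IHM] y ya.
    have e : ad Hn y = shift (ad H) a y by rewrite adHn shiftE (Dpiece a).
    rewrite !iterSr e IHM //; apply: gen_eigen_comm ya => z; exact: shiftC.
  move=> h; rewrite -big_seq; apply: (lin_closed_sum (W := fun x => iter M (ad Hn) x = 0)).
    split; first exact: iter_lfun0.
    by move=> c y z yM zM; rewrite iter_lfunP yM zM scaler0 addr0.
  by move=> a ar _; apply: h.
have Hn0 : Hn = 0.
  apply: (@killing_nondegenerate _ k0 _ _ brL brS) => y.
  (* Automorphisms preserve the Killing form and [Hn] is fixed, so averaging [y] does not change the
     value. *)
  have [z [zy zf]] : exists z, killing brL Hn z = killing brL Hn y /\ fixed sig z.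
    apply: fixed_average; last by exists y.
      by move=> i x <-; rewrite -[in LHS](Hn_fixed i) killing_aut //; apply: cfo_aut.
    move=> M x xP; rewrite linearZ /= linear_sum (eq_bigr _ (fun j _ => xP j)).
    rewrite sumr_const card_ord -[killing _ _ _ *+ _]mulr_natl mulrA mulVf ?mul1r //.
    by rewrite ((pcharf0P k).1 k0).
  rewrite -zy; apply: (ltr_nilpotent (N := N)) => x.
  suff -> M : iter M (ad Hn \o ad z)%VF x = iter M (ad Hn) (iter M (ad z) x) by apply: NP.
  elim: M => [//|M IHM]; rewrite !iterS comp_lfunE IHM; congr (ad Hn _).
  move: (iter M (ad z) x) => v; elim: M {IHM} => [//|M IHM] /=; rewrite -IHM !adE br_leibniz //.
  by rewrite [br z Hn]br_anti // Hn_cent // oppr0 br0l // add0r.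
move=> x; exists [seq p a x | a <- s]; rewrite big_map -psum; split=> // _ /mapP[a _ ->].
exists a; rewrite -(Dpiece a (p a x)) //; apply/eqP; rewrite -subr_eq0 -adHn Hn0.
by rewrite adE br0l.
Qed.

(** A form of the Cartan condition that covers a zero fixed algebra too, asks for diagonalizability
    on all of [g], and tests maximality on single elements, which makes it easy to transport along
    isomorphisms. *)
Definition maxtoral (T : {vspace g}) : Prop :=
  [/\ forall x, x \in T -> fixed sig x,
      forall x y, x \in T -> y \in T -> br x y = 0,
      forall x, x \in T -> diagonal (ad x) &
      forall y, fixed sig y -> diagonal (ad y) ->
        (forall x, x \in T -> br x y = 0) -> y \in T].

Lemma fixed_diagonal_ad_diag z : fixed sig z -> diagonal (ad z) -> ad_diag br (fixed sig) z.
Proof.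
move=> zf /diagonal_projections[s [p pP]] x xf; have [us psum pin pid p0] := pP.
exists [seq p a x | a <- s]; rewrite big_map -psum; split=> // _ /mapP[a _ ->]; split.
  move=> i; rewrite -(proj_comm pP) ?xf // => b y /eigenE zy; apply/eigenE.
  by rewrite adE -{1}(zf i) -cfo_br -(adE brL) zy linearZ.
by exists a; have /eigenE := pin a x; rewrite adE.
Qed.

(** Toral subalgebras are abelian: if [x, y] = a y with [x] and [y] in [h], then [y, [y, x]] = 0,
    and [ad y] is diagonalizable, so [y, x] = 0. *)
Lemma cartan_maxtoral (h : {vspace g}) : cartan_of_fixed br sig h -> maxtoral h.
Proof.
case=> hT h0; have [ex|nex] := boolp.EM (exists x, x != 0 /\ fixed sig x); last first.
  have f0 x : fixed sig x -> x = 0.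
    by move=> xf; apply/eqP/negPn/negP => x0; apply: nex; exists x.
  rewrite h0 //; split=> [x|x y|x|y /f0 ->]; rewrite ?memv0 ?eqxx // => /eqP ->.
  - by move=> i; rewrite linear0.
  - by rewrite br0l.
  - move=> y; exists [:: y]; rewrite big_seq1; split=> // v _.
    by exists 0; rewrite adE br0l // scale0r.
have [[hf hsub hd] hmax] := hT ex.
have hdiag x : x \in h -> diagonal (ad x).
  by move=> xh; apply: toral_diagonal; [apply: hf|apply: hd].
have hab x y : x \in h -> y \in h -> br x y = 0.
  move=> xh yh; have [s [p pP]] := diagonal_projections (hdiag x xh).
  have [us psum pin pid p0] := pP.
  have ph a : p a y \in h.
    apply: (eigen_proj_sub (W := fun z => z \in h) pP) => // [|z zh].
      by split=> [|c u v uh vh]; rewrite ?mem0v // memvD // memvZ.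
    by rewrite adE hsub.
  rewrite (psum y) br_sumr // big1 // => a _; rewrite br_anti //.
  have /eigenE := pin a y; rewrite adE => xp.
  rewrite -(adE brL (p a y)) diagonal_sq0 ?oppr0 //; first exact: hdiag.
  by rewrite !adE (br_anti brL (p a y) x) xp brNr // brZr // brxx // scaler0 oppr0.
split=> // y yf yd yc.
pose h' := (h + <[y]>)%VS.
have hy x z : x \in h' -> z \in h' -> br x z = 0.
  move=> /memv_addP[u uh [_ /vlineP[c ->] ->]] /memv_addP[v vh [_ /vlineP[e ->] ->]].
  rewrite (brDl brL) !(brDr brL) !(brZl brL) !(brZr brL) (brxx brL) (hab u v uh vh) (yc u uh).
  rewrite (br_anti brL y v) (yc v vh).
  by rewrite oppr0 !scaler0 !addr0.
have h'f x : x \in h' -> fixed sig x.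
  move=> /memv_addP[u uh [_ /vlineP[c ->] ->]]; rewrite addrC.
  by apply: fixed_lin.2 => //; apply: hf.
have -> : h = h'.
  apply/esym/hmax; last exact: addvSl.
  split=> // [x z xh zh|H Hh]; first by rewrite hy ?mem0v.
  apply: fixed_diagonal_ad_diag; first exact: h'f.
  move: Hh => /memv_addP[u uh [_ /vlineP[c ->] ->]].
  rewrite linearD linearZ /=; apply: diagonal_lin => // [|x]; first exact: hdiag.
  by rewrite !adE br_leibniz // (yc u) // br0l // add0r.
by rewrite -[y]add0r memv_add ?mem0v ?memv_line.
Qed.

Section Roots.
Variables (T : {vspace g}) (T_max : maxtoral T).

Lemma rootsp_br (al be : hdual T) x y :
  rootsp br al x -> rootsp br be y -> rootsp br (al + be) (br x y).
Proof.
by move=> xa yb H; rewrite br_leibniz // xa yb brZl // brZr // add_lfunE scalerDl.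
Qed.

Lemma rootsp_lin (al : hdual T) : lin_closed (rootsp br al).
Proof.
split=> [H|a x y xa ya H]; first by rewrite br0r // scaler0.
by rewrite brDr // brZr // xa ya scalerDr !scalerA mulrC.
Qed.

Lemma rootspE (al : hdual T) x : rootsp br al x <->
  joint_eigen (fun H : subvs_of T => ad (vsval H)) (fun (be : hdual T) H => be H) al x.
Proof. by split=> h H; have := h H; rewrite adE. Qed.

(** A basis of [T] gives finitely many commuting diagonalizable operators; on a nonzero joint
    eigenvector the eigenvalue depends linearly on the element of [T]. *)
Lemma root_projections : exists (s : seq (hdual T)) p, projections (rootsp br (h := T)) s p.
Proof.
have [Tf Tab Td Tm] := T_max.
apply: exists_projections; first exact: rootsp_lin.
  apply: indep_sub (fun al x => (rootspE al x).1) _.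
  by apply: joint_eigen_indep => al be h; apply/lfunP.
apply: span_by_sumof; first exact: rootsp_lin.
move=> x; pose fs := [seq ad b | b <- vbasis T].
have [||r [rP ->]] := @joint_diagonal _ _ fs _ _ x.
- by move=> _ /mapP[b /vbasis_mem bT ->]; apply: Td.
- move=> _ _ /mapP[b /vbasis_mem bT ->] /mapP[c /vbasis_mem cT ->] y.
  by rewrite !adE (br_leibniz brL) (Tab b c bT cT) (br0l brL) add0r.
exists r; split=> // v /rP vP.
have [->|v0] := eqVneq v 0; first by exists 0; case: (rootsp_lin 0).
have /boolp.choice[c cP] (H : subvs_of T) : exists c : k, br (vsval H) v = c *: v.
  have := subvsP H; move/coord_vbasis => ->.
  have /boolp.choice[d dP] : forall i : 'I_(\dim T), exists d : k, br (vbasis T)`_i v = d *: v.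
    move=> i; have [|d] := vP (ad (vbasis T)`_i); last by rewrite adE; exists d.
    by apply/map_f/mem_nth; rewrite size_tuple.
  exists (\sum_i coord (vbasis T) i (vsval H) * d i).
  rewrite br_suml // scaler_suml; apply: eq_bigr => i _.
  by rewrite brZl // dP scalerA.
have clin : linear (c : subvs_of T -> k^o).
  move=> a H H'; apply/eqP; rewrite -subr_eq0; apply/eqP.
  have : (c (a *: H + H') - (a * c H + c H')) *: v = 0.
    by rewrite scalerBl -cP linearP /= brDl // brZl // !cP scalerDl scalerA subrr.
  by move/eqP; rewrite scaler_eq0 (negPf v0) orbF => /eqP.
pose L : {linear subvs_of T -> k^o} := HB.pack (c : subvs_of T -> k^o)
  (GRing.isLinear.Build _ _ _ _ (c : subvs_of T -> k^o) clin).
by exists (linfun L) => H; rewrite lfunE /= cP.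
Qed.

Lemma fixed_rootsp (f : 'End(g)) : (forall x y, f (br x y) = br (f x) (f y)) ->
  (forall x, x \in T -> f x = x) ->
  forall (al : hdual T) x, rootsp br al x -> rootsp br al (f x).
Proof.
by move=> fbr fT al x xa H; rewrite -{1}(fT (vsval H)) ?subvsP // -fbr xa linearZ.
Qed.

Definition rat_eigen (H : g) (q : rat) (x : g) : Prop := br H x = ratr q *: x.

(** With [F] additive to [rat] and nonzero on the nonzero roots, the derivation acting by [F al] on
    the [al]-space is inner, say [ad H]. It commutes with [sig] and kills [T], so maximality puts
    [H] in [T]. A vector killed by [H] has only a component for the root 0. *)
Lemma generic_element : exists H, [/\ H \in T, forall x, sumof (rat_eigen H) x &
  forall x, br H x = 0 -> forall t, t \in T -> br t x = 0].
Proof.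
have [Tf Tab Td Tm] := T_max.
have [s [p pP]] := root_projections; have [us psum pin pid p0] := pP.
have [F [Fadd Fs]] := additive_functional (@pchar0_lmod_tf k k0 (hdual T)) s.
have F0 : F 0 = 0 by apply: (@addrI _ (F 0)); rewrite -Fadd !addr0.
have [D [DE Dpiece]] := scalar_on_pieces (fun a => ratr (F a)) pP.
have Dder : derivation br D.
  apply: (graded_derivation brL pP _ _ Dpiece) => [a b x y|a b]; first exact: rootsp_br.
  by rewrite Fadd pchar0_ratrD.
have [H DH] := derivation_inner k0 brL brS Dder.
have HE al x : rootsp br al x -> br H x = ratr (F al) *: x.
  by move=> /Dpiece; rewrite DH adE.
have HT : H \in T.
  apply: Tm.
  - move=> i; apply: (inner_fixed brS (cfo_aut i) DH) => x.
    suff /lfunP/(_ x) : (sig i \o D = D \o sig i)%VF by rewrite !comp_lfunE.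
    apply: (lfun_eq_on_pieces pP) => al y ya; rewrite !comp_lfunE (Dpiece al y ya).
    rewrite (Dpiece al) ?linearZ //; apply: fixed_rootsp ya; first exact: cfo_br.
    by move=> z /Tf; apply.
  - move=> x; exists [seq p a x | a <- s]; rewrite big_map -psum; split=> // _ /mapP[a _ ->].
    by exists (ratr (F a)); rewrite adE (HE a).
  - move=> x xT; rewrite br_anti // (HE 0); last by move=> t; rewrite lfunE scale0r Tab ?subvsP.
    by rewrite F0 (_ : ratr 0 = 0) ?scale0r ?oppr0 //; apply/eqP; rewrite pchar0_ratr_eq0.
exists H; split=> // x.
  rewrite (psum x); apply: lin_closed_sum => [|a _ _]; last first.
    by apply: (@sumof_in _ _ _ _ (F a)); apply: HE.
  apply: sumof_lin => q; split=> [|a y z yq zq]; first by rewrite /rat_eigen br0r // scaler0.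
  by rewrite /rat_eigen brDr // brZr // yq zq scalerDr !scalerA mulrC.
move=> Hx t tT; suff px a : a \in s -> a = 0 \/ p a x = 0.
  rewrite (psum x) br_sumr // big_seq big1 // => a /px[a0|->]; last by rewrite br0r.
  have := pin a x (Sub t tT); rewrite a0 zero_lfunE scale0r //.
move=> as_; have [->|a0] := eqVneq a 0; first by left.
right; have := congr1 (p a) Hx; rewrite linear0 -(adE brL) -DH.
have -> : p a (D x) = D (p a x).
  by apply: (proj_comm pP) => b y yb; rewrite (Dpiece b) //; apply: (lin_closedZ (rootsp_lin b)).
rewrite (Dpiece a) // => /eqP; rewrite scaler_eq0 pchar0_ratr_eq0 //.
by rewrite (negPf (Fs a as_ a0)) => /eqP.
Qed.
End Roots.
End Toral.

Lemma seq_min (s : seq rat) : s != [::] -> exists2 q, q \in s & forall r, r \in s -> q <= r.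
Proof.
elim: s => [//|a s IHs] _; have [->|s0] := eqVneq s [::].
  by exists a => [|r]; rewrite inE // => /eqP ->.
have [q qs qmin] := IHs s0; case: (leP a q) => aq.
  exists a; rewrite ?mem_head // => r; rewrite inE => /orP[/eqP ->//|/qmin].
  exact: le_trans.
exists q; rewrite ?inE ?qs ?orbT // => r; rewrite inE => /orP[/eqP ->|/qmin//].
exact: ltW.
Qed.

Lemma seq_lower (s : seq rat) : exists q, forall r, r \in s -> q < r.
Proof.
have [->|s0] := eqVneq s [::]; first by exists 0.
by have [q _ qmin] := seq_min s0; exists (q - 1) => r /qmin; apply: lt_le_trans; rewrite ltrBlDr ltrDl.
Qed.

(** * Gradings by rational eigenvalues and their perturbations *)

Section RationalGrading.
Variables (k : closedFieldType) (k0 : [pchar k] =i pred0).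
Variables (g : vectType k) (br : g -> g -> g).
Hypotheses (brL : is_lie br) (brS : is_simple_lie br).
Notation ad := (ad brL).
Notation rat_eigen := (rat_eigen br).

Let ratr0 : ratr 0 = 0 :> k. Proof. by apply/eqP; rewrite pchar0_ratr_eq0. Qed.

Lemma rat_eigenE H q x : rat_eigen H q x <->
  joint_eigen (fun _ : unit => ad H) (fun r _ => ratr r) q x.
Proof. by split=> [e []|/(_ tt)]; rewrite adE. Qed.

Lemma rat_eigen_lin H q : lin_closed (rat_eigen H q).
Proof.
split; first by rewrite /rat_eigen br0r // scaler0.
by move=> a x y xq yq; rewrite /rat_eigen brDr // brZr // xq yq scalerDr !scalerA mulrC.
Qed.

Lemma rat_eigen_br H a b x y :
  rat_eigen H a x -> rat_eigen H b y -> rat_eigen H (a + b) (br x y).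
Proof.
move=> xa yb; rewrite /rat_eigen br_leibniz // xa yb brZl // brZr //.
by rewrite pchar0_ratrD // scalerDl.
Qed.

Lemma rat_eigen0 H : rat_eigen H 0 H.
Proof. by rewrite /rat_eigen brxx // ratr0 scale0r. Qed.

Lemma rat_eigen_projections H : (forall x, sumof (rat_eigen H) x) ->
  exists s p, projections (rat_eigen H) s p.
Proof.
move=> Hs; apply: exists_projections => //; first exact: rat_eigen_lin.
apply: indep_sub (fun q x => (rat_eigenE H q x).1) _.
by apply: joint_eigen_indep => q r /(_ tt); apply: pchar0_ratr_inj.
Qed.

Section OneElement.
Variables (H : g) (s : seq rat) (p : rat -> 'End(g)).
Hypothesis pP : projections (rat_eigen H) s p.

Lemma rat_proj_sub (W : g -> Prop) : lin_closed W -> (forall x, W x -> W (br H x)) ->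
  forall q x, W x -> W (p q x).
Proof.
move=> Wlin WH q x Wx.
have pP' : projections (joint_eigen (fun _ : unit => ad H) (fun r _ => ratr r : k)) s p.
  have [us psum pin pid p0] := pP; split=> // [r y|r y /rat_eigenE|r t y /rat_eigenE].
  - by apply/rat_eigenE.
  - exact: pid.
  - exact: p0.
apply: (joint_proj_sub _ Wlin _ pP' _ Wx) => [a b /(_ tt)|_ y Wy]; first exact: pchar0_ratr_inj.
by rewrite adE; apply: WH.
Qed.

Lemma rat_proj_comm (f : 'End(g)) : (forall x y, f (br x y) = br (f x) (f y)) -> f H = H ->
  forall q x, p q (f x) = f (p q x).
Proof.
move=> fbr fH; apply: (proj_comm pP) => q x xq.
by rewrite /rat_eigen -{1}fH -fbr xq linearZ.
Qed.

Lemma rat_proj_ad q x : p q (br H x) = ratr q *: p q x.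
Proof.
have [us psum pin pid p0] := pP.
rewrite -(adE brL) (proj_comm pP) ?adE; first exact: pin.
by move=> r y yr; rewrite adE yr; apply: (lin_closedZ (rat_eigen_lin H r)).
Qed.

Lemma rat_proj_br0 c u v :
  (forall i j, p i u != 0 -> p j v != 0 -> i + j != c) -> p c (br u v) = 0.
Proof.
have [us psum pin pid p0] := pP => ij.
rewrite (psum u) br_suml // linear_sum big1 // => i _ /=.
have [->|u0] := eqVneq (p i u) 0; first by rewrite br0l // linear0.
rewrite (psum v) br_sumr // linear_sum big1 // => j _ /=.
have [->|v0] := eqVneq (p j v) 0; first by rewrite br0r // linear0.
apply: (p0 _ (i + j)); first exact: rat_eigen_br.
by rewrite eq_sym; apply: ij.
Qed.

Lemma rat_proj_br_ge a b u v : (forall r, r < a -> p r u = 0) ->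
  (forall r, r < b -> p r v = 0) -> forall r, r < a + b -> p r (br u v) = 0.
Proof.
move=> ua vb r rab; apply: rat_proj_br0 => i j ui vj; apply: contraTneq rab => <-.
have ai : a <= i by rewrite leNgt; apply: contra ui => /ua ->.
have bj : b <= j by rewrite leNgt; apply: contra vj => /vb ->.
by rewrite -leNgt lerD.
Qed.

Lemma rat_proj_br_gt a b u v : (forall r, r <= a -> p r u = 0) ->
  (forall r, r < b -> p r v = 0) -> forall r, r <= a + b -> p r (br u v) = 0.
Proof.
move=> ua vb r rab; apply: rat_proj_br0 => i j ui vj; apply: contraTneq rab => <-.
have ai : a < i by rewrite ltNge; apply: contra ui => /ua ->.
have bj : b <= j by rewrite leNgt; apply: contra vj => /vb ->.
by rewrite -ltNge ltr_leD.
Qed.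

(* Induction on the number of weights of [ad H] exceeding [q]. *)
Lemma filtration_ind (P : rat -> g -> Prop) :
  (forall q, P q 0) ->
  (forall q q1 x, q < q1 -> (forall r, r < q1 -> p r x = 0) ->
     (forall y, (forall r, r <= q1 -> p r y = 0) -> P q1 y) -> P q x) ->
  forall q x, (forall r, r <= q -> p r x = 0) -> P q x.
Proof.
have [us psum pin pid p0] := pP => P0 PS q.
have [c] := ubnP (size [seq r <- s | q < r]); elim: c q => [//|c IHc] q sz x xq.
have [e|ne] := eqVneq [seq r <- s | q < r] [::].
  suff -> : x = 0 by apply: P0.
  rewrite (psum x) big_seq big1 // => r rs; apply: xq.
  by rewrite leNgt; apply/negP => qr; have : r \in [::] by rewrite -e mem_filter qr.
have [q1] := seq_min ne; rewrite mem_filter => /andP[qq1 q1s] q1min.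
have xq1 r : r < q1 -> p r x = 0.
  move=> rq1; case: (leP r q) => rq; first exact: xq.
  have [rs|rs] := boolP (r \in s); last exact: (proj_out pP).
  by have := q1min r; rewrite mem_filter rq rs leNgt rq1 => /(_ isT).
apply: (PS q q1) => // y yq1; apply: IHc => //.
rewrite -ltnS (leq_trans _ sz) // ltnS.
have -> : [seq r <- s | q1 < r] = [seq r <- [seq r <- s | q < r] | q1 < r].
  rewrite -filter_predI; apply: eq_filter => r /=.
  by case: (ltP q1 r) => //= h; rewrite (lt_trans qq1 h).
rewrite [size (filter _ (filter _ _))]size_filter ltn_neqAle count_size andbT -all_count.
by apply/allPn; exists q1; rewrite ?mem_filter ?qq1 // ltxx.
Qed.

(** [ad z] strictly raises weights, and only finitely many weights occur. *)
Lemma rat_nilpotent z : (forall r, r <= 0 -> p r z = 0) ->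
  exists N, forall x, iter N (ad z) x = 0.
Proof.
move=> z0; apply: uniform_nilpotent => x.
have [us psum pin pid p0] := pP; have [q qs] := seq_lower s.
have xq r : r <= q -> p r x = 0.
  move=> rq; apply: (proj_out pP); apply: contraTN rq => /qs; by rewrite ltNge.
move: q x xq {qs}; apply: filtration_ind => [q|q q1 x _ xq1 IH]; first by exists 0%N.
have [|N xN] := IH (br z x).
  by move=> r; rewrite -[q1]add0r; apply: rat_proj_br_gt.
by exists N.+1; rewrite iterSr adE.
Qed.

Lemma killing_rat_orth r t x y : rat_eigen H r x -> rat_eigen H t y -> r + t != 0 ->
  killing brL x y = 0.
Proof.
move=> xr yt rt; have := killing_derivation brL x y (ad_derivation brL H).
rewrite !adE xr yt linearZ ![killing _ (_ *: _) _]killingC linearZ /= [killing _ y x]killingC.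
move/eqP; rewrite -addr_eq0 -mulrDl -pchar0_ratrD // mulf_eq0 pchar0_ratr_eq0 //.
by rewrite (negPf rt) => /eqP.
Qed.

(** Weights [r] and [t] are orthogonal unless [r + t = 0], so the component [p r z] pairs only with
    weight [- r]. *)
Lemma killing_rat_proj0 r z : (forall y, rat_eigen H (- r) y -> killing brL z y = 0) ->
  p r z = 0.
Proof.
have [us psum pin pid p0] := pP.
move=> zy; apply: (@killing_nondegenerate _ k0 _ _ brL brS) => y.
rewrite (psum y) linear_sum big1 // => t _ /=.
have [rt|rt] := eqVneq (r + t) 0; last exact: (killing_rat_orth _ _ rt).
have tr : t = - r by apply/eqP; rewrite -addr_eq0 addrC rt.
rewrite -[RHS](zy (p t y)); last by rewrite -tr.
rewrite [in RHS](psum z) ![killing _ _ (p t y)]killingC linear_sum /=.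
have [rs|rs] := boolP (r \in s); last first.
  rewrite (proj_out pP z rs) linear0 big_seq big1 // => u us_.
  rewrite killingC (@killing_rat_orth u t) // tr subr_eq0.
  by apply: contraNneq rs => <-.
rewrite (bigD1_seq r) //= big1 ?addr0 // => u ur.
by rewrite killingC (@killing_rat_orth u t) // tr subr_eq0.
Qed.

(* [ad z] preserves the filtration by the weights of [H], so [tr (ad H ad z)] is a
   combination of the traces of [ad z] on the graded pieces, where it is nilpotent. *)
Lemma killing_nilpotent0 z : (forall r, r < 0 -> p r z = 0) ->
  (exists N, forall x, iter N (ad z) x = 0) -> killing brL H z = 0.
Proof.
move=> z0 [N zN]; have [us psum pin pid p0] := pP.
have HE : ad H = \sum_(a <- s) ratr a *: p a.
  apply/lfunP => x; rewrite adE sum_lfunE {1}(psum x) br_sumr //; apply: eq_bigr => a _.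
  by rewrite scale_lfunE; apply: pin.
rewrite /killing HE (big_morph (fun u => (u \o ad z)%VF)
  (fun u v => comp_lfunDl u v (ad z)) (comp_lfun0l _ (ad z))) linear_sum big1 //= => a _.
rewrite -comp_lfunZl linearZ /=.
have -> : (p a = p a \o p a)%VF by apply/lfunP => x; rewrite comp_lfunE (projK pP) eqxx.
rewrite -comp_lfunA ltrC (ltr_nilpotent (N := N.+1)) ?mulr0 // => x.
set u := (_ \o p a)%VF; have uE y : u y = p a (br z (p a y)) by rewrite /u !comp_lfunE adE.
have ge j r : r < a -> p r (iter j (br z) (p a x)) = 0.
  elim: j r => [|j IHj] r ra /=; first by rewrite (projK pP) lt_eqF.
  by apply: (rat_proj_br_ge z0 IHj); rewrite add0r.
(* Truncating an iterate to its weight-[a] component discards only higher weights, and [ad z] cannot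
   bring these back down to [a]. *)
have e j : p a (iter j u x) = p a (iter j (br z) (p a x)).
  elim: j => [|j IHj]; first by rewrite /= (projK pP) eqxx.
  rewrite /= uE (projK pP) eqxx IHj; set v := iter j _ _.
  apply/eqP; rewrite -subr_eq0 -linearB -brBr //= -(addr0 (p a _)); apply/eqP.
  rewrite addr0; apply: rat_proj_br0 => i l zi; rewrite linearB /= (projK pP).
  have [->|la] := eqVneq l a; first by rewrite subrr eqxx.
  rewrite sub0r oppr_eq0 => vl; have al : a < l.
    by rewrite lt_neqAle eq_sym la leNgt; apply: contra vl => /(ge j) ->.
  have i0 : 0 <= i by rewrite leNgt; apply: contra zi => /z0 ->.
  by rewrite gt_eqF // -[a]add0r ler_ltD.
rewrite iterS uE e -(eq_iter (f := ad z)) ?zN ?linear0 ?br0r ?linear0 // => y.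
exact: adE.
Qed.

End OneElement.

Section Perturbation.
Variables (H : g) (s : seq rat) (p : rat -> 'End(g)).
Hypothesis pP : projections (rat_eigen H) s p.
Variables (n : g) (n_gt0 : forall r, r <= 0 -> p r n = 0).
Let X := H + n.

Let rat_eigen_gt q r x := rat_eigen X r x /\ (r <= q -> x = 0).

Let rat_eigen_gt_lin q r : lin_closed (rat_eigen_gt q r).
Proof.
split; first by split=> //; case: (rat_eigen_lin X r).
move=> a x y [xr x0] [yr y0]; split; first exact: (rat_eigen_lin X r).2.
by move=> rq; rewrite x0 // y0 // scaler0 addr0.
Qed.

(** For [x] of [H]-weights at least [q1], the vector [y = (ad X - q1) x] has weights above [q1], so
    by induction it is a sum of eigenvectors of [ad X] with eigenvalues [t > q1]. Dividing each by
    [t - q1] gives [z] with [(ad X - q1) z = y], and [x - z] is an eigenvector for [q1]. *)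
Lemma perturbation_filtration q x : (forall r, r <= q -> p r x = 0) ->
  sumof (rat_eigen_gt q) x.
Proof.
have [us psum pin pid p0] := pP.
have slin t := sumof_lin (rat_eigen_gt_lin t).
move: q x; apply: (filtration_ind pP) => [q|q q1 x qq1 xq1 IH]; first by case: (slin q).
pose y := br X x - ratr q1 *: x.
have up t v : q1 <= t -> rat_eigen_gt q1 t v -> rat_eigen_gt q t v.
  by move=> qt [vt v0]; split=> // tq; have := le_trans qt tq; rewrite leNgt qq1.
have [z [zs zy]] : exists z, sumof (rat_eigen_gt q) z /\ br X z - ratr q1 *: z = y.
  have [|l [lE yE]] := IH y.
    move=> r rq1; rewrite /y brDl // linearB linearD /= linearZ /= (rat_proj_ad pP).
    rewrite [p r (br n x)](rat_proj_br_gt pP (a := 0) (b := q1)) ?add0r // addr0.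
    move: rq1; rewrite le_eqVlt => /orP[/eqP ->|/xq1 ->]; first by rewrite subrr.
    by rewrite !scaler0 subrr.
  rewrite yE; elim: l {yE} lE => [|[t v] l IHl] lE.
    by exists 0; rewrite big_nil br0r // scaler0 subrr; case: (slin q).
  have [|z [zs zy]] := IHl; first by move=> u ul; apply: lE; rewrite inE ul orbT.
  have /= [vt v0] := lE _ (mem_head _ _); rewrite big_cons /=.
  case: (leP t q1) => tq1; first by exists z; rewrite v0 // add0r.
  have tq0 : ratr t - ratr q1 != 0 :> k.
    by rewrite -pchar0_ratrB // pchar0_ratr_eq0 // subr_eq0 gt_eqF.
  exists ((ratr t - ratr q1)^-1 *: v + z); split.
    apply: (slin q).2 => //; apply: (@sumof_in _ _ _ _ t); split=> // tq.
    by have := lt_trans qq1 tq1; rewrite ltNge tq.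
  rewrite brDr // brZr // vt scalerDr opprD addrACA zy !scalerA -scalerBl [ratr q1 * _]mulrC.
  by rewrite -mulrBr mulVf // scale1r.
rewrite -[x](subrK z); apply: (lin_closedD (slin q)) => //; apply: (@sumof_in _ _ _ _ q1).
split; last by rewrite leNgt qq1.
rewrite /rat_eigen brBr // scalerBr; apply/eqP; rewrite -subr_eq0.
by rewrite opprD addrACA -opprD zy subrr.
Qed.

Lemma perturbation_rational x : sumof (rat_eigen X) x.
Proof.
have [q qs] := seq_lower s.
have [|l [lE ->]] := @perturbation_filtration q x.
  by move=> r rq; apply: (proj_out pP); apply: contraTN rq => /qs; rewrite ltNge.
by exists l; split=> // u /lE[].
Qed.

(* The automorphism identifies both eigenspace gradings of [ad H] and [ad X] with the
   associated graded algebra of their common filtration. *)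
Lemma perturbation_conjugate : exists eta : 'End(g),
  [/\ lie_aut br eta, eta H = X &
      forall f : 'End(g), (forall x y, f (br x y) = br (f x) (f y)) ->
        f H = H -> f X = X -> forall x, f (eta x) = eta (f x)].
Proof.
have [us psum pin pid p0] := pP.
have [sX [pX pXP]] := rat_eigen_projections perturbation_rational.
have [_ psumX pinX pidX pX0] := pXP.
have gtX q x r : (forall t, t <= q -> p t x = 0) -> r <= q -> pX r x = 0.
  move=> /perturbation_filtration[l [lE ->]] rq; rewrite linear_sum big_seq big1 // => -[t v] tl.
  have /= [vt v0] := lE _ tl; case: (leP t q) => tq; first by rewrite v0 ?linear0.
  by apply: (pX0 _ t) => //; rewrite lt_eqF // (le_lt_trans rq).
have ltX a x r : rat_eigen H a x -> r < a -> pX r x = 0.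
  move=> xa ra; apply: (gtX r) => // t tr; apply: (p0 _ a) => //.
  by rewrite lt_eqF // (le_lt_trans tr).
(* A vector of [H]-weight [a] goes to its component of [X]-weight [a], the lowest that can occur in
   it. *)
pose eta : 'End(g) := \sum_(a <- s) (pX a \o p a)%VF.
have etaE a x : rat_eigen H a x -> eta x = pX a x.
  move=> xa; rewrite /eta sum_lfunE.
  have [as_|nas] := boolP (a \in s); last first.
    have -> : x = 0 by rewrite -(pid a x xa) (proj_out pP).
    by rewrite linear0 big1 // => b _; rewrite linear0.
  rewrite (bigD1_seq a) //= comp_lfunE pid // big1 ?addr0 // => b ba.
  by rewrite comp_lfunE (p0 _ a) // linear0.
have eta_br x y : eta (br x y) = br (eta x) (eta y).
  rewrite (psum x) (psum y) !linear_sum !br_suml // linear_sum; apply: eq_bigr => a _ /=.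
  rewrite !br_sumr // linear_sum; apply: eq_bigr => b _ /=.
  have xa := pin a x; have yb := pin b y; move: (p a x) (p b y) xa yb => {}x {}y xa yb.
  rewrite (etaE (a + b)) ?(etaE a x) ?(etaE b y) //; last exact: rat_eigen_br.
  (* [x - pX a x] has only [X]-weights above [a], and [y] has none below [b], so their bracket does
     not reach weight [a + b]. *)
  have dx r : r <= a -> pX r (x - pX a x) = 0.
    rewrite le_eqVlt linearB /= (projK pXP) => /orP[/eqP ->|ra]; first by rewrite eqxx subrr.
    by rewrite (lt_eqF ra) (ltX a x r xa ra) subr0.
  have dy r : r <= b -> pX r (y - pX b y) = 0.
    rewrite le_eqVlt linearB /= (projK pXP) => /orP[/eqP ->|ra]; first by rewrite eqxx subrr.
    by rewrite (lt_eqF ra) (ltX b y r yb ra) subr0.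
  have e1 : pX (a + b) (br (x - pX a x) y) = 0.
    by apply: (rat_proj_br_gt pXP dx) => // r; apply: ltX.
  have e2 : pX (a + b) (br (pX a x) (y - pX b y)) = 0.
    rewrite br_anti // linearN /= addrC (rat_proj_br_gt pXP dy (b := a)) ?oppr0 // => r ra.
    by rewrite (projK pXP) lt_eqF.
  rewrite -{1}[x](subrK (pX a x)) brDl // linearD /= e1 add0r.
  rewrite -{1}[y](subrK (pX b y)) brDr // linearD /= e2 add0r pidX //.
  exact: rat_eigen_br.
have etaH : eta H = X.
  rewrite (etaE 0); last exact: rat_eigen0.
  rewrite -[H](addrK n) linearB /= (gtX 0 n) // subr0 pidX //; exact: rat_eigen0.
have eta_comm (f : 'End(g)) : (forall x y, f (br x y) = br (f x) (f y)) -> f H = H -> f X = X ->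
    forall x, f (eta x) = eta (f x).
  move=> fbr fH fX x; rewrite /eta !sum_lfunE linear_sum; apply: eq_bigr => a _ /=.
  by rewrite !comp_lfunE (rat_proj_comm pP fbr fH) (rat_proj_comm pXP fbr fX).
(* The kernel of [eta] is an ideal, so [eta] only has to be nonzero. If it vanished then
   [X = eta H = 0], and [H = - n] would have no component of weight 0, forcing [H = 0]; that case is
   settled by the identity. *)
have [H0|H0] := eqVneq H 0.
  have X0 : X = H.
    rewrite /X -[n in H + n](pid 0); first by rewrite n_gt0 ?addr0.
    by rewrite /rat_eigen H0 br0l // ratr0 scale0r.
  exists \1%VF; split.
  - by split=> [|x y]; [exists id => x; rewrite id_lfunE|rewrite !id_lfunE].
  - by rewrite id_lfunE X0.
  - by move=> f _ _ _ x; rewrite !id_lfunE.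
exists eta; split=> //; split=> //.
have ker0 : lker eta == 0%VS.
  rewrite -subv0; apply/subvP => x; rewrite memv_ker memv0 => /eqP ex; apply/negPn/negP => x0.
  have eta0 : forall y, eta y = 0.
    apply: (simple_ideal brS (I := fun y => eta y = 0)); last by exists x.
      by split=> [|a u v u0 v0]; rewrite ?linear0 // linearP /= u0 v0 scaler0 addr0.
    by move=> u v v0; rewrite eta_br v0 br0r.
  case/eqP: H0; rewrite -(pid 0 H (rat_eigen0 H)) -[H](addrK n) -/X -etaH eta0 sub0r.
  by rewrite linearN /= n_gt0 ?oppr0.
by exists (eta^-1)%VF => x; [apply: lker0_lfunK|apply: lker0_lfunVK].
Qed.
End Perturbation.
End RationalGrading.

Section Isomorphism.
Variables (k : closedFieldType) (g g' : vectType k).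
Variables (br : g -> g -> g) (br' : g' -> g' -> g').
Hypotheses (brL : is_lie br) (br'L : is_lie br').
Variable (phi : 'Hom(g, g')).
Hypotheses (phi_bij : bijective phi) (phi_br : forall x y, phi (br x y) = br' (phi x) (phi y)).

Lemma diagonal_iso x : diagonal (ad brL x) -> diagonal (ad br'L (phi x)).
Proof.
have [psi phiK psiK] := phi_bij; move=> xd y; have [s [sE e]] := xd (psi y).
exists [seq phi v | v <- s]; rewrite big_map -linear_sum -e /=; split; last exact/esym/psiK.
move=> _ /mapP[v /sE[c vc] ->]; exists c.
by rewrite adE -phi_br -(adE brL) vc linearZ.
Qed.
End Isomorphism.

(** * Conjugacy of maximal toral subalgebras *)

Section Conjugacy.
Variables (k : closedFieldType) (k0 : [pchar k] =i pred0).
Variables (g : vectType k) (br : g -> g -> g).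
Hypotheses (brL : is_lie br) (brS : is_simple_lie br).
Notation ad := (ad brL).
Notation rat_eigen := (rat_eigen br).
Variables (n : nat) (sig : 'I_n -> 'End(g)) (m : 'I_n -> nat).
Hypothesis sig_cfo : cfo_tuple br sig m.

Let sig_br i x y : sig i (br x y) = br (sig i x) (sig i y).
Proof. exact: cfo_br sig_cfo i x y. Qed.

(* Otherwise some [z] is Killing-orthogonal to [N1 + P2] but not to [H1], where [N1]
   (resp. [P2]) is the positive (resp. nonnegative) part for [H1] (resp. [H2]); but then
   [z] lies in [P1] and in [N2], and [ad z] is nilpotent, so [killing H1 z = 0]. *)
Lemma parabolic_meet (H1 H2 : g) s1 p1 s2 p2 :
  projections (rat_eigen H1) s1 p1 -> projections (rat_eigen H2) s2 p2 ->
  exists X, (forall r, r <= 0 -> p1 r (X - H1) = 0) /\ (forall r, r < 0 -> p2 r X = 0).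
Proof.
move=> pP1 pP2; have [us1 psum1 pin1 pid1 p01] := pP1; have [us2 psum2 pin2 pid2 p02] := pP2.
pose A := \sum_(r <- s1 | 0 < r) p1 r; pose B := \sum_(r <- s2 | 0 <= r) p2 r.
have AE r x : r <= 0 -> p1 r (A x) = 0.
  move=> r0; rewrite /A sum_lfunE linear_sum big1 // => t t0 /=.
  by rewrite (projK pP1) lt_eqF // (le_lt_trans r0).
have BE r x : r < 0 -> p2 r (B x) = 0.
  move=> r0; rewrite /B sum_lfunE linear_sum big1 // => t t0 /=.
  by rewrite (projK pP2) lt_eqF // (lt_le_trans r0).
have Aid r x : 0 < r -> rat_eigen H1 r x -> A x = x.
  move=> r0 xr; have [rs|rs] := boolP (r \in s1); last first.
    by rewrite -(pid1 r x xr) (proj_out pP1) // linear0.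
  rewrite /A sum_lfunE -big_filter (bigD1_seq r) ?filter_uniq ?mem_filter ?r0 //=.
  by rewrite pid1 // big1 ?addr0 // => t tr; apply: (p01 _ r).
have Bid r x : 0 <= r -> rat_eigen H2 r x -> B x = x.
  move=> r0 xr; have [rs|rs] := boolP (r \in s2); last first.
    by rewrite -(pid2 r x xr) (proj_out pP2) // linear0.
  rewrite /B sum_lfunE -big_filter (bigD1_seq r) ?filter_uniq ?mem_filter ?r0 //=.
  by rewrite pid2 // big1 ?addr0 // => t tr; apply: (p02 _ r).
have [/memv_addP[_ /memv_imgP[u _ ->] [_ /memv_imgP[v _ ->] HE]]|nH] :=
    boolP (H1 \in (limg A + limg B)%VS).
  exists (B v); split=> r r0; last exact: BE.
  by rewrite HE opprD addrCA subrr addr0 linearN /= AE ?oppr0.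
have [l [l0 lH]] := separating_functional nH.
have [z zl] := killing_represent k0 brL brS l.
have z1 r : r < 0 -> p1 r z = 0.
  move=> r0; apply: (killing_rat_proj0 (brL := brL) k0 brS pP1) => y yr.
  rewrite zl; apply: l0; apply: (subvP (addvSl _ _)).
  by rewrite -(Aid _ _ _ yr) ?memv_img ?memvf // oppr_gt0.
have z2 r : r <= 0 -> p2 r z = 0.
  move=> r0; apply: (killing_rat_proj0 (brL := brL) k0 brS pP2) => y yr.
  rewrite zl; apply: l0; apply: (subvP (addvSr _ _)).
  by rewrite -(Bid _ _ _ yr) ?memv_img ?memvf // oppr_ge0.
have := killing_nilpotent0 (brL := brL) k0 pP1 z1 (rat_nilpotent k0 brL pP2 z2).
by rewrite killingC zl => /eqP; rewrite (negPf lH).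
Qed.

(** Both conditions on [X] are affine and preserved by [sig], so [fixed_average] applies. *)
Lemma parabolic_meet_fixed (H1 H2 : g) s1 p1 s2 p2 : fixed sig H1 -> fixed sig H2 ->
  projections (rat_eigen H1) s1 p1 -> projections (rat_eigen H2) s2 p2 ->
  exists X, [/\ fixed sig X, (forall r, r <= 0 -> p1 r (X - H1) = 0) &
    (forall r, r < 0 -> p2 r X = 0)].
Proof.
move=> f1 f2 pP1 pP2.
have [|||X [[X1 X2] Xf]] := fixed_average sig_cfo (C := fun X =>
  (forall r, r <= 0 -> p1 r (X - H1) = 0) /\ (forall r, r < 0 -> p2 r X = 0)).
- move=> i x [x1 x2]; split=> r r0.
    by rewrite -{1}(f1 i) -linearB /= (rat_proj_comm pP1 (sig_br i) (f1 i)) x1 ?linear0.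
  by rewrite (rat_proj_comm pP2 (sig_br i) (f2 i)) x2 ?linear0.
- move=> N x xP; split=> r r0; last first.
    by rewrite linearZ linear_sum big1 => [|j _]; [exact: scaler0|have [_] := xP j; apply].
  have -> : N.+1%:R^-1 *: \sum_j x j - H1 = N.+1%:R^-1 *: \sum_j (x j - H1).
    rewrite sumrB scalerBr sumr_const card_ord -[H1 *+ _]scaler_nat scalerA mulVf ?scale1r //.
    by rewrite ((pcharf0P k).1 k0).
  by rewrite linearZ linear_sum big1 => [|j _]; [exact: scaler0|have [+ _] := xP j; apply].
- exact: parabolic_meet pP1 pP2.
by exists X.
Qed.

(** [Y] is the component of [H2] of [ad X]-weight 0. The vectors of positive [H2]-weight form an
    [ad X]-stable subspace [W], which contains [X, H2] because bracketing with [H2] kills weight 0.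
    The weight-[r] component of [X, H2] is [r] times that of [H2], so [H2 - Y] lies in [W]. *)
Lemma commuting_perturbation (X H2 : g) s2 p2 : fixed sig X -> fixed sig H2 ->
  (forall x, sumof (rat_eigen X) x) -> projections (rat_eigen H2) s2 p2 ->
  (forall r, r < 0 -> p2 r X = 0) ->
  exists Y, [/\ fixed sig Y, br X Y = 0 & forall r, r <= 0 -> p2 r (Y - H2) = 0].
Proof.
move=> Xf H2f Xs pP2 X2; have [us2 psum2 pin2 pid2 p02] := pP2.
have [s [p pP]] := rat_eigen_projections k0 brL Xs; have [us psum pin pid p0] := pP.
pose W v := forall r, r <= 0 -> p2 r v = 0.
have Wlin : lin_closed W.
  split=> [r _|a x y Wx Wy r r0]; first by rewrite linear0.
  by rewrite linearP /= Wx // Wy // scaler0 addr0.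
have WX v : W v -> W (br X v).
  move=> Wv r r0; rewrite br_anti // linearN /=.
  by have := rat_proj_br_gt k0 brL pP2 Wv X2; rewrite addr0 => ->; rewrite ?oppr0.
have WXH : W (br X H2).
  move=> r r0; rewrite br_anti // linearN /= (rat_proj_ad brL pP2).
  move: r0; rewrite le_eqVlt => /orP[/eqP ->|/X2 ->]; last by rewrite scaler0 oppr0.
  by have /eqP -> : ratr 0 == 0 :> k; rewrite ?pchar0_ratr_eq0 // scale0r oppr0.
have Wp r : r != 0 -> W (p r H2).
  move=> r0; have := rat_proj_sub k0 brL pP Wlin WX r WXH; rewrite (rat_proj_ad brL pP).
  by apply: lin_closedZV => //; rewrite pchar0_ratr_eq0.
exists (p 0 H2); split.
- by move=> i; rewrite -(rat_proj_comm pP (sig_br i) (Xf i)) H2f.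
- by rewrite (pin 0 H2); have /eqP -> : ratr 0 == 0 :> k; rewrite ?pchar0_ratr_eq0 // scale0r.
- suff : W (H2 - p 0 H2) by move=> /(lin_closedN Wlin); rewrite opprB.
  have [s0|s0] := boolP (0 \in s).
    rewrite {1}(psum H2) (bigD1_seq 0) //= addrAC subrr add0r.
    by apply: lin_closed_sum => // r _; apply: Wp.
  rewrite (proj_out pP) // subr0 (psum H2); apply: lin_closed_sum => // r rs _.
  by apply: Wp; apply: contraNneq s0 => <-.
Qed.

Lemma maxtoral_aut (eta : 'End(g)) (T : {vspace g}) : lie_aut br eta ->
  (forall i x, sig i (eta x) = eta (sig i x)) -> maxtoral brL sig T ->
  maxtoral brL sig (eta @: T)%VS.
Proof.
move=> [[th etaK thK] eta_br] eta_sig [Tf Tab Td Tm].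
have ker0 : lker eta == 0%VS by apply/lker0P => x y /(congr1 th); rewrite !etaK.
have invE x : (eta^-1)%VF x = th x by rewrite -{1}[x]thK lker0_lfunK.
have th_br x y : th (br x y) = br (th x) (th y).
  by rewrite -{1}[x]thK -{1}[y]thK -eta_br etaK.
split.
- by move=> _ /memv_imgP[x xT ->] i; rewrite eta_sig Tf.
- by move=> _ _ /memv_imgP[x xT ->] /memv_imgP[y yT ->]; rewrite -eta_br Tab // linear0.
- move=> _ /memv_imgP[x xT ->]; apply: (diagonal_iso (brL := brL)) => //; last exact: Td.
  by exists th.
- move=> y yf yd yc; rewrite -[y]thK; apply: memv_img; apply: Tm.
  + by move=> i; apply: (can_inj etaK); rewrite -eta_sig thK yf.
  + rewrite -invE; apply: (diagonal_iso (brL := brL)) => //.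
      by exists eta => x; rewrite invE.
    by move=> u v; rewrite !invE.
  + move=> x xT; apply: (can_inj etaK); rewrite eta_br thK linear0.
    by apply: yc; apply: memv_img.
Qed.

(** [Y] commutes with [X], hence with [T1], hence lies in [T1] by maximality. So [T1] commutes with
    [Y], hence with [T2], and maximality of [T2] concludes. *)
Lemma maxtoral_generic_sub (T1 T2 : {vspace g}) X Y :
  maxtoral brL sig T1 -> maxtoral brL sig T2 -> X \in T1 -> Y \in T2 -> br X Y = 0 ->
  (forall x, br X x = 0 -> forall t, t \in T1 -> br t x = 0) ->
  (forall x, br Y x = 0 -> forall t, t \in T2 -> br t x = 0) ->
  (T1 <= T2)%VS.
Proof.
move=> [T1f T1ab T1d T1m] [T2f T2ab T2d T2m] XT YT XY Xg Yg.
have YT1 : Y \in T1 by apply: T1m; [apply: T2f|apply: T2d|apply: Xg].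
apply/subvP => t tT; apply: T2m; [exact: T1f|exact: T1d|].
by apply: Yg; apply: T1ab.
Qed.

(** [T1] and [T2] are moved so that their generic elements become the commuting [X] and [Y]; maximal
    toral subalgebras with commuting generic elements coincide. *)
Theorem maxtoral_conjugate (T1 T2 : {vspace g}) :
  maxtoral brL sig T1 -> maxtoral brL sig T2 -> exists eta : 'End(g),
  [/\ lie_aut br eta, (forall i x, sig i (eta x) = eta (sig i x)) & (eta @: T1)%VS = T2].
Proof.
move=> M1 M2.
have [H1 [H1T H1s H1g]] := generic_element k0 brS sig_cfo M1.
have [H2 [H2T H2s H2g]] := generic_element k0 brS sig_cfo M2.
have [T1f _ _ _] := M1; have [T2f _ _ _] := M2.
have H1f := T1f _ H1T; have H2f := T2f _ H2T.
have [s1 [p1 pP1]] := rat_eigen_projections k0 brL H1s.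
have [s2 [p2 pP2]] := rat_eigen_projections k0 brL H2s.
have [X [Xf X1 X2]] := parabolic_meet_fixed H1f H2f pP1 pP2.
have XE : X = H1 + (X - H1) by rewrite addrC subrK.
have [eta1 [aut1 e1 comm1]] := perturbation_conjugate k0 brL brS pP1 X1.
have Xs x : sumof (rat_eigen X) x by rewrite XE; apply: (perturbation_rational k0 brL pP1 X1 x).
have [Y [Yf XY Y2]] := commuting_perturbation Xf H2f Xs pP2 X2.
have YE : Y = H2 + (Y - H2) by rewrite addrC subrK.
have [eta2 [aut2 e2 comm2]] := perturbation_conjugate k0 brL brS pP2 Y2.
rewrite -XE in e1 comm1; rewrite -YE in e2 comm2.
have sig1 i x : sig i (eta1 x) = eta1 (sig i x) by apply: comm1.
have sig2 i x : sig i (eta2 x) = eta2 (sig i x) by apply: comm2.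
have N1 := maxtoral_aut aut1 sig1 M1; have N2 := maxtoral_aut aut2 sig2 M2.
have XT : X \in (eta1 @: T1)%VS by rewrite -e1 memv_img.
have YT : Y \in (eta2 @: T2)%VS by rewrite -e2 memv_img.
have gen (eta : 'End(g)) H (T : {vspace g}) : lie_aut br eta ->
    (forall x, br H x = 0 -> forall t, t \in T -> br t x = 0) ->
    forall x, br (eta H) x = 0 -> forall t, t \in (eta @: T)%VS -> br t x = 0.
  move=> [[th etaK thK] eta_br] Hg x; rewrite -[x]thK -eta_br => /(congr1 th).
  rewrite etaK -[in RHS](linear0 eta) etaK => /Hg h _ /memv_imgP[t tT ->].
  by rewrite -eta_br h ?linear0.
have g1 := gen eta1 H1 T1 aut1 H1g; have g2 := gen eta2 H2 T2 aut2 H2g.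
rewrite e1 in g1; rewrite e2 in g2.
have TT : (eta1 @: T1 = eta2 @: T2)%VS.
  apply/eqP; rewrite eqEsubv (maxtoral_generic_sub N1 N2 XT YT) //.
  by apply: (maxtoral_generic_sub N2 N1 YT XT) => //; rewrite br_anti // XY oppr0.
have [[th1 eta1K th1K] br1] := aut1; have [[th2 eta2K th2K] br2] := aut2.
have ker0 : lker eta2 == 0%VS by apply/lker0P => x y /(congr1 th2); rewrite !eta2K.
have invE x : (eta2^-1)%VF x = th2 x by rewrite -{1}[x]th2K lker0_lfunK.
exists (eta2^-1 \o eta1)%VF; split.
- split; first exists (th1 \o eta2) => x; rewrite ?comp_lfunE ?invE /=.
  + by rewrite th2K eta1K.
  + by rewrite th1K eta2K.
  + by move=> x y; rewrite !comp_lfunE !invE br1; apply: (can_inj eta2K); rewrite br2 !th2K.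
- move=> i x; rewrite !comp_lfunE !invE; apply: (can_inj eta2K).
  by rewrite -sig2 !th2K sig1.
- by rewrite limg_comp TT -limg_comp lker0_compVf // lim1g.
Qed.
End Conjugacy.

(** * Loop algebras and their gradings *)

Section RootsOfUnity.
Variables (k : fieldType) (zeta : nat -> k).
Hypothesis zeta_prim : forall N : nat, (0 < N)%N -> N.-primitive_root (zeta N).
Hypothesis zeta_compat : forall M N : nat, (0 < M)%N -> (0 < N)%N ->
  zeta (M * N)%N ^+ M = zeta N.

Lemma zeta_neq0 N : (0 < N)%N -> zeta N != 0.
Proof.
move=> N0; apply/negP => /eqP z0; have := prim_expr_order (zeta_prim N0).
by rewrite z0 expr0n gtn_eqF // => /eqP; rewrite eq_sym oner_eq0.
Qed.

Lemma zeta_exp_eq1 N (z : int) : (0 < N)%N -> (zeta N ^ z == 1) = (N %| z)%Z.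
Proof.
move=> N0; have prim := zeta_prim N0; have z0 := zeta_neq0 N0.
rewrite dvdzE /=; case: z => j; first by rewrite -exprnP -(prim_order_dvd prim).
by rewrite NegzE -exprnN invr_eq1 (prim_order_dvd prim) abszN.
Qed.

(** [zeta_pow] reads the reduced fraction; compatibility of the chosen roots of unity absorbs the
    common factor [c] of [a] and [b]. *)
Lemma zeta_powE (a : int) (b : nat) : (0 < b)%N ->
  zeta_pow zeta (a%:~R / b%:R) = zeta b ^ a.
Proof.
move=> b0; set q : rat := _ / _; rewrite /zeta_pow.
have d0 : (0 < `|denq q|)%N by rewrite absz_gt0 denq_neq0.
have e : numq q * b = a * denq q.
  have bq : (b%:Z)%:~R != 0 :> rat by rewrite intr_eq0 -lt0n.
  apply/eqP; rewrite -(eqr_int rat) !rmorphM /= numqE mulrAC.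
  by rewrite /q divfK // mulrC.
have : (`|denq q| %| b)%N.
  rewrite -(Gauss_dvdr _ (_ : coprime `|denq q| `|numq q|)); last by rewrite coprime_sym coprime_num_den.
  by rewrite -[X in (_ %| _ * X)%N]/(`|b%:Z|)%N -abszM e abszM dvdn_mull.
case/dvdnP => c bE.
have c0 : (0 < c)%N by move: b0; rewrite bE muln_gt0 => /andP[].
have aE : a = c%:Z * numq q.
  apply: (mulIf (denq_neq0 q)); rewrite -e bE PoszM.
  by rewrite -[`|_|%N%:Z]/(`|denq q|) (gtr0_norm (denq_gt0 q)) mulrA [_ * c%:Z]mulrC.
by rewrite aE -exprz_exp bE -exprnP zeta_compat.
Qed.

Lemma zeta_pow_neq0 q : zeta_pow zeta q != 0.
Proof. by rewrite expfz_neq0 // zeta_neq0 // absz_gt0 denq_neq0. Qed.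

Lemma zeta_powD p q : zeta_pow zeta (p + q) = zeta_pow zeta p * zeta_pow zeta q.
Proof.
pose N := (`|denq p| * `|denq q|)%N.
have N0 : (0 < N)%N by rewrite muln_gt0 !absz_gt0 !denq_neq0.
have NE : N%:R = (denq p)%:~R * (denq q)%:~R :> rat.
  by rewrite /N natrM !natr_absz !gtr0_norm ?denq_gt0.
have pE : p = (numq p * denq q)%:~R / N%:R.
  by rewrite NE rmorphM /= -mulf_div divff ?intr_eq0 ?denq_neq0 // mulr1 divq_num_den.
have qE : q = (numq q * denq p)%:~R / N%:R.
  by rewrite NE mulrC rmorphM /= [X in X^-1]mulrC invfM mulrACA mulVf ?intr_eq0 ?denq_neq0 // mulr1 mulrC divq_num_den.
rewrite pE qE -mulrDl -rmorphD /= !zeta_powE // expfzDr //; exact: zeta_neq0.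
Qed.

Lemma zeta_pow0 : zeta_pow zeta 0 = 1.
Proof. by rewrite /zeta_pow. Qed.

Lemma zeta_pow_sum (I : Type) (r : seq I) (F : I -> rat) :
  zeta_pow zeta (\sum_(i <- r) F i) = \prod_(i <- r) zeta_pow zeta (F i).
Proof. exact: (big_morph _ zeta_powD zeta_pow0). Qed.

Lemma zeta_powMz q (z : int) : zeta_pow zeta (q * z%:~R) = zeta_pow zeta q ^ z.
Proof.
have N0 : (0 < `|denq q|)%N by rewrite absz_gt0 denq_neq0.
have qE : q = (numq q)%:~R / (`|denq q|%N)%:R by rewrite natr_absz gtr0_norm ?denq_gt0 // divq_num_den.
by rewrite {1}qE mulrAC -rmorphM /= zeta_powE // -exprz_exp.
Qed.

Lemma zeta_pow_eq1 q : zeta_pow zeta q = 1 -> exists z : int, q = z%:~R.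
Proof.
have N0 : (0 < `|denq q|)%N by rewrite absz_gt0 denq_neq0.
move/eqP; rewrite zeta_exp_eq1 // dvdzE /= => d.
have d1 : denq q = 1.
  have := coprime_num_den q; rewrite /coprime (gcdn_idPr d) => /eqP e.
  by rewrite -[denq q]gtr0_norm ?denq_gt0 // -abszE e.
by exists (numq q); rewrite -{1}[q]divq_num_den d1 divr1.
Qed.
End RootsOfUnity.

(** * Finitely supported functions, evaluation and the loop bracket *)

Section LoopAlgebra.
Variables (k : fieldType) (V : lmodType k) (n : nat).
Implicit Types (f : LA V n) (l mu : 'rV[int]_n).

Definition single l (x : V) : LA V n := fun mu => if mu == l then x else 0.

Definition finsupp f : Prop := exists s : seq 'rV[int]_n, forall l, f l != 0 -> l \in s.

(** Frees sums over [la_supp], an arbitrarily chosen list covering the support, from that choice. *)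
Lemma sum_support (U : nmodType) (I : eqType) (s t : seq I) (F : I -> U) :
  uniq s -> uniq t -> (forall i, F i != 0 -> i \in s) -> (forall i, F i != 0 -> i \in t) ->
  \sum_(i <- s) F i = \sum_(i <- t) F i.
Proof.
move=> us ut Fs Ft.
rewrite (bigID (fun i => F i != 0)) /= [X in _ + X]big1 ?addr0; last by move=> i; rewrite negbK => /eqP.
rewrite [RHS](bigID (fun i => F i != 0)) /= [X in _ + X]big1 ?addr0; last by move=> i; rewrite negbK => /eqP.
rewrite -big_filter -[RHS]big_filter; apply: perm_big; apply: uniq_perm; rewrite ?filter_uniq // => i.
rewrite !mem_filter; case Fi: (F i != 0) => //=.
by rewrite (Fs i Fi) (Ft i Fi).
Qed.

Lemma la_suppP f : finsupp f -> forall l, f l != 0 -> l \in la_supp f.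
Proof. by move=> ff; apply: (ClassicalEpsilon.epsilon_spec (inhabits [::]) (fun s => forall l, f l != 0 -> l \in s)). Qed.

Lemma finsupp_single l x : finsupp (single l x).
Proof. by exists [:: l] => mu; rewrite /single inE; case: (mu =P l) => // _; rewrite eqxx. Qed.

Lemma finsupp_add f f' : finsupp f -> finsupp f' -> finsupp (la_add f f').
Proof.
move=> [s sP] [t tP]; exists (s ++ t) => l; rewrite mem_cat /la_add => h.
have [f0|/sP -> //] := eqVneq (f l) 0; rewrite (tP l) ?orbT //.
by move: h; rewrite f0 add0r.
Qed.

Lemma finsupp_scale a f : finsupp f -> finsupp (la_scale a f).
Proof.
move=> [s sP]; exists s => l; rewrite /la_scale => h; apply: sP.
by apply: contraNneq h => ->; rewrite scaler0.
Qed.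

Lemma la_add0 f : la_add (@la0 k V n) f = f.
Proof. by apply: boolp.funext => l; rewrite /la_add add0r. Qed.

Lemma la_addr0 f : la_add f (@la0 k V n) = f.
Proof. by apply: boolp.funext => l; rewrite /la_add addr0. Qed.

Lemma la_scale1 f : la_scale 1 f = f.
Proof. by apply: boolp.funext => l; rewrite /la_scale scale1r. Qed.

Lemma single0 l : single l 0 = @la0 k V n.
Proof. by apply: boolp.funext => mu; rewrite /single; case: eqP. Qed.

Lemma singleE l x : single l x l = x.
Proof. by rewrite /single eqxx. Qed.

Lemma single_neq0 l x : x != 0 -> single l x <> @la0 k V n.
Proof. by move=> /eqP x0 /(congr1 (fun f => f l)); rewrite singleE. Qed.

Lemma supported_single f l : (forall mu, mu != l -> f mu = 0) -> f = single l (f l).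
Proof.
by move=> h; apply: boolp.funext => mu; rewrite /single; case: (eqVneq mu l) => [->|/h].
Qed.

Lemma single_lin l a x y : single l (a *: x + y) = la_add (la_scale a (single l x)) (single l y).
Proof.
by apply: boolp.funext => mu; rewrite /la_add /la_scale /single; case: eqP; rewrite ?scaler0 ?addr0.
Qed.

Definition la_shift (ga : 'rV[int]_n) f : LA V n := fun l => f (l - ga).

Lemma la_shift_single ga l x : la_shift ga (single l x) = single (l + ga) x.
Proof. by apply: boolp.funext => mu; rewrite /la_shift /single subr_eq. Qed.

Lemma finsupp_shift ga f : finsupp f -> finsupp (la_shift ga f).
Proof.
move=> [s sP]; exists [seq l + ga | l <- s] => l /sP h.
by apply/mapP; exists (l - ga); rewrite ?subrK.
Qed.

Section Evaluation.
Variable a : 'rV[int]_n -> k.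

(** When [a] is a character of Z^n this evaluates [t] at a point of the torus; the constant 1 is
    evaluation at t = 1. *)
Definition la_ev f : V := \sum_(l <- undup (la_supp f)) a l *: f l.

Lemma la_evE f s : uniq s -> (forall l, f l != 0 -> l \in s) ->
  la_ev f = \sum_(l <- s) a l *: f l.
Proof.
move=> us sP; have ff : finsupp f by exists s.
apply: sum_support => //; first exact: undup_uniq.
  move=> l h; rewrite mem_undup; apply: la_suppP => //.
  by apply: contraNneq h => ->; rewrite scaler0.
by move=> l h; apply: sP; apply: contraNneq h => ->; rewrite scaler0.
Qed.

Lemma la_ev_single l x : la_ev (single l x) = a l *: x.
Proof.
rewrite (la_evE (s := [:: l])) ?big_seq1 ?singleE // => mu.
by rewrite /single inE; case: (mu =P l) => // _; rewrite eqxx.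
Qed.

Lemma la_ev_lin c f f' : finsupp f -> finsupp f' ->
  la_ev (la_add (la_scale c f) f') = c *: la_ev f + la_ev f'.
Proof.
move=> [s sP] [t tP]; pose u := undup (s ++ t).
have fu l : f l != 0 -> l \in u by move=> /sP ls; rewrite mem_undup mem_cat ls.
have f'u l : f' l != 0 -> l \in u by move=> /tP ls; rewrite mem_undup mem_cat ls orbT.
have uu : uniq u by apply: undup_uniq.
rewrite (la_evE uu fu) (la_evE uu f'u) (la_evE uu) => [|l].
  rewrite scaler_sumr -big_split; apply: eq_bigr => l _ /=.
  by rewrite /la_add /la_scale scalerDr !scalerA mulrC.
rewrite /la_add /la_scale => h; have [f0|] := eqVneq (f l) 0; last exact: fu.
by apply: f'u; move: h; rewrite f0 scaler0 add0r.
Qed.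

Lemma la_ev_add f f' : finsupp f -> finsupp f' -> la_ev (la_add f f') = la_ev f + la_ev f'.
Proof. by move=> ff ff'; rewrite -{1}[f]la_scale1 la_ev_lin // scale1r. Qed.

Lemma la_ev0 : la_ev (@la0 k V n) = 0.
Proof. by rewrite (la_evE (s := [::])) ?big_nil // => l; rewrite /la0 eqxx. Qed.
End Evaluation.
End LoopAlgebra.

Section LoopBracket.
Variables (k : fieldType) (V : vectType k) (n : nat) (br : V -> V -> V).
Hypothesis brL : is_lie br.
Implicit Types (f : LA V n) (l mu : 'rV[int]_n).

Lemma la_brE f f' s l : uniq s -> (forall l, f l != 0 -> l \in s) ->
  la_br br f f' l = \sum_(mu <- s) br (f mu) (f' (l - mu)).
Proof.
move=> us sP; have ff : finsupp f by exists s.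
apply: sum_support => //; first exact: undup_uniq.
  move=> mu h; rewrite mem_undup; apply: la_suppP => //.
  by apply: contraNneq h => ->; rewrite br0l.
by move=> mu h; apply: sP; apply: contraNneq h => ->; rewrite br0l.
Qed.

Lemma la_br_single l mu x y :
  la_br br (single l x) (single mu y) = single (l + mu) (br x y) :> LA V n.
Proof.
apply: boolp.funext => nu; rewrite (@la_brE _ _ [:: l]) //; last first.
  by move=> ka; rewrite /single inE; case: (ka =P l) => // _; rewrite eqxx.
by rewrite big_seq1 singleE /single subr_eq addrC; case: eqP; rewrite ?br0r.
Qed.

Lemma la_br_linl c f1 f2 f' : finsupp f1 -> finsupp f2 ->
  la_br br (la_add (la_scale c f1) f2) f' = la_add (la_scale c (la_br br f1 f')) (la_br br f2 f').
Proof.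
move=> [s sP] [t tP]; pose u := undup (s ++ t).
have fu l : f1 l != 0 -> l \in u by move=> /sP ls; rewrite mem_undup mem_cat ls.
have f'u l : f2 l != 0 -> l \in u by move=> /tP ls; rewrite mem_undup mem_cat ls orbT.
have uu : uniq u by apply: undup_uniq.
apply: boolp.funext => l; rewrite {2}/la_add {2}/la_scale !(@la_brE _ _ u) //; last first.
  move=> mu; rewrite /la_add /la_scale => h; have [f0|] := eqVneq (f1 mu) 0; last exact: fu.
  by apply: f'u; move: h; rewrite f0 scaler0 add0r.
rewrite scaler_sumr -big_split; apply: eq_bigr => mu _ /=.
by rewrite brDl // brZl.
Qed.

Lemma la_br_linr c f f1 f2 :
  la_br br f (la_add (la_scale c f1) f2) = la_add (la_scale c (la_br br f f1)) (la_br br f f2).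
Proof.
apply: boolp.funext => l; rewrite /la_br /la_add /la_scale scaler_sumr -big_split.
by apply: eq_bigr => mu _ /=; rewrite brDr // brZr.
Qed.

Lemma la_br0r f : la_br br f (@la0 k V n) = @la0 k V n.
Proof. by apply: boolp.funext => l; rewrite /la_br big1 // => mu _; rewrite br0r. Qed.

Lemma la_br0l f : la_br br (@la0 k V n) f = @la0 k V n.
Proof. by apply: boolp.funext => l; rewrite /la_br big1 // => mu _; rewrite br0l. Qed.

Lemma la_br_addl f1 f2 f' : finsupp f1 -> finsupp f2 ->
  la_br br (la_add f1 f2) f' = la_add (la_br br f1 f') (la_br br f2 f').
Proof. by move=> s1 s2; rewrite -{1}[f1]la_scale1 la_br_linl // la_scale1. Qed.

Lemma la_br_addr f f1 f2 :
  la_br br f (la_add f1 f2) = la_add (la_br br f f1) (la_br br f f2).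
Proof. by rewrite -{1}[f1]la_scale1 la_br_linr // la_scale1. Qed.

Lemma finsupp_br f f' : finsupp f -> finsupp f' -> finsupp (la_br br f f').
Proof.
move=> [s sP] [t tP]; exists [seq x + y | x <- s, y <- t] => l; apply: contraR => h.
rewrite (@la_brE _ _ (undup s)) ?undup_uniq // => [|mu /sP]; last by rewrite mem_undup.
rewrite big_seq big1 // => mu; rewrite mem_undup => mus.
have [->|/tP lt] := eqVneq (f' (l - mu)) 0; first by rewrite br0r.
by case/negP: h; apply/allpairsP; exists (mu, l - mu); rewrite /= addrCA subrr addr0.
Qed.

Lemma la_shift_brr ga f f' : la_br br f (la_shift ga f') = la_shift ga (la_br br f f').
Proof.
by apply: boolp.funext => l; apply: eq_bigr => mu _; rewrite /la_shift addrAC.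
Qed.

Lemma la_shift_brl ga f f' : finsupp f ->
  la_br br (la_shift ga f) f' = la_shift ga (la_br br f f').
Proof.
move=> [s sP]; apply: boolp.funext => l; rewrite {2}/la_shift.
have u : forall l, f l != 0 -> l \in undup s by move=> mu /sP; rewrite mem_undup.
rewrite [RHS](@la_brE _ _ _ _ (undup_uniq s) u) (@la_brE _ _ [seq mu + ga | mu <- undup s]).
- rewrite big_map; apply: eq_bigr => mu _; rewrite /la_shift addrK.
  by rewrite opprD [- mu - ga]addrC addrA.
- by rewrite map_inj_uniq ?undup_uniq //; apply: addIr.
- by move=> mu /u h; apply/mapP; exists (mu - ga); rewrite ?subrK.
Qed.
End LoopBracket.

(** * Homogeneous pieces of a multiloop algebra *)

Section MultiloopBasics.
Variables (k : closedFieldType) (k0 : [pchar k] =i pred0) (zeta : nat -> k).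
Hypothesis zeta_prim : forall N : nat, (0 < N)%N -> N.-primitive_root (zeta N).
Variables (g : vectType k) (br : g -> g -> g).
Hypothesis brL : is_lie br.
Variables (n : nat) (sig : 'I_n -> 'End(g)) (m : 'I_n -> nat) (h : {vspace g}).
Hypotheses (sig_cfo : cfo_tuple br sig m) (h_max : maxtoral brL sig h).

Notation sigsp := (sigsp zeta sig m).
Notation ml_alg := (ml_alg zeta br sig m h).
Notation ml_comp := (ml_comp zeta br sig m (h := h)).
Implicit Types (l mu nu : 'rV[int]_n) (al be : hdual h).

(** Discrete Fourier transform: [e j] is the component of [x] for the eigenvalue [w ^+ j]. The
    components add up to [x] because the powers of a nontrivial root of unity sum to 0. *)
Lemma finite_order_diagonal (f : 'End(g)) (M : nat) : (0 < M)%N ->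
  (forall x, iter M f x = x) -> diagonal f.
Proof.
case: M => // M _ fM x; have := zeta_prim (ltn0Sn M); move: (zeta M.+1) => w prim.
have w0 : w != 0.
  apply/negP => /eqP w0; have /eqP := prim_expr_order prim.
  by rewrite w0 expr0n /= eq_sym oner_eq0.
pose v := w^-1; have vM j : v ^+ (j * M.+1) = 1.
  by rewrite mulnC exprM exprVn (prim_expr_order prim) invr1 expr1n.
have M0k : M.+1%:R != 0 :> k by rewrite ((pcharf0P k).1 k0).
pose e (j : nat) := M.+1%:R^-1 *: \sum_(l < M.+1) v ^+ (j * l) *: iter l f x.
have fe j : e j = v ^+ j *: f (e j).
  rewrite /e linearZ /= [RHS]scalerA [v ^+ j * _]mulrC -[RHS]scalerA; congr (_ *: _).
  rewrite linear_sum scaler_sumr.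
  rewrite [LHS]big_ord_recl [RHS]big_ord_recr /= [LHS]addrC muln0; congr (_ + _).
    apply: eq_bigr => l _; rewrite linearZ /= scalerA -exprD /bump /= add1n mulnS.
    by [].
  by rewrite linearZ /= scalerA -exprD -mulnS vM -[f (iter M f x)]/(iter M.+1 f x) fM expr0.
exists [seq e j | j <- iota 0 M.+1]; rewrite big_map; split.
  move=> _ /mapP[j _ ->]; exists (w ^+ j).
  by rewrite {2}fe scalerA -exprMn divff // expr1n scale1r.
rewrite -[iota 0 M.+1]/(index_iota 0 M.+1) big_mkord /e -scaler_sumr exchange_big /=.
rewrite (eq_bigr (fun l : 'I_M.+1 => (if l == 0 :> nat then M.+1%:R else 0) *: iter l f x)).
  by rewrite big_ord_recl /= big1 ?addr0 ?scalerA ?mulVf ?scale1r // => l _; rewrite scale0r.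
move=> l _; rewrite -scaler_suml; congr (_ *: _); case: eqP => [l0|/eqP l0].
  by rewrite (eq_bigr (fun=> 1)) => [|j _]; rewrite ?sumr_const ?card_ord // l0 muln0.
have vl : v ^+ l != 1.
  by rewrite exprVn invr_eq1 -(prim_order_dvd prim) gtnNdvd ?lt0n.
have : (v ^+ l) ^+ M.+1 - 1 = 0 by rewrite -exprM vM subrr.
rewrite subrX1 => /eqP; rewrite mulf_eq0 subr_eq0 (negPf vl) /= => /eqP s0.
apply: etrans s0.
by apply: eq_bigr => j _; rewrite -exprM mulnC.
Qed.

Lemma sigsp_lin l : lin_closed (sigsp l).
Proof.
split=> [i|a x y xl yl i]; first by rewrite linear0 scaler0.
by rewrite linearP /= xl yl scalerDr !scalerA mulrC.
Qed.

Let z_neq0 i : zeta (m i) != 0.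
Proof. by apply: (zeta_neq0 zeta_prim); apply: cfo_gt0 sig_cfo i. Qed.

Lemma sigsp_br l mu x y : sigsp l x -> sigsp mu y -> sigsp (l + mu) (br x y).
Proof.
move=> xl ymu i; rewrite (cfo_br sig_cfo) xl ymu brZl // brZr // scalerA mxE.
by rewrite expfzDr.
Qed.

Definition lab (l : 'rV[int]_n) : {ffun 'I_n -> k} := [ffun i => zeta (m i) ^ (l 0 i)].

Lemma lab_eqP l mu : lab l = lab mu <-> forall i, (m i %| l 0%R i - mu 0%R i)%Z.
Proof.
have e i : (zeta (m i) ^ (l 0 i) == zeta (m i) ^ (mu 0 i)) = (m i %| l 0%R i - mu 0%R i)%Z.
  rewrite -(zeta_exp_eq1 zeta_prim) ?(cfo_gt0 sig_cfo) //.
  have -> : zeta (m i) ^ (l 0 i) = zeta (m i) ^ (l 0 i - mu 0 i) * zeta (m i) ^ (mu 0 i).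
    by rewrite -expfzDr // subrK.
  by rewrite -{2}[zeta (m i) ^ (mu 0 i)]mul1r (inj_eq (mulIf (expfz_neq0 _ (z_neq0 i)))).
split=> [/ffunP lm i|lm]; first by have := lm i; rewrite !ffunE -e => ->.
by apply/ffunP => i; rewrite !ffunE; apply/eqP; rewrite e.
Qed.

(** Indexed by eigenvalues, pieces with distinct indices are independent; for [bipiece], degrees
    congruent modulo Gamma give the same subspace. *)
Definition piece (a : hdual h * {ffun 'I_n -> k}) (x : g) : Prop :=
  rootsp br a.1 x /\ forall i, sig i x = a.2 i *: x.

Lemma piece_lab al l x : piece (al, lab l) x <-> rootsp br al x /\ sigsp l x.
Proof. by split=> -[xa xl]; split=> // i; have := xl i; rewrite /= ffunE. Qed.

(** The order of [sig i] divides [m i], so its eigenvalues are powers of [zeta (m i)]. *)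
Lemma piece_ex a x : piece a x -> x != 0 -> exists l, a.2 = lab l.
Proof.
move=> [_ xa] x0.
have /boolp.choice[c cP] : forall i, exists c : nat, a.2 i = zeta (m i) ^+ c.
  move=> i; have : (a.2 i) ^+ m i = 1.
    have := cfo_iter sig_cfo i x.
    have -> : iter (m i) (sig i) x = (a.2 i) ^+ m i *: x.
      elim: (m i) => [|N IHN]; first by rewrite expr0 scale1r.
      by rewrite /= IHN linearZ /= xa scalerA exprSr.
    move/eqP; rewrite -{2}[x]scale1r -subr_eq0 -scalerBl scaler_eq0 (negPf x0) orbF.
    by rewrite subr_eq0 => /eqP.
  by move/(prim_rootP (zeta_prim (cfo_gt0 sig_cfo i))) => [c ->]; exists c.
exists (\row_i (c i)%:Z); apply/ffunP => i; rewrite ffunE mxE cP exprnP //.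
Qed.

Lemma piece_lin a : lin_closed (piece a).
Proof.
split; first by split; [exact: (rootsp_lin brL _).1|move=> i; rewrite linear0 scaler0].
move=> c x y [xa xs] [ya ys]; split; first exact: (rootsp_lin brL _).2.
by move=> i; rewrite linearP /= xs ys scalerDr !scalerA mulrC.
Qed.

Lemma root_proj_sig s p : projections (rootsp br (h := h)) s p ->
  forall i al x, p al (sig i x) = sig i (p al x).
Proof.
move=> pP i; apply: (proj_comm pP) => al x; apply: fixed_rootsp; first exact: cfo_br sig_cfo i.
by have [hf _ _ _] := h_max; move=> y /hf.
Qed.

Lemma piece_projections : exists s p, projections piece s p.
Proof.
have [sr [pr prP]] := root_projections h_max; have [_ psum pin _ _] := prP.
apply: exists_projections; first exact: piece_lin.
  pose F (j : subvs_of h + 'I_n) := match j with inl H => ad brL (vsval H) | inr i => sig i end.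
  pose ev (a : hdual h * {ffun 'I_n -> k}) (j : subvs_of h + 'I_n) : k :=
    match j with inl H => a.1 H | inr i => a.2 i end.
  apply: (@indep_sub _ _ _ _ (joint_eigen F ev)).
    by move=> a x [xa xs] [H|i] /=; rewrite ?adE ?xa ?xs.
  apply: joint_eigen_indep => -[al c] [be d] e; congr pair.
    by apply/lfunP => H; apply: (e (inl H)).
  by apply/ffunP => i; apply: (e (inr i)).
apply: span_by_sumof; first exact: piece_lin.
move=> x; have [||r [rP ->]] := @joint_diagonal _ _ [seq sig i | i <- enum 'I_n] _ _ x.
- move=> _ /mapP[i _ ->]; apply: (finite_order_diagonal (cfo_gt0 sig_cfo i)).
  exact: cfo_iter sig_cfo i.
- by move=> _ _ /mapP[i _ ->] /mapP[j _ ->] y; apply: cfo_comm sig_cfo i j y.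
rewrite big_seq; elim/big_ind: _ => [|y z [t [tP ->]] [u [uP ->]]|v vr].
- by exists [::]; rewrite big_nil.
- by exists (t ++ u); rewrite big_cat; split=> // w; rewrite mem_cat => /orP[/tP|/uP].
rewrite (psum v); apply: span_by_sum => al; exists [:: pr al v]; rewrite big_seq1; split=> // w.
rewrite inE => /eqP ->; have /boolp.choice[c cP] : forall i, exists c : k, sig i v = c *: v.
  by move=> i; apply: (rP v vr); apply/map_f; rewrite mem_enum.
exists (al, [ffun i => c i]); split; first exact: pin.
by move=> i; rewrite -(root_proj_sig prP) cP linearZ ffunE.
Qed.

Definition bipiece (a : hdual h * 'rV[int]_n) (x : g) : Prop :=
  rootsp br a.1 x /\ sigsp a.2 x.

Lemma bipiece_lin a : lin_closed (bipiece a).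
Proof.
split; first by split; [exact: (rootsp_lin brL _).1|exact: (sigsp_lin _).1].
move=> c x y [xa xs] [ya ys].
by split; [exact: (rootsp_lin brL _).2|exact: (sigsp_lin _).2].
Qed.

Lemma bipiece_span x : sumof bipiece x.
Proof.
have [s [p pP]] := piece_projections; have [_ psum pin _ _] := pP.
rewrite (psum x); apply: lin_closed_sum => [|a _ _]; first exact: sumof_lin bipiece_lin.
have [->|pa0] := eqVneq (p a x) 0; first by case: (sumof_lin bipiece_lin).
have [l al] := piece_ex (pin a x) pa0.
apply: (@sumof_in _ _ _ _ (a.1, l)); apply/piece_lab; rewrite -al; move: (pin a x).
by case: (a).
Qed.

Lemma bipiece_br a b x y : bipiece a x -> bipiece b y -> bipiece (a + b) (br x y).
Proof. by move=> [xa xs] [yb ys]; split; [apply: rootsp_br|apply: sigsp_br]. Qed.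

Lemma bipiece_eq (V : vectType k) (u v : 'Hom(g, V)) :
  (forall a x, bipiece a x -> u x = v x) -> u = v.
Proof.
move=> uv; apply/lfunP => x; have [s [sE ->]] := bipiece_span x.
by rewrite !linear_sum big_seq [RHS]big_seq; apply: eq_bigr => a /sE/uv.
Qed.

Lemma in_Qh_root al x : rootsp br al x -> x != 0 -> in_Qh br al.
Proof.
move=> xa x0; have [->|al0] := eqVneq al 0; first by exists [::]; rewrite big_nil.
exists [:: (1, al)]; rewrite big_seq1 mulr1z; split=> // q; rewrite inE => /eqP -> /=.
by split=> //; exists x.
Qed.

Lemma ml_compP a f : ml_comp a f <-> exists2 x, f = single a.2 x & bipiece a x.
Proof.
split=> [[f0 fs fr _]|[x -> [xr xs]]]; first by exists (f a.2); [apply: supported_single|].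
split; rewrite ?singleE //; first by move=> mu /negPf e; rewrite /single e.
by have [->|x0] := eqVneq x 0; [right|left; apply: in_Qh_root x0].
Qed.

(** The root projections commute with [sig], so a coefficient in a joint eigenspace of [sig] splits
    into bihomogeneous ones. *)
Lemma ml_algP f : ml_alg f <-> finsupp f /\ forall l, sigsp l (f l).
Proof.
split=> [[s [x [sP fE]]]|[[s sP] fs]].
  split.
    exists [seq y.2 | y <- s] => l; apply: contraR => ls; apply/eqP.
    rewrite fE big_seq big1 // => y ys; have [x0 _ _ _] := sP y ys; apply: x0.
    by apply: contraNneq ls => ->; apply: map_f.
  move=> l; rewrite fE; apply: lin_closed_sum => [|y ys _]; first exact: sigsp_lin.
  have [x0 xs _ _] := sP y ys; have [->//|ly] := eqVneq l y.2.
  by rewrite x0 //; case: (sigsp_lin l).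
have [sr [pr prP]] := root_projections h_max; have [_ psum pin _ _] := prP.
exists [seq (al, l) | al <- sr, l <- undup s], (fun y => single y.2 (pr y.1 (f y.2))).
split=> [_ /allpairsP[[al l] [_ _ ->]]|mu].
  apply/ml_compP; exists (pr al (f l)) => //; split; first exact: pin.
  by move=> i; rewrite -(root_proj_sig prP) fs linearZ.
rewrite big_allpairs_dep /=.
rewrite [LHS]psum; apply: eq_bigr => al _.
have [mus|mus] := boolP (mu \in undup s).
  rewrite (bigD1_seq mu) ?undup_uniq //= singleE big1 ?addr0 // => l.
  by rewrite /single eq_sym => /negPf ->.
have -> : f mu = 0.
  by apply/eqP; apply: contraNT mus => /sP; rewrite mem_undup.
rewrite linear0 big_seq big1 // => l ls; rewrite /single.
by case: eqP => // e; rewrite e ls in mus.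
Qed.

Lemma ml_finsupp f : ml_alg f -> finsupp f. Proof. by move/ml_algP=> []. Qed.

Lemma ml_single l x : sigsp l x -> ml_alg (single l x).
Proof.
move=> xl; apply/ml_algP; split; first exact: finsupp_single.
move=> mu; rewrite /single; case: eqP => [->//|_]; exact: (sigsp_lin mu).1.
Qed.

Lemma ml_lin c f f' : ml_alg f -> ml_alg f' -> ml_alg (la_add (la_scale c f) f').
Proof.
move=> /ml_algP[ff fs] /ml_algP[ff' fs']; apply/ml_algP; split.
  by apply: finsupp_add => //; apply: finsupp_scale.
by move=> l; apply: (sigsp_lin l).2.
Qed.

Lemma ml_add f f' : ml_alg f -> ml_alg f' -> ml_alg (la_add f f').
Proof. by rewrite -{2}[f]la_scale1; apply: ml_lin. Qed.

Lemma ml_0 : ml_alg (@la0 k g n).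
Proof. by apply/ml_algP; split=> [|l]; [exists [::] => l; rewrite /la0 eqxx|exact: (sigsp_lin l).1]. Qed.

Lemma ml_br f f' : ml_alg f -> ml_alg f' -> ml_alg (la_br br f f').
Proof.
move=> /ml_algP[ff fs] /ml_algP[ff' fs']; apply/ml_algP; split; first exact: finsupp_br.
move=> l; apply: lin_closed_sum => [|mu _ _]; first exact: sigsp_lin.
by rewrite -[l in sigsp l](subrK mu) addrC; apply: sigsp_br.
Qed.

Lemma ml_ind (P : LA g n -> Prop) : P (@la0 k g n) ->
  (forall a x f, bipiece a x -> ml_alg f -> P f -> P (la_add (single a.2 x) f)) ->
  forall f, ml_alg f -> P f.
Proof.
move=> P0 PS f [s [x [sP fE]]].
have -> : f = fun mu => \sum_(y <- s) x y mu by apply: boolp.funext.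
move: sP => {fE f}; elim: s => [|y s IHs] sP.
  by rewrite (_ : (fun _ => _) = @la0 k g n) //; apply: boolp.funext => mu; rewrite big_nil.
have [v xE vy] := (ml_compP y (x y)).1 (sP y (mem_head _ _)).
have sP' z : z \in s -> ml_comp z (x z) by move=> zs; apply: sP; rewrite inE zs orbT.
rewrite (_ : (fun _ => _) = la_add (single y.2 v) (fun mu => \sum_(y <- s) x y mu)).
  by apply: PS => //; [exists s, x|apply: IHs].
by apply: boolp.funext => mu; rewrite big_cons xE.
Qed.

Definition in_Gamma (ga : 'rV[int]_n) : Prop := forall i, (m i %| ga 0%R i)%Z.

Lemma in_Gamma_lab l mu : in_Gamma (l - mu) <-> lab l = lab mu.
Proof.
split=> [lm|/lab_eqP lm i]; last by have := lm i; rewrite !mxE.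
by apply/lab_eqP => i; have := lm i; rewrite !mxE.
Qed.

Lemma sigsp_Gamma ga l x : in_Gamma ga -> sigsp l x -> sigsp (l + ga) x.
Proof.
move=> gG xl i; rewrite xl mxE expfzDr //.
by have /eqP -> : zeta (m i) ^ ga 0 i == 1; rewrite ?mulr1 // (zeta_exp_eq1 zeta_prim) ?(cfo_gt0 sig_cfo).
Qed.

Lemma sigsp_Gamma_eq l mu x : x != 0 -> sigsp l x -> sigsp mu x -> in_Gamma (l - mu).
Proof.
move=> x0 xl xmu; apply/in_Gamma_lab/ffunP => i; rewrite !ffunE.
have := xl i; rewrite xmu => /eqP; rewrite -subr_eq0 -scalerBl scaler_eq0 (negPf x0) orbF.
by rewrite subr_eq0 => /eqP.
Qed.

Lemma ml_shift ga f : in_Gamma ga -> ml_alg f -> ml_alg (la_shift ga f).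
Proof.
move=> gG /ml_algP[ff fs]; apply/ml_algP; split; first exact: finsupp_shift.
by move=> l; rewrite -[l in sigsp l](subrK ga); apply: sigsp_Gamma.
Qed.
End MultiloopBasics.

(** * Recovering the twist from a graded isomorphism *)

Section Schur.
Variables (k : closedFieldType) (g : vectType k) (br : g -> g -> g).
Hypotheses (brL : is_lie br) (brS : is_simple_lie br).

Lemma gen_eigen_eigenvector (f : 'End(g)) a x : gen_eigen f a x -> x != 0 ->
  exists v, v != 0 /\ f v = a *: v.
Proof.
case=> N; elim: N x => [|N IHN] x; first by move=> /= ->; rewrite eqxx.
rewrite iterSr => xN x0; have [e|] := eqVneq (shift f a x) 0; last exact: IHN.
by exists x; split=> //; move/eqP: e; rewrite shiftE subr_eq0 => /eqP.
Qed.

Lemma simple_neq0 : exists x : g, x != 0.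
Proof. by have [_ [x [y xy]] _] := brS; exists (br x y). Qed.

(** An eigenspace of [c] is a nonzero ideal. *)
Lemma schur (c : 'End(g)) : (forall x y, c (br x y) = br x (c y)) ->
  exists a, forall x, c x = a *: x.
Proof.
move=> cbr; have [x x0] := simple_neq0; have [s [p pP]] := gen_eigen_projections c.
have [a _ pa0] := proj_neq0 pP x0; have [_ _ pin _ _] := pP.
have [v [v0 cv]] := gen_eigen_eigenvector (pin a x) pa0.
exists a; apply: (simple_ideal brS (I := fun y => c y = a *: y)); last by exists v.
  split=> [|e y z cy cz]; first by rewrite linear0 scaler0.
  by rewrite linearP /= cy cz scalerDr !scalerA mulrC.
by move=> y z cz; rewrite cbr cz brZr.
Qed.
End Schur.

Section ShiftScalar.
Variables (k : closedFieldType) (V g : vectType k) (n : nat).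
Variables (brV : V -> V -> V) (br : g -> g -> g).
Hypotheses (brVL : is_lie brV) (brL : is_lie br) (brS : is_simple_lie br).
Variables (B : LA V n -> Prop) (theta : LA V n -> g) (ga : 'rV[int]_n).
Hypotheses (B_fin : forall u, B u -> finsupp u)
  (B_lin : forall c u v, B u -> B v -> B (la_add (la_scale c u) v))
  (B_br : forall u v, B u -> B v -> B (la_br brV u v))
  (B_shift : forall u, B u -> B (la_shift ga u))
  (B_unshift : forall u, B u -> B (la_shift (- ga) u))
  (theta_lin : forall c u v, B u -> B v ->
     theta (la_add (la_scale c u) v) = c *: theta u + theta v)
  (theta_br : forall u v, B u -> B v -> theta (la_br brV u v) = br (theta u) (theta v))
  (theta_surj : forall y, exists u, B u /\ theta u = y).

(* The shift is a centroid element: [ [w, T u] = T [w, u] = [T w, u] ].  Hence [T] maps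
   [ker theta] to elements whose image is central in [g], i.e. zero, and the operator it
   induces on [g] commutes with [ad g]. *)
Lemma shift_scalar : exists2 chi : k, chi != 0 &
  forall u, B u -> theta (la_shift ga u) = chi *: theta u.
Proof.
have ker u : B u -> theta u = 0 -> theta (la_shift ga u) = 0.
  move=> Bu u0; apply: (center_trivial brL brS) => y; have [w [Bw <-]] := theta_surj y.
  rewrite -(theta_br (B_shift Bu) Bw) la_shift_brl //; last exact: B_fin.
  by rewrite -la_shift_brr // theta_br ?u0 ?br0l //; apply: B_shift.
have shift_lin c (u v : LA V n) : la_shift ga (la_add (la_scale c u) v) =
  la_add (la_scale c (la_shift ga u)) (la_shift ga v) by [].
have well u v : B u -> B v -> theta u = theta v ->
    theta (la_shift ga u) = theta (la_shift ga v).
  move=> Bu Bv uv; have := ker (la_add (la_scale (-1) v) u) (B_lin _ Bv Bu).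
  rewrite theta_lin // shift_lin theta_lin; [|exact: B_shift|exact: B_shift].
  rewrite uv !scaleN1r addNr => /(_ erefl)/eqP; rewrite addrC subr_eq0 => /eqP.
  by [].
have [pre preP] := boolp.choice theta_surj.
pose c y := theta (la_shift ga (pre y)).
have Bpre y : B (pre y) by have [] := preP y.
have tpre y : theta (pre y) = y by have [] := preP y.
have cE u : B u -> theta (la_shift ga u) = c (theta u).
  by move=> Bu; apply: well => //; rewrite tpre.
have clin : linear c.
  move=> a y z; rewrite -[y in LHS]tpre -[z in LHS]tpre -theta_lin // -cE; last exact: B_lin.
  by rewrite shift_lin theta_lin //; apply: B_shift.
pose C : {linear g -> g} := HB.pack c (GRing.isLinear.Build _ _ _ _ c clin).
have [|chi chiP] := @schur _ _ _ brL brS (linfun C).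
  move=> x y; rewrite !lfunE /= -[x]tpre -[y in LHS]tpre -theta_br // -cE; last exact: B_br.
  by rewrite -la_shift_brr // theta_br //; apply: B_shift.
have cchi y : c y = chi *: y by rewrite -chiP lfunE.
exists chi; last by move=> u Bu; rewrite cE // cchi.
have [x x0] := simple_neq0 brS; apply: contraNneq x0 => chi0.
have := cE _ (B_unshift (Bpre x)); rewrite cchi chi0 scale0r.
have -> : la_shift ga (la_shift (- ga) (pre x)) = pre x.
  by apply: boolp.funext => l; rewrite /la_shift opprK subrK.
by rewrite tpre => ->.
Qed.
End ShiftScalar.

Section Evaluations.
Variables (k : closedFieldType) (k0 : [pchar k] =i pred0) (zeta : nat -> k).
Hypothesis zeta_prim : forall N : nat, (0 < N)%N -> N.-primitive_root (zeta N).
Variables (g : vectType k) (br : g -> g -> g).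
Hypothesis brL : is_lie br.
Variables (n : nat) (sig : 'I_n -> 'End(g)) (m : 'I_n -> nat) (h : {vspace g}).
Hypotheses (sig_cfo : cfo_tuple br sig m) (h_max : maxtoral brL sig h).
Variable a : 'rV[int]_n -> k.
Hypotheses (a0 : forall l, a l != 0) (aD : forall l mu, a (l + mu) = a l * a mu).
Notation L := (ml_alg zeta br sig m h).

Lemma ml_ev_surj x : exists f, L f /\ la_ev a f = x.
Proof.
have [s [sE ->]] := bipiece_span k0 zeta_prim sig_cfo h_max x.
elim: s sE => [|[b y] s IHs] sE.
  by exists (@la0 k g n); rewrite la_ev0 big_nil; split=> //; apply: ml_0 sig_cfo h_max.
have [|f [Lf fE]] := IHs; first by move=> q qs; apply: sE; rewrite inE qs orbT.
have /= [_ yb] := sE _ (mem_head _ _).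
have Ls : L (single b.2 ((a b.2)^-1 *: y)).
  by apply: (ml_single sig_cfo h_max); apply: (lin_closedZ (sigsp_lin zeta sig m b.2)).
exists (la_add (single b.2 ((a b.2)^-1 *: y)) f); split; first exact: (ml_add sig_cfo h_max).
rewrite la_ev_add ?fE ?big_cons /=; last exact: (ml_finsupp sig_cfo h_max Lf).
  by rewrite la_ev_single scalerA divff // scale1r.
exact: finsupp_single.
Qed.

Lemma ml_ev_br f f' : L f -> L f' -> la_ev a (la_br br f f') = br (la_ev a f) (la_ev a f').
Proof.
move=> Lf Lf'; move: f Lf; apply: ml_ind.
  by rewrite la_br0l // la_ev0 br0l.
move=> b x f bx Lf IHf; have ff := ml_finsupp sig_cfo h_max Lf.
rewrite la_br_addl // ?finsupp_single //; last exact: finsupp_single.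
have ff' := ml_finsupp sig_cfo h_max Lf'.
rewrite !la_ev_add ?finsupp_single // ?brDl //; try (by apply: finsupp_br => //; apply: finsupp_single); last exact: finsupp_single.
rewrite IHf; congr (_ + _); move: f' Lf' ff' {IHf}.
move=> f' Lf' _; move: f' Lf'; apply: ml_ind.
  by rewrite la_br0r // la_ev0 br0r.
move=> e y f' ey Lf' IHf'; have ff' := ml_finsupp sig_cfo h_max Lf'.
rewrite la_br_addr // !la_ev_add ?brDr ?IHf' //; try (by apply: finsupp_single);
  try (by apply: finsupp_br => //; apply: finsupp_single).
rewrite la_br_single // !la_ev_single; congr (_ + _).
by rewrite (brZl brL) (brZr brL) scalerA aD.
Qed.
End Evaluations.

Section LieIso.
Variables (k : fieldType) (V V' : lmodType k) (n : nat).
Variables (br : V -> V -> V) (br' : V' -> V' -> V') (B : LA V n -> Prop) (B' : LA V' n -> Prop).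
Variable Phi : LA V n -> LA V' n.
Hypothesis PhiI : lie_iso br br' B B' Phi.
Hypotheses (B0 : B (@la0 k V n))
  (B_lin : forall c u v, B u -> B v -> B (la_add (la_scale c u) v)).

Lemma lie_iso_add u v : B u -> B v -> Phi (la_add u v) = la_add (Phi u) (Phi v).
Proof. by case: PhiI => _ _ _ h _ Bu Bv; have := h 1 u v Bu Bv; rewrite !la_scale1. Qed.

Lemma lie_iso0 : Phi (@la0 k V n) = @la0 k V' n.
Proof.
have := lie_iso_add B0 B0; rewrite la_add0 => e; apply: boolp.funext => l.
by apply: (@addrI _ (Phi (@la0 k V n) l)); rewrite -[LHS]/(la_add _ _ l) -e [RHS]addr0.
Qed.

Lemma lie_iso_inverse : (forall u v, B u -> B v -> B (la_br br u v)) ->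
  exists Psi, lie_iso br' br B' B Psi /\ forall v, B' v -> Phi (Psi v) = v.
Proof.
move=> B_br; have [P1 P2 P3 P4 P5] := PhiI.
have /boolp.choice[Psi PsiP] : forall v, exists u, B' v -> B u /\ Phi u = v.
  move=> v; have [/P2[u uP]|nv] := boolp.EM (B' v); first by exists u.
  by exists (@la0 k V n) => /nv.
have BPsi v : B' v -> B (Psi v) by move=> /PsiP[].
have PhiPsi v : B' v -> Phi (Psi v) = v by move=> /PsiP[].
have B'_lin c u v : B' u -> B' v -> B' (la_add (la_scale c u) v).
  move=> B'u B'v; rewrite -(PhiPsi u B'u) -(PhiPsi v B'v).
  by rewrite -P4; [apply/P1/B_lin; apply: (BPsi)|apply: (BPsi)|apply: (BPsi)].
have B'_br u v : B' u -> B' v -> B' (la_br br' u v).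
  move=> B'u B'v; rewrite -(PhiPsi u B'u) -(PhiPsi v B'v).
  by rewrite -P5; [apply/P1/B_br; apply: (BPsi)|apply: (BPsi)|apply: (BPsi)].
exists Psi; split=> //; split=> //.
- move=> u Bu; exists (Phi u); have B'u := P1 _ Bu; split=> //.
  by apply: P3 => //; rewrite ?PhiPsi //; apply: (BPsi).
- by move=> u v B'u B'v e; rewrite -(PhiPsi u B'u) -(PhiPsi v B'v) e.
- move=> a u v B'u B'v; have Bu := BPsi u B'u; have Bv := BPsi v B'v.
  apply: P3; [exact/BPsi/B'_lin|exact: B_lin|].
  by rewrite P4 // !PhiPsi //; apply: (B'_lin).
- move=> u v B'u B'v; have Bu := BPsi u B'u; have Bv := BPsi v B'v.
  apply: P3; [exact/BPsi/B'_br|exact: B_br|].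
  by rewrite P5 // !PhiPsi //; apply: (B'_br).
Qed.
End LieIso.

Lemma closed_root (k : closedFieldType) (c : k) N : (0 < N)%N -> exists a, a ^+ N = c.
Proof.
move=> N0; have /closed_rootP[a] : size ('X^N - c%:P) != 1%N.
  by rewrite size_XnsubC // eqSS -lt0n.
by rewrite rootE !hornerE subr_eq0 => /eqP; exists a.
Qed.

Lemma Gamma_gen n (m : 'I_n -> nat) (P : 'rV[int]_n -> Prop) :
  (forall i, P (delta_mx 0 i *+ m i)) -> P 0 -> (forall x y, P x -> P y -> P (x - y)) ->
  forall ga, in_Gamma m ga -> P ga.
Proof.
move=> Pd P0 PB ga gG.
have PN x : P x -> P (- x) by rewrite -sub0r; apply: PB.
have PD x y : P x -> P y -> P (x + y) by move=> Px Py; rewrite -[y]opprK; apply/PB/PN.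
have Pn x N : P x -> P (x *+ N).
  by move=> Px; elim: N => [//|N IHN]; rewrite mulrS; apply: PD.
have Pz x (z : int) : P x -> P (x *~ z).
  by move=> Px; case: z => N; [apply: Pn|rewrite NegzE mulrNz; apply/PN/Pn].
rewrite (row_sum_delta ga); elim/big_ind: _ => // i _.
have -> : ga 0 i *: delta_mx 0 i = (delta_mx 0 i *+ m i) *~ (ga 0%R i %/ m i)%Z :> 'rV[int]_n.
  by rewrite -scaler_int intz -scaler_nat scalerA natz divzK.
exact/Pz/Pd.
Qed.

(** * From an isomorphism of loop algebras to one of the simple algebras *)

Section Descent.
Variables (k : closedFieldType) (k0 : [pchar k] =i pred0) (zeta : nat -> k).
Hypothesis zeta_prim : forall N : nat, (0 < N)%N -> N.-primitive_root (zeta N).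
Variables (n : nat).
Variables (g : vectType k) (br : g -> g -> g).
Hypotheses (brL : is_lie br) (brS : is_simple_lie br).
Variables (sig : 'I_n -> 'End(g)) (m : 'I_n -> nat) (h : {vspace g}).
Hypotheses (sig_cfo : cfo_tuple br sig m) (h_max : maxtoral brL sig h).
Variables (g' : vectType k) (br' : g' -> g' -> g').
Hypotheses (br'L : is_lie br') (br'S : is_simple_lie br').
Variables (sig' : 'I_n -> 'End(g')) (m' : 'I_n -> nat) (h' : {vspace g'}).
Hypotheses (sig'_cfo : cfo_tuple br' sig' m') (h'_max : maxtoral br'L sig' h').
Notation L := (ml_alg zeta br sig m h).
Notation L' := (ml_alg zeta br' sig' m' h').
Variable Phi : LA g n -> LA g' n.
Hypothesis PhiI : lie_iso br br' L L' Phi.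

Let one : 'rV[int]_n -> k := fun=> 1.
Definition descent (u : LA g n) : g' := la_ev one (Phi u).
Notation theta := descent.

Let L_lin := ml_lin (zeta := zeta) sig_cfo h_max.
Let L_fin := ml_finsupp (zeta := zeta) sig_cfo h_max.
Let L'_fin := ml_finsupp (zeta := zeta) sig'_cfo h'_max.

Lemma descent_lin c u v : L u -> L v -> theta (la_add (la_scale c u) v) = c *: theta u + theta v.
Proof.
case: PhiI => P1 _ _ P4 _ Lu Lv; rewrite /theta P4 // la_ev_lin //; apply: L'_fin; exact: P1.
Qed.

Lemma descent_br u v : L u -> L v -> theta (la_br br u v) = br' (theta u) (theta v).
Proof.
case: PhiI => P1 _ _ _ P5 Lu Lv; rewrite /theta P5 //.
have oneD l mu : one (l + mu) = one l * one mu by rewrite /one mulr1.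
exact: (ml_ev_br sig'_cfo h'_max oneD (P1 u Lu) (P1 v Lv)).
Qed.

Lemma descent_surj y : exists u, L u /\ theta u = y.
Proof.
have [|f [Lf <-]] := ml_ev_surj k0 zeta_prim sig'_cfo h'_max (a := one) _ y.
  by move=> l; apply: oner_neq0.
by case: PhiI => _ P2 _ _ _; have [u [Lu <-]] := P2 f Lf; exists u.
Qed.

Lemma descent_shift ga : in_Gamma m ga -> exists2 chi : k, chi != 0 &
  forall u, L u -> theta (la_shift ga u) = chi *: theta u.
Proof.
move=> gG; apply: (@shift_scalar k g g' n br br' brL br'L br'S L).
- exact: L_fin.
- exact: L_lin.
- by apply: (ml_br zeta_prim sig_cfo h_max).
- by move=> u; apply: (ml_shift zeta_prim sig_cfo h_max).
- move=> u; apply: (ml_shift zeta_prim sig_cfo h_max) => i.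
  by have := gG i; rewrite mxE !dvdzE abszN.
- exact: descent_lin.
- exact: descent_br.
- exact: descent_surj.
Qed.

(** Shifts by Gamma act through scalars. Taking an [m i]-th root [c i] of the scalar at the
    generator [m i] e_i extends them to a character of all of Z^n. *)
Lemma descent_character : exists a : 'rV[int]_n -> k,
  [/\ forall l, a l != 0, forall l mu, a (l + mu) = a l * a mu &
      forall ga, in_Gamma m ga -> forall u, L u -> theta (la_shift ga u) = a ga *: theta u].
Proof.
have m0 i : (0 < m i)%N by apply: cfo_gt0 sig_cfo i.
have dG i : in_Gamma m (delta_mx 0 i *+ m i).
  move=> j; rewrite mulmxnE mxE eqxx /=; case: (j =P i) => [->|_]; last by rewrite mul0rn dvdz0.
  by rewrite -[_ *+ m i]/((m i)%:R) natz dvdzz.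
have /boolp.choice[c cP] : forall i, exists c : k, c != 0 /\
    forall u, L u -> theta (la_shift (delta_mx 0 i *+ m i) u) = c ^+ m i *: theta u.
  move=> i; have [chi chi0 chiP] := descent_shift (dG i).
  have [c cE] := closed_root chi (m0 i); exists c; split.
    by apply: contraNneq chi0 => c0; rewrite -cE c0 expr0n gtn_eqF.
  by move=> u Lu; rewrite cE chiP.
have c0 i : c i != 0 by case: (cP i).
pose a (l : 'rV[int]_n) := \prod_i c i ^ l 0 i.
have an0 l : a l != 0 by apply/prodf_neq0 => i _; apply: expfz_neq0.
have aD l mu : a (l + mu) = a l * a mu.
  by rewrite /a -big_split; apply: eq_bigr => i _; rewrite mxE expfzDr.
exists a; split=> //; have a0 : a 0 = 1 by rewrite /a big1 // => i _; rewrite mxE expr0z.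
suff : forall ga, in_Gamma m ga -> in_Gamma m ga /\
    forall u, L u -> theta (la_shift ga u) = a ga *: theta u.
  by move=> hG ga /hG[].
have shiftD x y (u : LA g n) : la_shift (x + y) u = la_shift x (la_shift y u).
  by apply: boolp.funext => l; rewrite /la_shift opprD addrA.
apply: Gamma_gen.
- move=> i; split=> // u Lu; have [_ ci] := cP i; rewrite (ci u Lu); congr (_ *: _).
  rewrite /a (bigD1 i) //= big1 ?mulr1 => [|j ji].
    by rewrite mulmxnE mxE !eqxx -[_ *+ m i]/((m i)%:R) natz.
  by rewrite mulmxnE mxE eqxx (negPf ji) mul0rn expr0z.
- split=> [i|u Lu]; first by rewrite mxE dvdz0.
  by rewrite a0 scale1r; congr descent; apply: boolp.funext => l; rewrite /la_shift subr0.
- move=> x y [xG xE] [yG yE]; split=> [i|u Lu].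
    by rewrite !mxE; apply: rpredB; [apply: xG|apply: yG].
  have Lv : L (la_shift (- y) u).
    apply: (ml_shift zeta_prim sig_cfo h_max) Lu => i.
    by have := yG i; rewrite mxE !dvdzE abszN.
  have := yE _ Lv; rewrite -shiftD subrr => e.
  have e2 : theta (la_shift (- y) u) = (a y)^-1 *: theta u.
    apply: (canRL (scalerK (an0 y))); rewrite -e; congr descent.
    by apply: boolp.funext => l; rewrite /la_shift subr0.
  rewrite shiftD xE // e2 scalerA; congr (_ *: _); apply: (mulIf (an0 y)).
  by rewrite -aD subrK divfK.
Qed.

(** On a piece, [a (- l)] times [theta (single l x)] does not depend on the degree [l] chosen,
    because [a] compensates shifts by Gamma. So these maps assemble to a linear [phi] with
    [phi (la_ev a u) = theta u]; it is onto because [theta] is, and injective because its kernel is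
    an ideal. *)
Lemma descent_iso : exists (phi : 'Hom(g, g')) (a : 'rV[int]_n -> k),
  [/\ bijective phi, forall x y, phi (br x y) = br' (phi x) (phi y),
      forall l, a l != 0 &
      forall (b : hdual h * 'rV[int]_n) x, bipiece zeta br sig m b x -> phi x = a b.2 *: theta (single b.2 x)].
Proof.
have [a [a0 aD aG]] := descent_character.
have [s [p pP]] := piece_projections k0 zeta_prim sig_cfo h_max.
have [us psum pin pid p0] := pP.
(* [rep] picks a degree for each nonzero piece; its value on zero pieces is a dummy. *)
have /boolp.choice[rep repP] : forall b : hdual h * {ffun 'I_n -> k}, exists l : 'rV[int]_n,
    (exists x, piece br sig b x /\ x != 0) -> b.2 = lab zeta m l.
  move=> b; have [[x [xb x0]]|no] := boolp.EM (exists x, piece br sig b x /\ x != 0).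
    by have [l ->] := piece_ex zeta_prim sig_cfo xb x0; exists l.
  by exists 0 => /no.
have sigsp0 l : sigsp zeta sig m l 0 by case: (sigsp_lin zeta sig m l).
have prep b x : sigsp zeta sig m (rep b) (p b x).
  have [->//|px0] := eqVneq (p b x) 0.
  have bE : b.2 = lab zeta m (rep b) by apply: repP; exists (p b x).
  have [_ ps] := pin b x.
  by move=> i; rewrite ps bE ffunE.
have Lsingle b x : L (single (rep b) (p b x)) by apply: (ml_single sig_cfo h_max).
pose f x := \sum_(b <- s) a (- rep b) *: theta (single (rep b) (p b x)).
have flin : linear f.
  move=> c x y; rewrite /f scaler_sumr -big_split; apply: eq_bigr => b _ /=.
  by rewrite linearP /= single_lin descent_lin // scalerDr !scalerA mulrC.
pose F : {linear g -> g'} := HB.pack f (GRing.isLinear.Build _ _ _ _ f flin).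
have aN l : a (- l) * a l = 1.
  by apply: (mulIf (a0 0)); rewrite -aD addNr mul1r -aD addr0.
have phiE (b : hdual h * 'rV[int]_n) x : bipiece zeta br sig m b x -> linfun F x = a (- b.2) *: theta (single b.2 x).
  case: b => al l xb; rewrite lfunE /= /f.
  have xp : piece br sig (al, lab zeta m l) x by apply/piece_lab.
  have [->|x0] := eqVneq x 0.
    have t0 : theta (@la0 k g n) = 0.
      by rewrite /descent (lie_iso0 PhiI) ?la_ev0 //; apply: (ml_0 zeta sig_cfo h_max).
    rewrite single0 t0 scaler0 big1 // => b _.
    by rewrite linear0 single0 t0 scaler0.
  pose b := (al, lab zeta m l).
  have bs : b \in s by apply: contraNT x0 => bs; rewrite -(pid b x xp) (proj_out pP).
  rewrite (bigD1_seq b) //= big1 ?addr0 => [|b' b'b]; last first.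
    rewrite (p0 _ b) // single0; have -> : theta (@la0 k g n) = 0.
      by rewrite /descent (lie_iso0 PhiI) ?la_ev0 //; apply: (ml_0 zeta sig_cfo h_max).
    by rewrite scaler0.
  rewrite pid //; have lr : lab zeta m l = lab zeta m (rep b).
    by apply: (repP b); exists x.
  have dG := (in_Gamma_lab zeta_prim sig_cfo l (rep b)).2 lr.
  have e : single l x = la_shift (l - rep b) (single (rep b) x) :> LA g n.
    by rewrite la_shift_single addrCA subrr addr0.
  rewrite e aG //; last by rewrite -(pid b x xp).
  by rewrite scalerA -aD addKr.
pose phi : 'Hom(g, g') := linfun F.
have phi_br x y : phi (br x y) = br' (phi x) (phi y).
  have [sx [sxE ->]] := bipiece_span k0 zeta_prim sig_cfo h_max x.
  have [sy [syE ->]] := bipiece_span k0 zeta_prim sig_cfo h_max y.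
  rewrite br_suml // !linear_sum br_suml // big_seq [RHS]big_seq; apply: eq_bigr => -[b u] /sxE /= ub.
  rewrite br_sumr // !linear_sum br_sumr // big_seq [RHS]big_seq; apply: eq_bigr => -[d v] /syE /= vd.
  rewrite (phiE _ _ (bipiece_br zeta_prim brL sig_cfo ub vd)) (phiE _ _ ub) (phiE _ _ vd).
  have Lu : L (single b.2 u) by apply: (ml_single sig_cfo h_max); case: ub.
  have Lv : L (single d.2 v) by apply: (ml_single sig_cfo h_max); case: vd.
  rewrite -(la_br_single brL) (descent_br Lu Lv) (brZl br'L) (brZr br'L) scalerA.
  by rewrite -aD -opprD.
have phi_ev u : L u -> phi (la_ev a u) = theta u.
  have t0 : theta (@la0 k g n) = 0.
    by rewrite /descent (lie_iso0 PhiI) ?la_ev0 //; apply: (ml_0 zeta sig_cfo h_max).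
  move: u; apply: ml_ind; first by rewrite la_ev0 linear0 t0.
  move=> b x u xb Lu IHu; have Ls : L (single b.2 x) by apply: (ml_single sig_cfo h_max); case: xb.
  rewrite la_ev_add; [|exact: finsupp_single|exact: L_fin].
  rewrite linearD /= IHu la_ev_single linearZ /= (phiE _ _ xb) scalerA [a _ * _]mulrC aN scale1r.
  by rewrite -[single _ _ in RHS]la_scale1 descent_lin // scale1r.
have phi_surj y : exists x, phi x = y.
  by have [u [Lu <-]] := descent_surj y; exists (la_ev a u); rewrite phi_ev.
have ker0 : lker phi == 0%VS.
  rewrite -subv0; apply/subvP => x; rewrite memv_ker memv0 => /eqP ex; apply/negPn/negP => x0.
  have z : forall y, phi y = 0.
    apply: (simple_ideal brS (I := fun y => phi y = 0)); last by exists x.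
      by split=> [|c u v u0 v0]; rewrite ?linear0 // linearP /= u0 v0 scaler0 addr0.
    by move=> u v v0; rewrite phi_br v0 br0r.
  have [y /eqP y0] := simple_neq0 br'S; have [w wy] := phi_surj y.
  by apply: y0; rewrite -wy z.
exists phi, (fun l => a (- l)); split=> //.
exists (phi^-1)%VF => y; first exact: lker0_lfunK.
by rewrite limg_lfunVK //; have [x <-] := phi_surj y; rewrite memv_img ?memvf.
Qed.

(** The image of [single b.2 x] sits in one degree, so its value at t = 1 is its only coefficient,
    an eigenvector of [sig']. *)
Lemma descent_supported (psi : hdual h * 'rV[int]_n -> 'rV[int]_n) :
  (forall (b : hdual h * 'rV[int]_n) x, bipiece zeta br sig m b x -> x != 0 ->
     forall mu, mu != psi b -> Phi (single b.2 x) mu = 0) ->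
  exists phi : 'Hom(g, g'),
  [/\ bijective phi, forall x y, phi (br x y) = br' (phi x) (phi y) &
      forall (b : hdual h * 'rV[int]_n) x, bipiece zeta br sig m b x -> x != 0 -> sigsp zeta sig' m' (psi b) (phi x)].
Proof.
move=> psiP; have [phi [a [phi_bij phi_br a0 phiE]]] := descent_iso.
exists phi; split=> // b x xb x0; rewrite (phiE b x xb).
apply: (lin_closedZ (sigsp_lin zeta sig' m' _)).
have Ls : L (single b.2 x) by apply: (ml_single sig_cfo h_max); case: xb.
have e := supported_single (psiP b x xb x0).
rewrite /descent e la_ev_single scale1r.
have [P1 _ _ _ _] := PhiI.
by have [_] := (ml_algP zeta sig'_cfo h'_max _).1 (P1 _ Ls); apply.
Qed.
End Descent.

Section GeneratedSubgroup.
Variables (G : zmodType) (S : G -> Prop).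

Lemma gen_subgroup_in x : S x -> gen_subgroup S x.
Proof.
move=> Sx; exists [:: (1, x)]; rewrite big_seq1 mulr1z; split=> // q.
by rewrite inE => /eqP ->.
Qed.

Lemma gen_subgroup0 : gen_subgroup S 0.
Proof. by exists [::]; rewrite big_nil. Qed.

Lemma gen_subgroupD x y : gen_subgroup S x -> gen_subgroup S y -> gen_subgroup S (x + y).
Proof.
move=> [s [sS ->]] [t [tS ->]]; exists (s ++ t); rewrite big_cat; split=> // q.
by rewrite mem_cat => /orP[/sS|/tS].
Qed.

Lemma gen_subgroupN x : gen_subgroup S x -> gen_subgroup S (- x).
Proof.
move=> [s [sS ->]]; exists [seq (- q.1, q.2) | q <- s]; rewrite big_map -sumrN; split.
  by move=> _ /mapP[q /sS qS ->].
by apply: eq_bigr => q _; rewrite mulrNz.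
Qed.

Lemma gen_subgroup_ind (P : G -> Prop) : P 0 -> (forall x y, P x -> P y -> P (x + y)) ->
  (forall x, P x -> P (- x)) -> (forall x, S x -> P x) -> forall x, gen_subgroup S x -> P x.
Proof.
move=> P0 PD PN PS x [s [sS ->]].
have Pn y N : P y -> P (y *+ N).
  by move=> Py; elim: N => [//|N IHN]; rewrite mulrS; apply: PD.
rewrite big_seq; elim/big_ind: _ => // q /sS/PS Pq.
by case: (q.1) => N; [apply: Pn|rewrite NegzE mulrNz; apply/PN/Pn].
Qed.

Variables (H : zmodType) (f : G -> H).
Hypothesis f_hom : hom_on (gen_subgroup S) f.

Lemma hom_on0 : f 0 = 0.
Proof. by apply: (@addrI _ (f 0)); rewrite -f_hom ?addr0 //; apply: gen_subgroup0. Qed.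

Lemma hom_onN x : gen_subgroup S x -> f (- x) = - f x.
Proof.
move=> Sx; apply: (@addrI _ (f x)); rewrite -f_hom ?subrr ?hom_on0 //.
exact: gen_subgroupN.
Qed.

Lemma hom_onMn x N : gen_subgroup S x -> f (x *+ N) = f x *+ N.
Proof.
move=> Sx; elim: N => [|N IHN]; first exact: hom_on0.
rewrite !mulrS f_hom ?IHN //; elim: N {IHN} => [|N IHN]; first exact: gen_subgroup0.
by rewrite mulrS; apply: gen_subgroupD.
Qed.

Lemma gen_subgroup_hom (T : H -> Prop) : (forall x, S x -> gen_subgroup T (f x)) ->
  forall x, gen_subgroup S x -> gen_subgroup T (f x).
Proof.
move=> ST x Sx; suff [] : gen_subgroup S x /\ gen_subgroup T (f x) by [].
move: x Sx; apply: (gen_subgroup_ind (P := fun x => gen_subgroup S x /\ gen_subgroup T (f x))).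
- by rewrite hom_on0; split; [apply: gen_subgroup0|exists [::]; rewrite big_nil].
- move=> x y [Sx [s [sT xE]]] [Sy [t [tT yE]]]; split; first exact: gen_subgroupD.
  rewrite f_hom //; exists (s ++ t); rewrite big_cat xE yE; split=> // q.
  by rewrite mem_cat => /orP[/sT|/tT].
- move=> x [Sx [s [sT xE]]]; split; first exact: gen_subgroupN.
  rewrite hom_onN //; exists [seq (- q.1, q.2) | q <- s]; rewrite xE big_map -sumrN; split.
    by move=> _ /mapP[q /sT qT ->].
  by apply: eq_bigr => q _; rewrite mulrNz.
- by move=> x Sx; split; [apply: gen_subgroup_in|apply: ST].
Qed.
End GeneratedSubgroup.

Lemma gen_subgroup_image (G H : zmodType) (S : G -> Prop) (T : H -> Prop) (f : G -> H) :
  hom_on (gen_subgroup S) f -> (forall y, T y -> exists x, gen_subgroup S x /\ f x = y) ->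
  forall y, gen_subgroup T y -> exists x, gen_subgroup S x /\ f x = y.
Proof.
move=> f_hom TS; apply: gen_subgroup_ind => //.
- by exists 0; split; [apply: gen_subgroup0|apply: hom_on0 f_hom].
- move=> _ _ [x [Sx <-]] [y [Sy <-]]; exists (x + y); rewrite f_hom //; split=> //.
  exact: gen_subgroupD.
- move=> _ [x [Sx <-]]; exists (- x); rewrite (hom_onN f_hom) //; split=> //.
  exact: gen_subgroupN.
Qed.

Section TuplePower.
Variables (k : fieldType) (g : vectType k) (n : nat).

Lemma endpow_eigen (f : 'End(g)) (z : int) (c : k) x : lker f == 0%VS ->
  f x = c *: x -> c != 0 -> endpow f z x = c ^ z *: x.
Proof.
move=> ker0 fx c0; have fVx : (f^-1)%VF x = c^-1 *: x.
  by rewrite -{1}[x](scalerK c0) -fx linearZ /= lker0_lfunK.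
case: z => N /=.
  elim: N => [|N IHN]; first by rewrite id_lfunE expr0z scale1r.
  by rewrite /= comp_lfunE IHN linearZ /= fx scalerA -exprSzr.
have e j : iter j (fun u => f^-1 \o u)%VF \1%VF x = c ^- j *: x.
  elim: j => [|j IHj]; first by rewrite id_lfunE expr0 invr1 scale1r.
  by rewrite /= comp_lfunE IHj linearZ /= fVx scalerA -invfM -exprSr.
by rewrite comp_lfunE e linearZ /= fVx scalerA -invfM -exprSr.
Qed.

Lemma tuple_powP_eigen (u : 'I_n -> 'End(g)) (P : 'M[int]_n) j (c : 'I_n -> k) x :
  (forall i, lker (u i) == 0%VS) -> (forall i, u i x = c i *: x) -> (forall i, c i != 0) ->
  tuple_powP u P j x = (\prod_i c i ^ P i j) *: x.
Proof.
move=> ker0 ux c0; rewrite /tuple_powP.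
elim: (index_enum _) => [|i r IHr]; first by rewrite !big_nil id_lfunE scale1r.
rewrite !big_cons comp_lfunE IHr linearZ /= (endpow_eigen _ (ker0 i) (ux i) (c0 i)).
by rewrite scalerA mulrC.
Qed.
End TuplePower.

(** * Extracting the matrix and the twist from a degree map *)

Section Reconstruction.
Variables (k : closedFieldType) (k0 : [pchar k] =i pred0) (zeta : nat -> k).
Hypothesis zeta_prim : forall N : nat, (0 < N)%N -> N.-primitive_root (zeta N).
Hypothesis zeta_compat : forall M N : nat, (0 < M)%N -> (0 < N)%N ->
  zeta (M * N)%N ^+ M = zeta N.
Variables (n : nat).
Variables (g : vectType k) (br : g -> g -> g).
Hypotheses (brL : is_lie br) (brS : is_simple_lie br).
Variables (sig : 'I_n -> 'End(g)) (m : 'I_n -> nat) (h : {vspace g}).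
Hypotheses (sig_cfo : cfo_tuple br sig m) (h_max : maxtoral brL sig h).
Variables (g' : vectType k) (br' : g' -> g' -> g').
Hypotheses (br'L : is_lie br') (br'S : is_simple_lie br').
Variables (sig' : 'I_n -> 'End(g')) (m' : 'I_n -> nat) (h' : {vspace g'}).
Hypotheses (sig'_cfo : cfo_tuple br' sig' m') (h'_max : maxtoral br'L sig' h').
Notation L := (ml_alg zeta br sig m h).
Notation L' := (ml_alg zeta br' sig' m' h').
Notation Lc := (ml_comp zeta br sig m (h := h)).
Notation bipiece := (bipiece zeta br sig m (h := h)).
Notation S := (gen_subgroup (supp_of Lc)).
Implicit Types (b d : hdual h * 'rV[int]_n).

Lemma supp_bipiece b : supp_of Lc b <-> exists x, bipiece b x /\ x != 0.
Proof.
split=> [[f [/ml_compP[x -> xb] f0]]|[x [xb x0]]].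
  exists x; split=> //; apply/eqP => x0; apply: f0; rewrite x0; exact: single0.
by exists (single b.2 x); split; [apply/ml_compP; exists x|apply: single_neq0].
Qed.

Lemma bipiece_ex : exists b x, bipiece b x /\ x != 0.
Proof.
have [x x0] := simple_neq0 brS; have [s [p pP]] := piece_projections k0 zeta_prim sig_cfo h_max.
have [[al c] _ pa0] := proj_neq0 pP x0; have [_ _ pin _ _] := pP.
have [l al_l] := piece_ex zeta_prim sig_cfo (pin _ x) pa0.
exists (al, l), (p (al, c) x); split=> //; apply/piece_lab; rewrite /= in al_l.
by rewrite -al_l; apply: pin.
Qed.

Lemma bipiece_Gamma ga b x : in_Gamma m ga -> bipiece b x -> bipiece (b + (0, ga)) x.
Proof.
move=> gG [xr xs]; split; first by rewrite /= addr0.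
exact: (sigsp_Gamma zeta_prim sig_cfo gG xs).
Qed.

Lemma S_bipiece b x : bipiece b x -> x != 0 -> S b.
Proof. by move=> xb x0; apply/gen_subgroup_in/supp_bipiece; exists x. Qed.

(** [(0, ga)] is the difference of two degrees that carry the same nonzero vector. *)
Lemma S_Gamma ga : in_Gamma m ga -> S (0, ga).
Proof.
move=> gG; have [b [x [xb x0]]] := bipiece_ex.
have -> : (0, ga) = (b + (0, ga)) - b by rewrite addrAC subrr add0r.
apply: gen_subgroupD; first exact: S_bipiece (bipiece_Gamma gG xb) x0.
exact/gen_subgroupN/(S_bipiece xb x0).
Qed.

Lemma S_in_Qh b : S b -> in_Qh br b.1.
Proof.
apply: (gen_subgroup_ind (P := fun b => in_Qh br b.1)) => [|x y|x|x /supp_bipiece[y [[yr _] y0]]].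
- exact: gen_subgroup0.
- exact: gen_subgroupD.
- exact: gen_subgroupN.
- exact: in_Qh_root y0.
Qed.

(** A nonzero vector of root [be] has a bihomogeneous term with nonzero [be]-component, and such a
    term has root [be] itself. *)
Lemma in_Qh_S al : in_Qh br al -> exists l, S (al, l).
Proof.
apply: (gen_subgroup_ind (P := fun al => exists l, S (al, l))) => [|x y [l xl] [mu ymu]|x [l xl]|be [be0 [x [x0 xbe]]]].
- by exists 0; apply: gen_subgroup0.
- by exists (l + mu); apply: (gen_subgroupD xl ymu).
- by exists (- l); apply: (gen_subgroupN xl).
have [s [p pP]] := root_projections h_max; have [_ _ pin pid p0] := pP.
have [t [tE xE]] := bipiece_span k0 zeta_prim sig_cfo h_max x.
have [/hasP[[b y] yt /= yb]|/hasPn no] := boolP (has (fun q => p be q.2 != 0) t).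
  have [yr ys] := tE _ yt; have bE : b.1 = be.
    apply/eqP; apply: contraNT yb => bbe; apply/eqP/(p0 _ b.1) => //.
    by rewrite eq_sym.
  exists b.2; rewrite -bE -surjective_pairing; apply: (@S_bipiece _ y) => //.
  by apply: contraNneq yb => ->; rewrite linear0.
case/eqP: x0; rewrite -(pid be x xbe) xE linear_sum big_seq big1 // => q /no.
by rewrite negbK => /eqP.
Qed.

(** Dividing by [q] turns Gamma into Z^n and degrees into exponents for [zeta_pow]. *)
Definition qrow (q : 'I_n -> nat) (l : 'rV[int]_n) : 'rV[rat]_n :=
  \row_i ((l 0 i)%:~R / (q i)%:R).

Lemma qrowD q l mu : qrow q (l + mu) = qrow q l + qrow q mu.
Proof. by apply/rowP => i; rewrite !mxE rmorphD mulrDl. Qed.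

Lemma qrowB q l mu : qrow q (l - mu) = qrow q l - qrow q mu.
Proof. by apply/rowP => i; rewrite !mxE rmorphB mulrBl. Qed.

Lemma qrow0 q : qrow q 0 = 0.
Proof. by apply/rowP => i; rewrite !mxE mul0r. Qed.

Lemma qrowMn q l N : qrow q (l *+ N) = qrow q l *+ N.
Proof. by elim: N => [|N IHN]; rewrite ?qrow0 // !mulrS qrowD IHN. Qed.

Section Twist.
Variables (s : hdual h -> 'rV[rat]_n) (P : 'M[int]_n) (tau : 'I_n -> 'End(g)).
Hypothesis tauE : forall i (al : hdual h) (x : g), in_Qh br al -> rootsp br al x ->
  tau i x = zeta_pow zeta (- (s al) 0 i) *: x.

Definition twist_row b : 'rV[rat]_n := qrow m b.2 - s b.1.

Lemma twist_piece b x i : bipiece b x ->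
  (tau i \o sig i)%VF x = zeta_pow zeta (twist_row b 0 i) *: x.
Proof.
have [->|x0] := eqVneq x 0; first by rewrite linear0 scaler0.
case=> xr xs; rewrite comp_lfunE xs linearZ /= (tauE i (in_Qh_root xr x0) xr) scalerA.
congr (_ *: _).
have -> : twist_row b 0 i = (b.2 0 i)%:~R / (m i)%:R - (s b.1) 0 i.
  by rewrite mxE [X in X + _]mxE [X in _ + X = _]mxE.
by rewrite zeta_powD // zeta_powE // (cfo_gt0 sig_cfo).
Qed.

(** Negative exponents in [endpow] use [f^-1], a true inverse only for injective maps; here each
    piece is scaled by a root of unity. *)
Lemma twist_ker i : lker (tau i \o sig i)%VF == 0%VS.
Proof.
rewrite -subv0; apply/subvP => x; rewrite memv_ker memv0 => ux.
have [sp [pp ppP]] := piece_projections k0 zeta_prim sig_cfo h_max.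
have [_ psp pip pidp _] := ppP.
apply: contraT => x0; have [a _ pa0] := proj_neq0 ppP x0.
have [l al] := piece_ex zeta_prim sig_cfo (pip a x) pa0.
have pbi : bipiece (a.1, l) (pp a x).
  by apply/piece_lab; rewrite -al -surjective_pairing.
have : pp a ((tau i \o sig i)%VF x) = (tau i \o sig i)%VF (pp a x).
  apply: (proj_comm ppP) => d y yd.
  have [->|y0] := eqVneq y 0; first by rewrite linear0; case: (piece_lin brL sig d).
  have [mu dmu] := piece_ex zeta_prim sig_cfo yd y0.
  have ybi : bipiece (d.1, mu) y by apply/piece_lab; rewrite -dmu -surjective_pairing.
  rewrite (twist_piece _ ybi); exact: (lin_closedZ (piece_lin brL sig d)).
rewrite (eqP ux) linear0 (twist_piece _ pbi) => /esym/eqP.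
by rewrite scaler_eq0 (negPf (zeta_pow_neq0 zeta_prim _)) (negPf pa0).
Qed.

Lemma twist_tuple j b x : bipiece b x ->
  tuple_powP (fun i => tau i \o sig i)%VF P j x =
  zeta_pow zeta ((twist_row b *m map_mx intr P) 0 j) *: x.
Proof.
move=> xb; rewrite (tuple_powP_eigen P j twist_ker (fun i => twist_piece i xb)).
  congr (_ *: _); rewrite mxE zeta_pow_sum //; apply: eq_bigr => i _.
  by rewrite [map_mx _ _ _ _]mxE zeta_powMz.
by move=> i; apply: zeta_pow_neq0.
Qed.
End Twist.

Variable Phi : LA g n -> LA g' n.
Hypothesis PhiI : lie_iso br br' L L' Phi.
Variable psi : hdual h * 'rV[int]_n -> 'rV[int]_n.
Hypothesis psi_hom : hom_on S psi.
Hypothesis psi_supp : forall b x, bipiece b x -> x != 0 ->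
  forall mu, mu != psi b -> Phi (single b.2 x) mu = 0.

(** The same [x] has degrees [b] and [b + (0, ga)], so the nonzero [phi x] is an eigenvector of
    [sig'] for both images, which therefore agree modulo Gamma'. *)
Lemma psi_Gamma ga : in_Gamma m ga -> in_Gamma m' (psi (0, ga)).
Proof.
move=> gG; have [b [x [xb x0]]] := bipiece_ex.
have [phi [[th phiK _] _ phiP]] := descent_supported k0 zeta_prim brS sig_cfo h_max
  br'S sig'_cfo h'_max PhiI psi_supp.
have px0 : phi x != 0 by apply: contraNneq x0 => px0; rewrite -[x]phiK px0 -(linear0 phi) phiK.
have Sb := S_bipiece xb x0; have Sg := S_Gamma gG.
have -> : psi (0, ga) = psi (b + (0, ga)) - psi b by rewrite psi_hom // addrAC subrr add0r.
apply: (sigsp_Gamma_eq zeta_prim sig'_cfo px0); last exact: phiP.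
by apply: phiP => //; apply: bipiece_Gamma.
Qed.

(** Let [w] be the preimage of the shift by [ga'] of the image of [single b.2 x]. Its value at t = 1
    is a nonzero multiple of [x], by [descent_shift] for the inverse of [Phi]. Only degrees [d] with
    [psi d = psi b + ga'] are needed to write [w], so one of them carries the piece of [x], and
    [d.2 - b.2] is the element sought. *)
Lemma psi_Gamma_surj ga' : in_Gamma m' ga' ->
  exists ga, in_Gamma m ga /\ psi (0, ga) = ga'.
Proof.
move=> gG'; have [b [x [xb x0]]] := bipiece_ex; have Sb := S_bipiece xb x0.
have L0 := ml_0 zeta sig_cfo h_max; have L_lin := ml_lin (zeta := zeta) sig_cfo h_max.
have [Psi [PsiI PhiPsi]] := lie_iso_inverse PhiI L_lin (ml_br zeta_prim sig_cfo h_max).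
have [chi chi0 chiP] := descent_shift k0 zeta_prim sig'_cfo h'_max brS sig_cfo h_max PsiI gG'.
have [P1 _ P3 _ _] := PhiI; have [Q1 _ _ _ _] := PsiI.
have Lx : L (single b.2 x) by apply: (ml_single sig_cfo h_max); case: xb.
have PsiPhi : Psi (Phi (single b.2 x)) = single b.2 x.
  by apply: P3 => //; [apply/Q1/P1|rewrite PhiPsi //; apply: P1].
pose v := la_shift ga' (Phi (single b.2 x)); pose ka := psi b + ga'.
have L'v : L' v by apply: (ml_shift zeta_prim sig'_cfo h'_max gG'); apply: P1.
have vka mu : mu != ka -> v mu = 0.
  by move=> muk; apply: (psi_supp xb x0); rewrite subr_eq.
pose w := Psi v; have Lw : L w by apply: Q1.
have wev : la_ev (fun=> 1) w = chi *: x.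
  by have := chiP _ (P1 _ Lx); rewrite /descent -/v -/w PsiPhi la_ev_single scale1r.
pose W := span_by (fun z => exists d, [/\ bipiece d z, z != 0 & psi d = ka]).
(* [w1] collects the terms of [w] with [psi]-degree [ka] and [w2] the others. Outside [ka] both
   [Phi w] and [Phi w1] vanish, at [ka] so does [Phi w2]; hence [w2 = 0]. *)
have [w1 [w2 [Lw1 Lw2 wE w1W [w1ka w2ka]]]] : exists w1 w2, [/\ L w1, L w2,
    w = la_add w1 w2, W (la_ev (fun=> 1) w1) &
    (forall mu, mu != ka -> Phi w1 mu = 0) /\ Phi w2 ka = 0].
  have Phi0 := lie_iso0 PhiI L0.
  move: (w) Lw; apply: ml_ind => [|d z u zd Lu [u1 [u2 [Lu1 Lu2 uE u1W [u1ka u2ka]]]]].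
    exists (@la0 k g n), (@la0 k g n); rewrite la_add0 la_ev0 Phi0; split=> //.
    by exists [::]; rewrite big_nil.
  have [z0|z0] := eqVneq z 0.
    by exists u1, u2; rewrite z0 single0 la_add0; split.
  have Lz : L (single d.2 z) by apply: (ml_single sig_cfo h_max); case: zd.
  have fz := finsupp_single d.2 z; have fu1 := ml_finsupp sig_cfo h_max Lu1.
  have laA (x1 x2 x3 : LA g n) : la_add x1 (la_add x2 x3) = la_add (la_add x1 x2) x3.
    by apply: boolp.funext => l; rewrite /la_add addrA.
  have Padd := lie_iso_add PhiI.
  have [dka|dka] := eqVneq (psi d) ka.
    exists (la_add (single d.2 z) u1), u2; split=> //.
    - exact: (ml_add sig_cfo h_max).
    - by rewrite uE laA.
    - rewrite la_ev_add // la_ev_single scale1r; case: u1W => r [rP ->].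
      exists (z :: r); rewrite big_cons; split=> // y; rewrite inE => /orP[/eqP ->|/rP//].
      by exists d.
    - split=> // mu muk; rewrite Padd // /la_add u1ka // addr0.
      by apply: (psi_supp zd z0); rewrite dka.
  exists u1, (la_add (single d.2 z) u2); split=> //.
  - exact: (ml_add sig_cfo h_max).
  - by rewrite uE; apply: boolp.funext => l; rewrite /la_add addrCA.
  - split=> //; rewrite Padd // /la_add u2ka addr0.
    by apply: (psi_supp zd z0); rewrite eq_sym.
have w2E : w2 = @la0 k g n.
  apply: P3 => //; rewrite (lie_iso0 PhiI L0); apply: boolp.funext => mu.
  have [->//|muk] := eqVneq mu ka.
  have := vka _ muk; rewrite -(PhiPsi v L'v) -/w wE (lie_iso_add PhiI Lw1 Lw2) /la_add.
  by rewrite w1ka // add0r.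
have [r [rP rE]] : W (chi *: x) by rewrite -wev wE w2E la_addr0.
have [s [p pP]] := piece_projections k0 zeta_prim sig_cfo h_max; have [_ _ pin pid p0] := pP.
pose a := (b.1, lab zeta m b.2).
have pax : p a x = x by apply: pid; apply/piece_lab; case: (b) xb.
have [/hasP[z zr pz]|/hasPn no] := boolP (has (fun z => p a z != 0) r); last first.
  suff /eqP : chi *: x = 0 by rewrite scaler_eq0 (negPf chi0) (negPf x0).
  rewrite -pax -linearZ /= rE linear_sum big_seq big1 // => z /no.
  by rewrite negbK => /eqP.
have [d [zd z0 dka]] := rP z zr.
have zpiece : piece br sig (d.1, lab zeta m d.2) z by apply/piece_lab; case: (d) zd.
have /eqP[e1 e2] : a == (d.1, lab zeta m d.2).
  by apply: contraNT pz => ad; apply/eqP/(p0 _ (d.1, lab zeta m d.2)).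
have gG : in_Gamma m (d.2 - b.2) by apply/(in_Gamma_lab zeta_prim sig_cfo).
exists (d.2 - b.2); split=> //; apply: (@addrI _ (psi b)).
rewrite -psi_hom //; last exact: S_Gamma.
rewrite -/ka -dka; congr psi; case: (b) (d) e1 => [b1 b2] [d1 d2] /= ->.
by rewrite -[LHS]/(_, _) /= addr0 addrC subrK.
Qed.

Let mq i : (m i)%:R != 0 :> rat. Proof. by rewrite pnatr_eq0 -lt0n (cfo_gt0 sig_cfo). Qed.
Let m'q i : (m' i)%:R != 0 :> rat. Proof. by rewrite pnatr_eq0 -lt0n (cfo_gt0 sig'_cfo). Qed.

Lemma qrow_delta i : qrow m (delta_mx 0 i *+ m i) = delta_mx 0 i.
Proof.
apply/rowP => j; rewrite !mxE mulmxnE mxE eqxx /=; case: (j =P i) => [->|_].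
  by rewrite -[_ *+ m i]/((m i)%:R) natz -pmulrn divff.
by rewrite mul0rn mul0r.
Qed.

Lemma qrow_Gamma_int (q : 'I_n -> nat) ga : (forall i, (0 < q i)%N) -> in_Gamma q ga ->
  exists l : 'rV[int]_n, qrow q ga = map_mx intr l.
Proof.
move=> q0 gG; exists (\row_i (ga 0%R i %/ q i)%Z); apply/rowP => i; rewrite !mxE.
rewrite -{1}(divzK (gG i)) rmorphM /= mulfK //; by rewrite intr_eq0 -lt0n.
Qed.

(** The rows of [P] are the images of the generators [m i] e_i, divided by [m']; preimages of the
    generators of Gamma' give the rows of its inverse. *)
Lemma psi_linear_on_Gamma : exists P : 'M[int]_n, P \in unitmx /\
  forall ga, in_Gamma m ga -> qrow m' (psi (0, ga)) = qrow m ga *m map_mx intr P.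
Proof.
have m0 i : (0 < m i)%N by apply: cfo_gt0 sig_cfo i.
have m'0 i : (0 < m' i)%N by apply: cfo_gt0 sig'_cfo i.
have dG i : in_Gamma m (delta_mx 0 i *+ m i).
  move=> j; rewrite mulmxnE mxE eqxx /=; case: (j =P i) => [->|_]; last by rewrite mul0rn dvdz0.
  by rewrite -[_ *+ m i]/((m i)%:R) natz dvdzz.
have /boolp.choice[p pP] i := qrow_Gamma_int m'0 (psi_Gamma (dG i)).
pose P := \matrix_(i, j) p i 0 j.
have PE ga : in_Gamma m ga -> qrow m' (psi (0, ga)) = qrow m ga *m map_mx intr P.
  move=> gG; suff [] : in_Gamma m ga /\ qrow m' (psi (0, ga)) = qrow m ga *m map_mx intr P by [].
  move: ga gG; apply: (Gamma_gen (P := fun ga => in_Gamma m ga /\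
    qrow m' (psi (0, ga)) = qrow m ga *m map_mx intr P)).
  - by move=> i; split=> //; rewrite pP qrow_delta -rowE; apply/rowP => j; rewrite !mxE.
  - split=> [i|]; first by rewrite mxE dvdz0.
    by rewrite [psi _](hom_on0 psi_hom) !qrow0 mul0mx.
  - move=> x y [xG xE] [yG yE]; split=> [i|].
      by rewrite !mxE; apply: rpredB; [apply: xG|apply: yG].
    have -> : (0, x - y) = (0, x) + - (0, y) :> hdual h * 'rV[int]_n.
      by congr pair; rewrite /= ?subr0 // oppr0 addr0.
    have Sx := S_Gamma xG; have Sy := S_Gamma yG.
    rewrite psi_hom ?(hom_onN psi_hom) //; last exact: gen_subgroupN.
    by rewrite !qrowB mulmxBl xE yE.
exists P; split=> //.
have d'G i : in_Gamma m' (delta_mx 0 i *+ m' i).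
  move=> j; rewrite mulmxnE mxE eqxx /=; case: (j =P i) => [->|_]; last by rewrite mul0rn dvdz0.
  by rewrite -[_ *+ m' i]/((m' i)%:R) natz dvdzz.
have /boolp.choice[q qP] : forall j, exists l : 'rV[int]_n,
    map_mx intr l *m map_mx intr P = delta_mx 0 j :> 'rV[rat]_n.
  move=> j; have [ga [gG gE]] := psi_Gamma_surj (d'G j).
  have [l lE] := qrow_Gamma_int m0 gG; exists l; rewrite -lE -PE // gE.
  apply/rowP => i; rewrite !mxE mulmxnE mxE eqxx /=; case: (i =P j) => [->|_].
    by rewrite -[_ *+ m' j]/((m' j)%:R) natz -pmulrn divff.
  by rewrite mul0rn mul0r.
pose Q := \matrix_(i, j) q i 0 j.
suff /mulmx1_unit[] : Q *m P = 1%:M by [].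
have e : map_mx intr (Q *m P) = 1%:M :> 'M[rat]_n.
  rewrite map_mxM; apply/row_matrixP => j; rewrite row_mul row1 -(qP j).
  by congr (_ *m _); apply/rowP => i; rewrite !mxE.
apply/matrixP => i j; have /matrixP/(_ i j) := e; rewrite mxE => eij.
by apply: (@intr_inj rat); rewrite eij !mxE rmorph_nat.
Qed.

Theorem reconstruction : exists (s : hdual h -> 'rV[rat]_n) (P : 'M[int]_n) (phi : 'Hom(g, g')),
  [/\ hom_on (in_Qh br (h := h)) s, P \in unitmx, bijective (fun x => phi x),
      (forall x y, phi (br x y) = br' (phi x) (phi y)) &
      exists tau : 'I_n -> 'End(g),
        (forall i (al : hdual h) (x : g), in_Qh br al -> rootsp br al x ->
           tau i x = zeta_pow zeta (- (s al) 0 i) *: x) /\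
        (forall j, sig' j =
           (phi \o tuple_powP (fun i => tau i \o sig i)%VF P j \o phi^-1)%VF)].
Proof.
have m0 i : (0 < m i)%N by apply: cfo_gt0 sig_cfo i.
have m'0 i : (0 < m' i)%N by apply: cfo_gt0 sig'_cfo i.
have [P [Pu PE]] := psi_linear_on_Gamma.
have [phi [phi_bij phi_br phiP]] := descent_supported k0 zeta_prim brS sig_cfo h_max
  br'S sig'_cfo h'_max PhiI psi_supp.
pose PQ : 'M[rat]_n := map_mx intr P.
have PQu : PQ \in unitmx.
  by rewrite unitmxE det_map_mx unitfE intr_eq0; apply: contraTneq Pu => e; rewrite unitmxE e.
pose D b := qrow m' (psi b) - qrow m b.2 *m PQ.
have DD b d : S b -> S d -> D (b + d) = D b + D d.
  by move=> Sb Sd; rewrite /D psi_hom // !qrowD mulmxDl opprD addrACA.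
(* A multiple of [l] lies in Gamma, where [D] vanishes by choice of [P], and rational vectors have
   no torsion. Hence [D] depends on the root only. *)
have D0 l : S (0, l) -> D (0, l) = 0.
  move=> Sl; pose M := (\prod_i m i)%N.
  have M0 : (0 < M)%N by rewrite prodn_gt0.
  have MG : in_Gamma m (l *+ M).
    move=> i; rewrite mulmxnE -mulr_natr natz; apply: dvdz_mull.
    by rewrite dvdzE /= /M (bigD1 i) //= dvdn_mulr.
  have eM : (0, l) *+ M = (0, l *+ M) :> hdual h * 'rV[int]_n.
    elim: (M) => [//|N IHN]; rewrite !mulrS IHN; congr pair; exact: addr0.
  have := PE _ MG; rewrite -eM (hom_onMn psi_hom) // !qrowMn.
  move=> e; have : D (0, l) *+ M = 0.
    by rewrite mulrnBl e -!scaler_nat scalemxAl subrr.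
  move/eqP; rewrite -scaler_nat scaler_eq0 pnatr_eq0 => /orP[/eqP M00|/eqP//].
  by rewrite M00 in M0.
have /boolp.choice[r rP] : forall al, exists r : 'rV[rat]_n, forall l, S (al, l) -> D (al, l) = r.
  move=> al; have [[l Sl]|no] := boolp.EM (exists l, S (al, l)); last first.
    by exists 0 => l Sl; case: no; exists l.
  exists (D (al, l)) => mu Smu.
  have e : (al, mu) = (al, l) + (0, mu - l) :> hdual h * 'rV[int]_n.
    by congr pair; rewrite /= ?addr0 // addrC subrK.
  have S0 : S (0, mu - l).
    have -> : (0, mu - l) = (al, mu) - (al, l) :> hdual h * 'rV[int]_n.
      by congr pair; rewrite /= ?subrr.
    exact/gen_subgroupD/gen_subgroupN.
  by rewrite e DD // D0 // addr0.
pose s al := - (r al *m invmx PQ).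
have psiE b : S b -> qrow m' (psi b) = (qrow m b.2 - s b.1) *m PQ.
  case: b => al l Sb; rewrite opprK mulmxDl -mulmxA mulVmx // mulmx1 -(rP al l Sb) /D /=.
  by rewrite addrC subrK.
have s_hom : hom_on (in_Qh br (h := h)) s.
  move=> al be /in_Qh_S[l Sl] /in_Qh_S[mu Smu].
  have Sa : S (al + be, l + mu) by apply: (gen_subgroupD Sl Smu).
  rewrite /s -opprD -mulmxDl -(rP _ _ Sl) -(rP _ _ Smu) -(rP _ _ Sa) -DD //.
have [sr [pr prP]] := root_projections h_max; have [_ psum pin _ _] := prP.
have /boolp.choice[tau tauP] i :=
  (scalar_on_pieces (fun al : hdual h => zeta_pow zeta (- (s al) 0 i)) prP).
have tauE i (al : hdual h) x : rootsp br al x -> tau i x = zeta_pow zeta (- (s al) 0 i) *: x.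
  by have [_] := tauP i; apply.
exists s, P, phi; split=> //; exists tau; split=> [i al x _|j]; first exact: tauE.
have tauQ i (al : hdual h) x : in_Qh br al -> rootsp br al x ->
    tau i x = zeta_pow zeta (- (s al) 0 i) *: x by move=> _; apply: tauE.
have [th phiK thK] := phi_bij.
have ker0 : lker phi == 0%VS by apply/lker0P => x y /(congr1 th); rewrite !phiK.
have eq1 : (sig' j \o phi)%VF = (phi \o tuple_powP (fun i => tau i \o sig i)%VF P j)%VF.
  apply: (bipiece_eq k0 zeta_prim sig_cfo h_max) => b x xb; rewrite !comp_lfunE.
  have [->|x0] := eqVneq x 0; first by rewrite !linear0.
  have Sb := S_bipiece xb x0; rewrite (twist_tuple P tauQ j xb).
  rewrite (phiP b x xb x0 j) linearZ /=; congr (_ *: _).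
  rewrite -(zeta_powE zeta_compat) //.
  have := congr1 (fun v : 'rV[rat]_n => v 0 j) (psiE b Sb); rewrite [LHS]mxE => -> //.
have phiV y : phi ((phi^-1)%VF y) = y.
  by rewrite -[y]thK lker0_lfunK.
apply/lfunP => y; have /lfunP/(_ ((phi^-1)%VF y)) := eq1.
by rewrite !comp_lfunE phiV.
Qed.
End Reconstruction.

(** * Realizing a twist by graded isomorphisms *)

Section Alignment.
Variables (k : closedFieldType) (k0 : [pchar k] =i pred0) (zeta : nat -> k).
Hypothesis zeta_prim : forall N : nat, (0 < N)%N -> N.-primitive_root (zeta N).
Hypothesis zeta_compat : forall M N : nat, (0 < M)%N -> (0 < N)%N ->
  zeta (M * N)%N ^+ M = zeta N.
Variables (n : nat).
Variables (g : vectType k) (br : g -> g -> g).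
Hypothesis brL : is_lie br.
Variables (sig : 'I_n -> 'End(g)) (m : 'I_n -> nat) (h : {vspace g}).
Hypotheses (sig_cfo : cfo_tuple br sig m) (h_max : maxtoral brL sig h).
Variables (g' : vectType k) (br' : g' -> g' -> g').
Hypotheses (br'L : is_lie br') (br'S : is_simple_lie br').
Variables (sig' : 'I_n -> 'End(g')) (m' : 'I_n -> nat) (h' : {vspace g'}).
Hypotheses (sig'_cfo : cfo_tuple br' sig' m') (h'_max : maxtoral br'L sig' h').
Notation bipiece := (bipiece zeta br sig m (h := h)).
Implicit Types (b d : hdual h * 'rV[int]_n).
Variables (s : hdual h -> 'rV[rat]_n) (P : 'M[int]_n) (phi : 'Hom(g, g')) (tau : 'I_n -> 'End(g)).
Hypotheses (s_hom : hom_on (in_Qh br (h := h)) s) (Pu : P \in unitmx)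
  (phi_bij : bijective (fun x => phi x)) (phi_br : forall x y, phi (br x y) = br' (phi x) (phi y))
  (tauE : forall i (al : hdual h) (x : g), in_Qh br al -> rootsp br al x ->
     tau i x = zeta_pow zeta (- (s al) 0 i) *: x)
  (sig'E : forall j, sig' j =
     (phi \o tuple_powP (fun i => tau i \o sig i)%VF P j \o phi^-1)%VF).
Notation PQ := (map_mx intr P : 'M[rat]_n).
Notation U := (tuple_powP (fun i => tau i \o sig i)%VF P).

Lemma phi_ker0 : lker phi == 0%VS.
Proof. by have [th phiK _] := phi_bij; apply/lker0P => x y /(congr1 th); rewrite !phiK. Qed.

Lemma sig'_phi j x : sig' j (phi x) = phi (U j x).
Proof. by rewrite sig'E !comp_lfunE lker0_lfunK // phi_ker0. Qed.

Lemma unit_intr_row (v : 'rV[rat]_n) (l : 'rV[int]_n) :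
  v *m PQ = map_mx intr l -> v = map_mx intr (l *m invmx P).
Proof.
move=> e; rewrite map_mxM -e -mulmxA -map_mxM mulmxV // map_mx1 mulmx1 //.
Qed.

Lemma int_row_Gamma (l z : 'rV[int]_n) : qrow m l = map_mx intr z -> in_Gamma m l.
Proof.
move=> e i; have := congr1 (fun v : 'rV[rat]_n => v 0 i) e; rewrite !mxE => ei.
have m0 : (m i)%:R != 0 :> rat by rewrite pnatr_eq0 -lt0n (cfo_gt0 sig_cfo).
apply/dvdzP; exists (z 0 i); apply: (@intr_inj rat).
by rewrite rmorphM /= -ei divfK.
Qed.

Lemma U_piece_comm j (t : seq (hdual h * {ffun 'I_n -> k})) p :
  projections (piece br sig (h := h)) t p -> forall a x, p a (U j x) = U j (p a x).
Proof.
move=> pP; apply: (proj_comm pP) => a x xa.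
have [->|x0] := eqVneq x 0; first by rewrite linear0; case: (piece_lin brL sig a).
have [l al] := piece_ex zeta_prim sig_cfo xa x0.
have xb : bipiece (a.1, l) x by apply/piece_lab; rewrite -al -surjective_pairing.
rewrite (twist_tuple k0 zeta_prim zeta_compat sig_cfo h_max P tauE j xb).
exact: (lin_closedZ (piece_lin brL sig a)).
Qed.

(** For maximality: the preimage of a [sig']-fixed [y] commuting with the image of [h] is fixed by
    [U] and has only the root 0, where the twist is trivial. If it has a component of degree [l],
    then [qrow m l *m PQ] is integral, so [l] lies in Gamma because [P] is invertible over the
    integers. Thus the preimage is fixed by [sig]. *)
Lemma image_maxtoral : maxtoral br'L sig' (phi @: h)%VS.
Proof.
have [th phiK thK] := phi_bij; have [hf hab hd hm] := h_max.
have s0 : s 0 = 0 by apply: hom_on0 s_hom.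
have thE x : (phi^-1)%VF x = th x by rewrite -{1}[x]thK lker0_lfunK // phi_ker0.
have th_br x y : th (br' x y) = br (th x) (th y).
  by rewrite -{1}[x]thK -{1}[y]thK -phi_br phiK.
split.
- move=> _ /memv_imgP[x xh ->] j; rewrite sig'_phi.
  have xb : bipiece (0, 0) x.
    split=> [H|i]; first by rewrite zero_lfunE scale0r hab // subvsP.
    by rewrite mxE expr0z scale1r hf.
  rewrite (twist_tuple k0 zeta_prim zeta_compat sig_cfo h_max P tauE j xb).
  by rewrite /twist_row qrow0 s0 subr0 mul0mx mxE zeta_pow0 scale1r.
- by move=> _ _ /memv_imgP[x xh ->] /memv_imgP[y yh ->]; rewrite -phi_br hab // linear0.
- by move=> _ /memv_imgP[x xh ->]; apply: (diagonal_iso br'L phi_bij phi_br); apply: hd.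
move=> y yf yd yc; rewrite -[y]thK; apply: memv_img.
have yU j : U j (th y) = th y by apply: (can_inj phiK); rewrite -sig'_phi thK yf.
have yh x : x \in h -> br x (th y) = 0.
  move=> xh; apply: (can_inj phiK); rewrite phi_br thK linear0.
  by apply: yc; apply: memv_img.
apply: hm => //; last first.
  rewrite -thE; apply: (diagonal_iso brL _ _ yd).
    by exists phi => x; rewrite thE.
  by move=> u v; rewrite !thE.
have [t [p pP]] := piece_projections k0 zeta_prim sig_cfo h_max.
have [_ psum pin pid p0] := pP; have [tr [pr prP]] := root_projections h_max.
move=> i; rewrite {1}(psum (th y)) {2}(psum (th y)) linear_sum; apply: eq_bigr => a _ /=.
have [->|pa0] := eqVneq (p a (th y)) 0; first by rewrite linear0.
have a1 : a.1 = 0.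
  apply/eqP; apply: contraNT pa0 => a1.
  have [_ _ _ _ pr0] := prP; have [par _] := pin a (th y).
  have y0 : rootsp br (h := h) 0 (th y) by move=> H; rewrite zero_lfunE scale0r yh ?subvsP.
  have e : pr a.1 (p a (th y)) = p a (th y) by have [_ _ _ + _] := prP; apply.
  rewrite -e; have -> : pr a.1 (p a (th y)) = p a (pr a.1 (th y)).
    have cm (c : hdual h * {ffun 'I_n -> k}) z : piece br sig c z -> piece br sig c (pr a.1 z).
      case: c => [c1 c2] [/= zr zs]; split => /=.
        have [<-|ac] := eqVneq a.1 c1; first by have [_ _ pin' _ _] := prP; apply: pin'.
        by rewrite (pr0 _ c1) //; case: (rootsp_lin brL c1).
      by move=> l; rewrite -(root_proj_sig sig_cfo h_max prP) zs linearZ.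
    by rewrite (proj_comm pP cm).
  by rewrite (pr0 _ 0) // linear0.
have [l al] := piece_ex zeta_prim sig_cfo (pin a (th y)) pa0.
have xb : bipiece (0, l) (p a (th y)).
  by apply/piece_lab; rewrite -al -a1 -surjective_pairing.
have [z zE] : exists z : 'rV[int]_n, qrow m l *m PQ = map_mx intr z.
  have /boolp.choice[z zP] : forall j, exists z : int, (qrow m l *m PQ) 0 j = z%:~R.
    move=> j; apply: (zeta_pow_eq1 zeta_prim).
    have := twist_tuple k0 zeta_prim zeta_compat sig_cfo h_max P tauE j xb.
    rewrite -(U_piece_comm j pP) yU /twist_row s0 subr0 => /eqP.
    rewrite -{1}[p a (th y)]scale1r -subr_eq0 -scalerBl scaler_eq0 (negPf pa0) orbF subr_eq0.
    by move/eqP.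
  by exists (\row_j z j); apply/rowP => j; rewrite zP !mxE.
have lG := int_row_Gamma (unit_intr_row zE).
have := (in_Gamma_lab zeta_prim sig_cfo l 0).1; rewrite subr0 => /(_ lG) l0.
have [_ ps] := pin a (th y); rewrite ps al l0 ffunE mxE expr0z scale1r //.
Qed.

Lemma alignment : exists phi1 : 'Hom(g, g'),
  [/\ bijective phi1, forall x y, phi1 (br x y) = br' (phi1 x) (phi1 y), (phi1 @: h)%VS = h' &
      (forall j x, sig' j (phi1 x) = phi1 (U j x))].
Proof.
have [eta [[eta_bij eta_br] eta_sig etaT]] := maxtoral_conjugate k0 br'S sig'_cfo image_maxtoral h'_max.
exists (eta \o phi)%VF; split.
- have [th phiK thK] := phi_bij; have [th' etaK th'K] := eta_bij.
  by exists (th \o th') => x /=; rewrite comp_lfunE /= ?etaK ?phiK // thK th'K.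
- by move=> x y; rewrite !comp_lfunE phi_br eta_br.
- by rewrite limg_comp.
- by move=> j x; rewrite !comp_lfunE eta_sig sig'_phi.
Qed.
End Alignment.

(** * Regradings described by degree maps *)

Section Regraded.
Variables (k : closedFieldType) (zeta : nat -> k).
Variables (g : vectType k) (br : g -> g -> g).
Hypothesis brL : is_lie br.
Variables (n : nat) (sig : 'I_n -> 'End(g)) (m : 'I_n -> nat) (h : {vspace g}).
Hypotheses (sig_cfo : cfo_tuple br sig m) (h_max : maxtoral brL sig h).
Notation sigsp := (sigsp zeta sig m).
Notation Lc := (ml_comp zeta br sig m (h := h)).
Notation bipiece := (bipiece zeta br sig m (h := h)).
Notation S := (gen_subgroup (supp_of Lc)).
Implicit Types (b d x : hdual h * 'rV[int]_n) (e : hdual h * 'rV[int]_n -> 'rV[int]_n).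

Lemma coarse_ml_comp l f : coarse Lc l f <-> exists2 y, f = single l y & sigsp l y.
Proof.
split=> [[s [X [XL fE]]]|[y -> yl]].
  have Xl al : al \in s -> X al = single l (X al l) /\ sigsp l (X al l).
    by move=> /XL/ml_compP[y -> [_ ys]]; rewrite singleE.
  exists (f l); last first.
    rewrite fE; apply: lin_closed_sum => [|al als _]; first exact: sigsp_lin.
    by case: (Xl al als).
  apply: supported_single => mu mul; rewrite fE big_seq big1 // => al als.
  by have [-> _] := Xl al als; rewrite /single (negPf mul).
have [sr [pr prP]] := root_projections h_max; have [_ psum pin _ _] := prP.
exists sr, (fun al => single l (pr al y)); split=> [al _|mu].
  apply/ml_compP; exists (pr al y) => //; split; first exact: pin.
  by move=> i; rewrite -(root_proj_sig sig_cfo h_max prP) yl linearZ.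
rewrite /single; case: eqP => _; first exact: psum.
by rewrite big1.
Qed.

(* Every algebra in a chain of regradings has this form, with [e] additive on the subgroup
   generated by the support. *)
Definition regraded e x (f : LA g n) : Prop :=
  f = @la0 k g n \/ exists mu, [/\ S (x.1, mu), Lc (x.1, mu) f & e (x.1, mu) = x.2].

Lemma regraded_snd x f : regraded (fun b => b.2) x f <-> Lc x f.
Proof.
split=> [[->|[mu [_ Lf e]]]|Lf].
- apply/ml_compP; exists 0; first by rewrite single0.
  by case: (bipiece_lin zeta brL sig m x).
- by move: Lf; rewrite [x]surjective_pairing -e.
have [f0|f0] := boolp.pselect (f = @la0 k g n); first by left.
right; exists x.2; rewrite -surjective_pairing; split=> //.
by apply: gen_subgroup_in; exists f.
Qed.

Lemma regraded_single e b (x : g) : bipiece b x -> x != 0 -> regraded e (b.1, e b) (single b.2 x).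
Proof.
move=> xb x0; right; exists b.2; rewrite /= -surjective_pairing; split=> //.
  exact: S_bipiece xb x0.
by apply/ml_compP; exists x.
Qed.

Lemma coarse_in (Q : zmodType) (comp : Q * 'rV[int]_n -> LA g n -> Prop) al l f :
  comp (al, l) f -> coarse comp l f.
Proof.
move=> cf; exists [:: al], (fun=> f); split=> [be|mu]; first by rewrite inE => /eqP ->.
by rewrite big_seq1.
Qed.

Lemma regraded_supp e l : supp_of (coarse (regraded e)) l -> exists b, S b /\ e b = l.
Proof.
move=> [f [[s [X [XP fE]]] f0]].
have [[al als X0]|all0] :=
  boolp.pselect (exists2 al, al \in s & X al <> @la0 k g n).
  by have [|[mu [Sb _ el]]] := XP al als; last exists (al, mu).
case: f0; apply: boolp.funext => mu; rewrite fE big_seq big1 // => al als.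
have [->//|X0] := boolp.pselect (X al = @la0 k g n).
by case: all0; exists al.
Qed.

Lemma gen_supp_coarse (comp : hdual h * 'rV[int]_n -> LA g n -> Prop) e : hom_on S e ->
  (forall b (x : g), bipiece b x -> x != 0 -> comp (b.1, e b) (single b.2 x)) ->
  forall b, S b -> gen_subgroup (supp_of (coarse comp)) (e b).
Proof.
move=> e_hom eP; apply: (gen_subgroup_hom e_hom) => b /(supp_bipiece zeta br sig m)[x [xb x0]].
apply: gen_subgroup_in; exists (single b.2 x); split; last exact: single_neq0.
exact: coarse_in (eP b x xb x0).
Qed.

Lemma regrade_rho_regraded e e' (rho : 'rV[int]_n -> 'rV[int]_n) : hom_on S e ->
  (forall b, S b -> e' b = rho (e b)) ->
  forall x f, regraded e' x f <-> regrade_rho (regraded e) rho x f.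
Proof.
move=> e_hom e'E x f; split=> [[->|[mu [Sb Lf ex]]]|[[mu [_ [rmu]]]|->]].
- by right.
- left; exists (e (x.1, mu)); split; last by rewrite -e'E //; split=> //; right; exists mu.
  by apply: gen_supp_coarse Sb => // b y; apply: regraded_single.
- by move=> [->|[l [Sl Lf /= el]]]; [left|right; exists l; rewrite e'E // el].
- by left.
Qed.

Lemma regraded_hom e : hom_on S e ->
  forall l, gen_subgroup (supp_of (coarse (regraded e))) l -> exists b, S b /\ e b = l.
Proof. by move=> e_hom; apply: gen_subgroup_image => // l; apply: regraded_supp. Qed.

Lemma regrade_s_regraded e (s : hdual h -> 'rV[int]_n) x f :
  regraded (fun b => e b - s b.1) x f <-> regrade_s (regraded e) s x f.
Proof.
rewrite /regrade_s; split=> [[->|[mu [Sb Lf <-]]]|[->|[mu [Sb Lf ex]]]]; [by left| |by left|].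
  by right; exists mu; split=> //=; rewrite subrK.
by right; exists mu; split=> //=; rewrite ex /= addrK.
Qed.
End Regraded.

(** * Loop isomorphism and chain of regradings built from a twist *)

Section Realization.
Variables (k : closedFieldType) (k0 : [pchar k] =i pred0) (zeta : nat -> k).
Hypothesis zeta_prim : forall N : nat, (0 < N)%N -> N.-primitive_root (zeta N).
Hypothesis zeta_compat : forall M N : nat, (0 < M)%N -> (0 < N)%N ->
  zeta (M * N)%N ^+ M = zeta N.
Variables (n : nat).
Variables (g : vectType k) (br : g -> g -> g).
Hypotheses (brL : is_lie br) (brS : is_simple_lie br).
Variables (sig : 'I_n -> 'End(g)) (m : 'I_n -> nat) (h : {vspace g}).
Hypotheses (sig_cfo : cfo_tuple br sig m) (h_max : maxtoral brL sig h).
Variables (g' : vectType k) (br' : g' -> g' -> g').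
Hypothesis br'L : is_lie br'.
Variables (sig' : 'I_n -> 'End(g')) (m' : 'I_n -> nat) (h' : {vspace g'}).
Hypotheses (sig'_cfo : cfo_tuple br' sig' m') (h'_max : maxtoral br'L sig' h').
Notation L := (ml_alg zeta br sig m h).
Notation L' := (ml_alg zeta br' sig' m' h').
Notation Lc := (ml_comp zeta br sig m (h := h)).
Notation Lc' := (ml_comp zeta br' sig' m' (h := h')).
Notation bipiece' := (bipiece zeta br' sig' m' (h := h')).
Notation bipiece := (bipiece zeta br sig m (h := h)).
Notation S := (gen_subgroup (supp_of Lc)).
Implicit Types (b d : hdual h * 'rV[int]_n).
Variables (s : hdual h -> 'rV[rat]_n) (P : 'M[int]_n) (phi : 'Hom(g, g')) (U : 'I_n -> 'End(g)).
Notation PQ := (map_mx intr P : 'M[rat]_n).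
Hypotheses (s_hom : hom_on (in_Qh br (h := h)) s) (Pu : P \in unitmx)
  (phi_bij : bijective (fun x => phi x)) (phi_br : forall x y, phi (br x y) = br' (phi x) (phi y))
  (phi_h : (phi @: h)%VS = h') (sig'_phi : forall j x, sig' j (phi x) = phi (U j x))
  (U_piece : forall j b x, bipiece b x -> U j x = zeta_pow zeta ((twist_row m s b *m PQ) 0 j) *: x).

Let th y := (phi^-1)%VF y.
Let ker0 : lker phi == 0%VS.
Proof. by have [th' phiK _] := phi_bij; apply/lker0P => x y /(congr1 th'); rewrite !phiK. Qed.
Let phiK x : th (phi x) = x. Proof. exact: lker0_lfunK. Qed.
Let thK y : phi (th y) = y.
Proof. by have [th' phiK' thK'] := phi_bij; rewrite -[y]thK' phiK. Qed.
Let phi_inj : injective phi. Proof. exact: can_inj phiK. Qed.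
Let phi_h_in x : x \in h -> phi x \in h'.
Proof. by move=> xh; rewrite -phi_h memv_img. Qed.
Let th_h_in y : y \in h' -> th y \in h.
Proof. by rewrite -phi_h => /memv_imgP[x xh ->]; rewrite phiK. Qed.
Let PQu : PQ \in unitmx.
Proof.
by rewrite unitmxE det_map_mx unitfE intr_eq0; apply: contraTneq Pu => e; rewrite unitmxE e.
Qed.
Let m'q i : (m' i)%:R != 0 :> rat. Proof. by rewrite pnatr_eq0 -lt0n (cfo_gt0 sig'_cfo). Qed.
Let mq i : (m i)%:R != 0 :> rat. Proof. by rewrite pnatr_eq0 -lt0n (cfo_gt0 sig_cfo). Qed.

Let qrow_inj (q : 'I_n -> nat) : (forall i, (q i)%:R != 0 :> rat) -> injective (qrow q).
Proof.
move=> q0 l mu /rowP e; apply/rowP => i; have := e i; rewrite !mxE => /(mulIf (invr_neq0 (q0 i))).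
exact: (@intr_inj rat).
Qed.

Definition dual_transport (al : hdual h) : hdual h' :=
  (al \o linfun (vsproj h) \o phi^-1 \o linfun vsval)%VF.
Definition dual_transport_inv (al : hdual h') : hdual h :=
  (al \o linfun (vsproj h') \o phi \o linfun vsval)%VF.
Notation theta := dual_transport.
Notation theta_inv := dual_transport_inv.

Lemma dual_transportE al H' : theta al H' = al (vsproj h (th (vsval H'))).
Proof. by rewrite !comp_lfunE !lfunE. Qed.

Lemma dual_transport_invE al H : theta_inv al H = al (vsproj h' (phi (vsval H))).
Proof. by rewrite !comp_lfunE !lfunE. Qed.

Lemma dual_transportD al be : theta (al + be) = theta al + theta be.
Proof. by apply/lfunP => H; rewrite add_lfunE !dual_transportE add_lfunE. Qed.

Lemma dual_transportK : cancel theta theta_inv.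
Proof.
move=> al; apply/lfunP => H; rewrite dual_transport_invE dual_transportE.
by rewrite vsprojK ?phi_h_in ?subvsP // phiK vsvalK.
Qed.

Lemma dual_transport_invK : cancel theta_inv theta.
Proof.
move=> al; apply/lfunP => H; rewrite dual_transportE dual_transport_invE.
by rewrite vsprojK ?th_h_in ?subvsP // thK vsvalK.
Qed.

Lemma rootsp_phi al x : rootsp br al x -> rootsp br' (theta al) (phi x).
Proof.
move=> xr H'; rewrite dual_transportE -[vsval H' in LHS]thK -phi_br.
have hH : th (vsval H') \in h by apply/th_h_in/subvsP.
by have := xr (vsproj h (th (vsval H'))); rewrite vsprojK // => ->; rewrite linearZ.
Qed.

Lemma rootsp_th al y : rootsp br' (theta al) y -> rootsp br al (th y).
Proof.
move=> yr H; apply: phi_inj; rewrite phi_br thK.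
have hH : phi (vsval H) \in h' by apply/phi_h_in/subvsP.
have := yr (vsproj h' (phi (vsval H))); rewrite vsprojK // => ->.
by rewrite dual_transportE vsprojK // phiK vsvalK linearZ /= thK.
Qed.

Definition psiQ b : 'rV[rat]_n := twist_row m s b *m PQ.

Lemma psiQD b d : S b -> S d -> psiQ (b + d) = psiQ b + psiQ d.
Proof.
move=> /S_in_Qh Qb /S_in_Qh Qd.
by rewrite /psiQ /twist_row s_hom // qrowD opprD addrACA mulmxDl.
Qed.

Lemma sig'_piece b x j : bipiece b x -> sig' j (phi x) = zeta_pow zeta (psiQ b 0 j) *: phi x.
Proof. by move=> xb; rewrite sig'_phi (U_piece _ xb) linearZ. Qed.

(** The [m' j]-th power of [sig' j] is the identity, so [psiQ b 0 j * m' j] is an integer for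
    degrees in the support. *)
Lemma psiQ_int b : S b -> exists l : 'rV[int]_n, qrow m' l = psiQ b.
Proof.
have Q0 : psiQ 0 = 0.
  by rewrite /psiQ /twist_row qrow0 (hom_on0 s_hom) subr0 mul0mx.
move=> Sb; suff [] : S b /\ exists l : 'rV[int]_n, qrow m' l = psiQ b by [].
move: b Sb; apply: (gen_subgroup_ind (P := fun b => S b /\
  exists l : 'rV[int]_n, qrow m' l = psiQ b)).
- by split; [exact: gen_subgroup0|exists 0; rewrite Q0 qrow0].
- move=> b d [Sb [l lE]] [Sd [mu muE]]; split; first exact: gen_subgroupD.
  by exists (l + mu); rewrite qrowD psiQD ?lE ?muE.
- move=> b [Sb [l lE]]; split; first exact: gen_subgroupN.
  exists (- l); apply: (@addrI _ (psiQ b)); rewrite -psiQD //; last exact: gen_subgroupN.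
  by rewrite subrr Q0 -lE -qrowD subrr qrow0.
- move=> b bs; split; first exact: gen_subgroup_in.
  have [x [xb x0]] := (supp_bipiece zeta br sig m b).1 bs.
  have px0 : phi x != 0 by apply: contraNneq x0 => e; rewrite -[x]phiK e /th linear0.
  have /boolp.choice[z zP] : forall j, exists z : int, psiQ b 0 j * (m' j)%:R = z%:~R.
    move=> j; apply: (zeta_pow_eq1 zeta_prim).
    rewrite pmulrn zeta_powMz //; have := cfo_iter sig'_cfo j (phi x).
    have -> : iter (m' j) (sig' j) (phi x) = zeta_pow zeta (psiQ b 0 j) ^+ m' j *: phi x.
      elim: (m' j) => [|N IHN]; first by rewrite expr0 scale1r.
      by rewrite /= IHN linearZ /= (sig'_piece _ xb) scalerA exprSr.
    move/eqP; rewrite -{2}[phi x]scale1r -subr_eq0 -scalerBl scaler_eq0 (negPf px0) orbF.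
    by rewrite subr_eq0 => /eqP.
  by exists (\row_j z j); apply/rowP => j; rewrite [LHS]mxE [in LHS]mxE -zP mulfK.
Qed.

(** The roots generating Q_h all occur in the finite list [sr], so the product of the denominators
    of [s] on it clears [s]. The factors [m i] in [s2] undo the division in [qrow]. *)
Lemma clear_denominators : exists (N : nat) (s2 : hdual h -> 'rV[int]_n),
  [/\ (0 < N)%N, hom_on (in_Qh br (h := h)) s2 &
      forall al, in_Qh br al -> qrow m (s2 al) = N%:R *: s al].
Proof.
have [sr [pr prP]] := root_projections h_max; have [_ _ _ pid _] := prP.
pose N := (\prod_(al <- sr) \prod_i `|denq (s al 0%R i)|)%N.
have N0 : (0 < N)%N.
  by apply: prodn_gt0 => al; apply: prodn_gt0 => i; rewrite absz_gt0 denq_neq0.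
have int_s al : in_Qh br al -> exists l : 'rV[int]_n, N%:R *: s al = map_mx intr l.
  move=> Qal; suff [] : in_Qh br al /\ exists l : 'rV[int]_n, N%:R *: s al = map_mx intr l by [].
  move: al Qal; apply: (gen_subgroup_ind (P := fun al => in_Qh br al /\
    exists l : 'rV[int]_n, N%:R *: s al = map_mx intr l)).
  - by split; [apply: gen_subgroup0|exists 0; rewrite (hom_on0 s_hom) scaler0 map_mx0].
  - move=> al be [Qal [l lE]] [Qbe [mu muE]]; split; first exact: gen_subgroupD.
    by exists (l + mu); rewrite s_hom // scalerDr lE muE map_mxD.
  - move=> al [Qal [l lE]]; split; first exact: gen_subgroupN.
    by exists (- l); rewrite (hom_onN s_hom) // scalerN lE map_mxN.
  - move=> al [al0 [x [x0 xr]]]; split; first by apply: gen_subgroup_in; split=> //; exists x.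
    have als : al \in sr by apply: contraNT x0 => nal; rewrite -(pid _ _ xr) (proj_out prP).
    have dN i : (`|denq (s al 0%R i)| %| N)%N.
      by rewrite /N (big_rem al) //= (bigD1 i) //= -mulnA dvdn_mulr.
    exists (\row_i (numq (s al 0 i) * (N %/ `|denq (s al 0%R i)|)%N)).
    apply/rowP => i; rewrite [LHS]mxE [RHS]mxE mxE.
    rewrite rmorphM /= numqE -{1}(divnK (dN i)) natrM -mulrA [RHS]mulrC; congr (_ * _).
    by rewrite mulrC -[X in _ * X%:~R]gez0_abs ?denq_ge0.
have /boolp.choice[s2 s2E] : forall al, exists l : 'rV[int]_n,
    in_Qh br al -> qrow m l = N%:R *: s al.
  move=> al; have [/int_s[l lE]|nQ] := boolp.pselect (in_Qh br al); last by exists 0.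
  exists (\row_i (l 0 i * (m i)%:Z)) => _; rewrite lE; apply/rowP => i.
  by rewrite !mxE rmorphM /= (mulfK (mq i)).
exists N, s2; split=> // al be Qal Qbe; apply: (qrow_inj mq).
by rewrite qrowD !s2E // ?s_hom ?scalerDr //; apply: gen_subgroupD.
Qed.

Section Psi.
Variables (psi : hdual h * 'rV[int]_n -> 'rV[int]_n).
Hypothesis psiE : forall b, S b -> qrow m' (psi b) = psiQ b.
Variables (sr : seq (hdual h)) (pr : hdual h -> 'End(g)).
Hypothesis prP : projections (rootsp br (h := h)) sr pr.

Lemma psi_hom_on : hom_on S psi.
Proof.
move=> b d Sb Sd; apply: (qrow_inj m'q); rewrite qrowD !psiE //; first exact: psiQD.
exact: gen_subgroupD.
Qed.

(** Degrees with different roots may have the same image, so injectivity is asserted root by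
    root. *)
Lemma psi_inj b d : S b -> S d -> b.1 = d.1 -> psi b = psi d -> b = d.
Proof.
move=> Sb Sd e1 /(congr1 (qrow m')); rewrite !psiE // => /(can_inj (mulmxK PQu)).
rewrite /twist_row e1 => /addIr/(qrow_inj mq) e2.
by rewrite [b]surjective_pairing [d]surjective_pairing e1 e2.
Qed.

Lemma sigsp_phi b x : bipiece b x -> x != 0 -> sigsp zeta sig' m' (psi b) (phi x).
Proof.
move=> xb x0 j; rewrite (sig'_piece j xb) -psiE; last exact: S_bipiece xb x0.
by rewrite mxE zeta_powE // (cfo_gt0 sig'_cfo).
Qed.

Lemma bipiece_phi b x : bipiece b x -> x != 0 -> bipiece' (theta b.1, psi b) (phi x).
Proof. by move=> xb x0; split; [apply: rootsp_phi; case: xb|apply: sigsp_phi]. Qed.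

Lemma root_piece_comm (t : seq (hdual h * {ffun 'I_n -> k})) p al x :
  projections (piece br sig (h := h)) t p -> rootsp br al x ->
  forall a, a.1 != al -> p a x = 0.
Proof.
move=> pP xr a aal; have [_ _ pin _ pr0] := prP; have [_ _ pina _ _] := pP.
have cm (c : hdual h * {ffun 'I_n -> k}) z : piece br sig c z -> piece br sig c (pr a.1 z).
  case: c => [c1 c2] [/= zr zs]; split => /=.
    have [<-|ac] := eqVneq a.1 c1; first by apply: pin.
    by rewrite (pr0 _ c1) //; case: (rootsp_lin brL c1).
  by move=> l; rewrite -(root_proj_sig sig_cfo h_max prP) zs linearZ.
have e : pr a.1 (p a x) = p a x by have [_ _ _ pid _] := prP; apply: pid; case: (pina a x).
by rewrite -e -(proj_comm pP cm) (pr0 _ al) // linear0.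
Qed.

(** Eigenvalues of [sig'] determine [nu] only modulo Gamma', so a first degree [l] is corrected by
    the element [ga] of Gamma that [P] sends to the discrepancy. *)
Lemma bipiece_th (d : hdual h' * 'rV[int]_n) y : bipiece' d y -> y != 0 ->
  exists b : hdual h * 'rV[int]_n, [/\ bipiece b (th y), theta b.1 = d.1 & psi b = d.2].
Proof.
case: d => be nu [/= yr ys] y0; pose al := theta_inv be.
have thal : theta al = be by apply: dual_transport_invK.
have xr : rootsp br al (th y) by apply: rootsp_th; rewrite thal.
have x0 : th y != 0 by apply: contraNneq y0 => e; rewrite -[y]thK e linear0.
have [t [p pP]] := piece_projections k0 zeta_prim sig_cfo h_max.
have [_ psum pin pid p0] := pP.
have Uc j z a : p a (U j z) = U j (p a z).
  apply: (proj_comm pP) => c v vc; have [->|v0] := eqVneq v 0.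
    by rewrite linear0; case: (piece_lin brL sig c).
  have [l cl] := piece_ex zeta_prim sig_cfo vc v0.
  have vb : bipiece (c.1, l) v by apply/piece_lab; rewrite -cl -surjective_pairing.
  rewrite (U_piece _ vb); exact: (lin_closedZ (piece_lin brL sig c)).
have Uth j : U j (th y) = zeta (m' j) ^ (nu 0 j) *: th y.
  by apply: phi_inj; rewrite -sig'_phi thK ys linearZ /= thK.
(* each nonzero component of [th y] lies in degree [b] for some [b] with [psi b = nu] *)
have comp a : p a (th y) != 0 -> exists l,
    [/\ a = (al, lab zeta m l), S (al, l) & psi (al, l) = nu].
  move=> pa0; have a1 : a.1 = al.
    by apply/eqP; apply: contraNT pa0 => a1; rewrite (root_piece_comm pP xr a1).
  have [l a2] := piece_ex zeta_prim sig_cfo (pin a (th y)) pa0.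
  have xb : bipiece (al, l) (p a (th y)).
    by apply/piece_lab; rewrite -a2 -a1 -surjective_pairing.
  have Sb := S_bipiece xb pa0.
  have ppa0 : phi (p a (th y)) != 0.
    by apply: contraNneq pa0 => e; rewrite -[p a _]phiK e /th linear0.
  have gG : in_Gamma m' (nu - psi (al, l)).
    apply: (sigsp_Gamma_eq zeta_prim sig'_cfo ppa0); last exact: sigsp_phi.
    by move=> j; rewrite sig'_phi -Uc Uth !linearZ.
  have m'0 i : (0 < m' i)%N by apply: cfo_gt0 sig'_cfo i.
  have [z zE] := qrow_Gamma_int m'0 gG.
  pose ga : 'rV[int]_n := \row_i ((z *m invmx P) 0 i * (m i)%:Z).
  have gaE : qrow m ga = map_mx intr (z *m invmx P).
    apply/rowP => i; rewrite [LHS]mxE [ga 0 i]mxE rmorphM /= mulfK ?mq //.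
    by rewrite [RHS]mxE.
  have gaG : in_Gamma m ga by move=> i; rewrite mxE dvdz_mull.
  have Sg := S_Gamma k0 zeta_prim brS sig_cfo h_max gaG.
  have psig : psi (0, ga) = nu - psi (al, l).
    apply: (qrow_inj m'q); rewrite psiE // zE /psiQ /twist_row /= (hom_on0 s_hom) subr0 gaE.
    by rewrite -map_mxM mulmxKV.
  have e : (al, l) + (0, ga) = (al, l + ga) by congr pair; apply: addr0.
  exists (l + ga); split.
  - rewrite [a]surjective_pairing a1 a2; congr pair.
    apply/(in_Gamma_lab zeta_prim sig_cfo); rewrite opprD addrA subrr sub0r => i.
    by have := gaG i; rewrite [(- ga) 0 i]mxE !dvdzE abszN.
  - by rewrite -e; apply: gen_subgroupD.
  - by rewrite -e psi_hom_on // psig addrC subrK.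
have [a _ pa0] := proj_neq0 pP x0; have [l [aE Sl psil]] := comp a pa0.
exists (al, l); split=> //; apply/piece_lab; rewrite -aE.
suff -> : th y = p a (th y) by apply: pin.
rewrite [LHS]psum; have as_ : a \in t by apply: contraNT pa0 => nas; rewrite (proj_out pP).
have [ut _ _ _ _] := pP; rewrite (bigD1_seq a) //= big1 ?addr0 // => c ca.
apply/eqP; apply: contraNT ca => /comp[mu [cE Smu psimu]].
by rewrite cE aE; have := psi_inj Smu Sl erefl (etrans psimu (esym psil)) => -[->].
Qed.

(** Keeps the root components that go from degree [mu] to degree [nu]. The test is on [psiQ], given
    by a formula in every degree, whereas [psi] is constrained only on the support subgroup. *)
Let deg_map (mu nu : 'rV[int]_n) (x : g) : g' :=
  \sum_(al <- sr) if psiQ (al, mu) == qrow m' nu then phi (pr al x) else 0.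

Let deg_map_lin mu nu a x y : deg_map mu nu (a *: x + y) = a *: deg_map mu nu x + deg_map mu nu y.
Proof.
rewrite /deg_map scaler_sumr -big_split; apply: eq_bigr => al _ /=.
by case: eqP => _; rewrite ?scaler0 ?addr0 // !linearP.
Qed.

Let deg_map0 mu nu : deg_map mu nu 0 = 0.
Proof. by rewrite /deg_map big1 // => al _; rewrite !linear0; case: eqP. Qed.

Definition realize (f : LA g n) : LA g' n :=
  fun nu => \sum_(mu <- undup (la_supp f)) deg_map mu nu (f mu).

Lemma realizeE f nu (t : seq 'rV[int]_n) : uniq t -> (forall l, f l != 0 -> l \in t) ->
  realize f nu = \sum_(mu <- t) deg_map mu nu (f mu).
Proof.
move=> ut tP; have ff : finsupp f by exists t.
apply: sum_support => //; first exact: undup_uniq.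
  move=> mu; rewrite mem_undup => d0; apply: (la_suppP ff).
  by apply: contraNneq d0 => ->; rewrite deg_map0.
by move=> mu d0; apply: tP; apply: contraNneq d0 => ->; rewrite deg_map0.
Qed.

Lemma realize_lin c f f' : finsupp f -> finsupp f' ->
  realize (la_add (la_scale c f) f') = la_add (la_scale c (realize f)) (realize f').
Proof.
move=> [t tP] [u uP]; pose w := undup (t ++ u).
have fw l : f l != 0 -> l \in w by move=> /tP lt; rewrite mem_undup mem_cat lt.
have f'w l : f' l != 0 -> l \in w by move=> /uP lt; rewrite mem_undup mem_cat lt orbT.
have uw : uniq w by apply: undup_uniq.
apply: boolp.funext => nu; rewrite {2}/la_add {2}/la_scale.
rewrite (realizeE nu uw fw) (realizeE nu uw f'w) (realizeE nu uw) => [|l].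
  rewrite scaler_sumr -big_split; apply: eq_bigr => mu _; exact: deg_map_lin.
rewrite /la_add /la_scale => d0; have [f0|] := eqVneq (f l) 0; last exact: fw.
by apply: f'w; move: d0; rewrite f0 scaler0 add0r.
Qed.

Lemma realize_add f f' : finsupp f -> finsupp f' ->
  realize (la_add f f') = la_add (realize f) (realize f').
Proof. by move=> ff ff'; rewrite -{1}[f]la_scale1 realize_lin // la_scale1. Qed.

Lemma realize0 : realize (@la0 k g n) = @la0 k g' n.
Proof.
apply: boolp.funext => nu; rewrite (realizeE _ (t := [::])) ?big_nil // => l.
by rewrite /la0 eqxx.
Qed.

Lemma realize_single b x : bipiece b x -> realize (single b.2 x) = single (psi b) (phi x).
Proof.
move=> xb; have [->|x0] := eqVneq x 0; first by rewrite linear0 !single0 realize0.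
have [us _ _ pid p0] := prP; have [xr _] := xb; have Sb := S_bipiece xb x0.
apply: boolp.funext => nu; rewrite (realizeE _ (t := [:: b.2])) // => [|l]; last first.
  by rewrite /single inE; case: (l =P b.2) => // _; rewrite eqxx.
rewrite big_seq1 singleE /deg_map.
have bs : b.1 \in sr by apply: contraNT x0 => nb; rewrite -(pid _ _ xr) (proj_out prP).
rewrite (bigD1_seq b.1) //= big1 ?addr0 => [|al alb]; last first.
  by rewrite (p0 _ b.1) // linear0; case: eqP.
rewrite -surjective_pairing -psiE // (inj_eq (qrow_inj m'q)) pid // /single eq_sym.
by [].
Qed.

(** Nothing cancels: for a fixed root [psi] is injective in the degree, so the root projection
    [pr al] isolates the term coming from [mu]. *)
Lemma realize_detect f al mu : L f -> pr al (f mu) != 0 -> realize f (psi (al, mu)) != 0.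
Proof.
move=> Lf x0; have [[t tP] fs] := (ml_algP zeta sig_cfo h_max f).1 Lf.
have [us psum pin pid p0] := prP.
have bp be l : bipiece (be, l) (pr be (f l)).
  split; first exact: pin.
  by move=> i; rewrite -(root_proj_sig sig_cfo h_max prP) fs linearZ.
have Smu := S_bipiece (bp al mu) x0.
have ut : forall l, f l != 0 -> l \in undup t by move=> l /tP; rewrite mem_undup.
rewrite (realizeE _ (undup_uniq t) ut) /deg_map; set nu := psi (al, mu).
apply: contraNneq (x0) => r0.
have e : \sum_(l <- undup t) \sum_(be <- sr)
    (if psiQ (be, l) == qrow m' nu then pr be (f l) else 0) = 0.
  apply: phi_inj; rewrite linear0 -[RHS]r0 linear_sum; apply: eq_bigr => l _ /=.
  by rewrite linear_sum; apply: eq_bigr => be _ /=; case: eqP => // _; rewrite linear0.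
have als : al \in sr by apply: contraNT (x0) => nal; rewrite (proj_out prP).
have := congr1 (pr al) e; rewrite linear0 linear_sum /= => e2; rewrite -[X in _ == X]e2.
have mut : mu \in undup t by apply: ut; apply: contraNneq (x0) => ->; rewrite linear0.
rewrite (bigD1_seq mu) ?undup_uniq //= [X in _ + X]big1 ?addr0 => [|l lmu].
  rewrite linear_sum (bigD1_seq al) //= psiE // eqxx (projK prP) eqxx big1 ?addr0 // => be beal.
  by case: eqP => _; rewrite ?linear0 // (projK prP) eq_sym (negPf beal).
rewrite linear_sum big1 // => be _ /=; case: eqP => [pE|_]; last exact: linear0.
rewrite (projK prP); case: eqP => // ab; rewrite -ab in pE *; apply/eqP; apply: contraNT lmu => fl0.
have xb := bp al l; have Sl := S_bipiece xb fl0.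
have : psi (al, l) = psi (al, mu) by apply: (qrow_inj m'q); rewrite psiE // pE psiE.
by move/(psi_inj Sl Smu erefl) => [->].
Qed.

Lemma realize_ml f : L f -> L' (realize f).
Proof.
move: f; apply: ml_ind => [|b x f xb Lf L'f].
  by rewrite realize0; apply: (ml_0 zeta sig'_cfo h'_max).
have ff := ml_finsupp sig_cfo h_max Lf.
rewrite realize_add ?realize_single //; last exact: finsupp_single.
apply: (ml_add sig'_cfo h'_max) => //; have [->|x0] := eqVneq x 0.
  by rewrite linear0 single0; apply: (ml_0 zeta sig'_cfo h'_max).
exact/(ml_single sig'_cfo h'_max)/sigsp_phi.
Qed.

Lemma realize_surj f' : L' f' -> exists f, L f /\ realize f = f'.
Proof.
move: f'; apply: ml_ind => [|d y f' yd L'f' [f [Lf <-]]].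
  by exists (@la0 k g n); rewrite realize0; split=> //; apply: (ml_0 zeta sig_cfo h_max).
have [->|y0] := eqVneq y 0; first by exists f; rewrite single0 la_add0.
have [b [xb _ psib]] := bipiece_th yd y0.
have sx : L (single b.2 (th y)) by apply: (ml_single sig_cfo h_max); case: xb.
exists (la_add (single b.2 (th y)) f); split; first exact: (ml_add sig_cfo h_max).
rewrite realize_add ?realize_single ?psib ?thK //; first exact: finsupp_single.
exact: (ml_finsupp sig_cfo h_max Lf).
Qed.

Lemma realize_inj f f' : L f -> L f' -> realize f = realize f' -> f = f'.
Proof.
move=> Lf Lf' e; have ff := ml_finsupp sig_cfo h_max Lf.
have ff' := ml_finsupp sig_cfo h_max Lf'.
pose d := la_add (la_scale (-1) f') f; have Ld : L d by apply: (ml_lin sig_cfo h_max).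
have d0 nu : realize d nu = 0.
  by rewrite realize_lin // -e /la_add /la_scale scaleN1r addNr.
apply: boolp.funext => mu; apply/eqP; rewrite -subr_eq0.
have -> : f mu - f' mu = d mu by rewrite /d /la_add /la_scale scaleN1r addrC.
apply: contraT => /(proj_neq0 prP)[al _ /(realize_detect Ld)].
by rewrite d0 eqxx.
Qed.

Lemma realize_br f f' : L f -> L f' -> realize (la_br br f f') = la_br br' (realize f) (realize f').
Proof.
move=> Lf; move: f Lf f'; apply: ml_ind => [f' _|b x f xb Lf IHf f' Lf'].
  by rewrite (la_br0l brL) realize0 (la_br0l br'L).
have ff := ml_finsupp sig_cfo h_max Lf; have ff' := ml_finsupp sig_cfo h_max Lf'.
have fs := @finsupp_single _ g n.
have fr u : L u -> finsupp (realize u) by move=> /realize_ml; apply: (ml_finsupp sig'_cfo h'_max).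
have fb u v : finsupp u -> finsupp v -> finsupp (la_br br u v) by apply: finsupp_br.
rewrite (la_br_addl brL) // !realize_add ?IHf ?realize_single //; try exact: fb.
rewrite (la_br_addl br'L) //; last first; [exact: fr|exact: finsupp_single|].
congr la_add; move: f' {IHf ff' fr} Lf'; apply: ml_ind => [|d y f' yd Lf' IHf'].
  by rewrite (la_br0r brL) realize0 (la_br0r br'L).
have ff' := ml_finsupp sig_cfo h_max Lf'.
rewrite (la_br_addr brL) !realize_add ?IHf' //; try exact: fb.
rewrite (la_br_addr br'L) (la_br_single brL) !realize_single // (la_br_single br'L) -phi_br.
congr la_add.
have bd := bipiece_br zeta_prim brL sig_cfo xb yd.
rewrite (realize_single bd).
have [->|x0] := eqVneq x 0; first by rewrite (br0l brL) linear0 !single0.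
have [->|y0] := eqVneq y 0; first by rewrite (br0r brL) linear0 !single0.
rewrite psi_hom_on //; [exact: S_bipiece xb x0|exact: S_bipiece yd y0].
Qed.

Theorem realize_iso : lie_iso br br' L L' realize.
Proof.
split; [exact: realize_ml|exact: realize_surj|exact: realize_inj| |exact: realize_br].
move=> a f f' Lf Lf'; exact: realize_lin (ml_finsupp sig_cfo h_max Lf) (ml_finsupp sig_cfo h_max Lf').
Qed.

Theorem realize_support_iso : support_iso br br' L Lc L' Lc'.
Proof.
pose Psi b : hdual h' * 'rV[int]_n := (theta b.1, psi b).
have PsiS : hom_on S Psi.
  by move=> b d Sb Sd; rewrite /Psi psi_hom_on // dual_transportD.
have Psi_inj b d : S b -> S d -> Psi b = Psi d -> b = d.
  move=> Sb Sd /pair_equal_spec[/(can_inj dual_transportK) e]; exact: psi_inj.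
exists realize, Psi; split=> //; first exact: realize_iso.
- move=> y; split=> [|[b [Sb <-]]]; last first.
    move: b Sb; apply: (gen_subgroup_hom PsiS) => b /(supp_bipiece zeta br sig m)[x [xb x0]].
    apply/gen_subgroup_in/supp_bipiece; exists (phi x); split; first exact: bipiece_phi.
    by apply: contraNneq x0 => e; rewrite -[x]phiK e /th linear0.
  apply: (gen_subgroup_image PsiS) => d /(supp_bipiece zeta br' sig' m')[z [zd z0]].
  have [b [zb b1 psib]] := bipiece_th zd z0; exists b; split; last first.
    by rewrite /Psi b1 psib -surjective_pairing.
  by apply: S_bipiece zb _; apply: contraNneq z0 => e; rewrite -[z]thK e linear0.
move=> b Sb f'; split=> [/ml_compP[y -> yb]|[f [/ml_compP[x -> xb] <-]]]; last first.
  apply/ml_compP; exists (phi x); first exact: realize_single.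
  have [->|x0] := eqVneq x 0; last exact: bipiece_phi.
  by rewrite linear0; case: (bipiece_lin zeta br'L sig' m' (Psi b)).
have [->|y0] := eqVneq y 0.
  exists (single b.2 0); rewrite !single0 realize0; split=> //; apply/ml_compP.
  by exists 0; [rewrite single0|case: (bipiece_lin zeta brL sig m b)].
have [d [xd d1 psid]] := bipiece_th yb y0.
have x0 : th y != 0 by apply: contraNneq y0 => e; rewrite -[y]thK e linear0.
have db : d = b.
  by apply: Psi_inj => //; [exact: S_bipiece xd x0|rewrite /Psi d1 psid].
move: xd; rewrite db => xb; exists (single b.2 (th y)).
by rewrite realize_single // thK; split=> //; apply/ml_compP; exists (th y).
Qed.

(** For [psi] a coarse component may mix several Z^n-degrees of [L], at most one for each root;
    [realize] collects them in the single degree [nu]. *)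
Lemma realize_coarse nu f' :
  coarse Lc' nu f' <-> exists f, coarse (regraded zeta br sig m psi) nu f /\ realize f = f'.
Proof.
have [_ psum pin _ _] := prP.
split=> [/(coarse_ml_comp zeta sig'_cfo h'_max)[y -> ys]|[f [[t [X [XP fE]]] <-]]].
  have [f [Lf fy]] := realize_surj (ml_single sig'_cfo h'_max ys); exists f; split=> //.
  have [_ fs] := (ml_algP zeta sig_cfo h_max f).1 Lf.
  exists sr, (fun al mu => pr al (f mu)); split=> // al _.
  pose X mu := pr al (f mu).
  have XS mu : X mu != 0 -> S (al, mu) /\ psi (al, mu) = nu.
    move=> x0; split.
      apply: (S_bipiece _ x0); split; first exact: pin.
      by move=> i; rewrite -(root_proj_sig sig_cfo h_max prP) fs linearZ.
    by have := realize_detect Lf x0; rewrite fy /single; case: (psi _ =P nu) => // _; rewrite eqxx.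
  have [[l /eqP x0]|X0] := boolp.pselect (exists mu, X mu <> 0); last first.
    by left; apply: boolp.funext => mu; apply: boolp.contrapT => x0; case: X0; exists mu.
  right; have [Smu psimu] := XS l x0; exists l; split=> //.
  apply/ml_compP; exists (X l); last first.
    split; first exact: pin.
    by move=> i; rewrite -(root_proj_sig sig_cfo h_max prP) fs linearZ.
  apply: supported_single => mu; apply: contraNeq => /XS[Sl psil].
  by have /(psi_inj Sl Smu erefl)[->] : psi (al, mu) = psi (al, l) by rewrite psil.
have -> : f = (fun mu => \sum_(al <- t) X al mu) by apply: boolp.funext.
suff [_ [y [ys ->]]] : L (fun mu => \sum_(al <- t) X al mu) /\
    exists y, sigsp zeta sig' m' nu y /\ realize (fun mu => \sum_(al <- t) X al mu) = single nu y.
  by apply/(coarse_ml_comp zeta sig'_cfo h'_max); exists y.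
move: XP {f fE}; elim: t => [|al t IHt] XP.
  rewrite (_ : (fun _ => _) = @la0 k g n); last by apply: boolp.funext => mu; rewrite big_nil.
  split; first exact: (ml_0 zeta sig_cfo h_max).
  by exists 0; rewrite realize0 single0; case: (sigsp_lin zeta sig' m' nu).
have [be bet|Lt [y [ys tE]]] := IHt; first by apply: XP; rewrite inE bet orbT.
rewrite (_ : (fun _ => _) = la_add (X al) (fun mu => \sum_(be <- t) X be mu)); last first.
  by apply: boolp.funext => mu; rewrite big_cons.
have [->|[mu [Smu /ml_compP[x -> xb] psimu]]] := XP al (mem_head _ _).
  by rewrite la_add0; split=> //; exists y.
have sx : L (single mu x) by apply: (ml_single sig_cfo h_max); case: xb.
split; first exact: (ml_add sig_cfo h_max).
exists (phi x + y); rewrite realize_add; first split.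
- apply: lin_closedD ys; first exact: sigsp_lin.
  have [->|x0] := eqVneq x 0; first by rewrite linear0; case: (sigsp_lin zeta sig' m' nu).
  by rewrite -[nu]psimu; apply: sigsp_phi xb x0.
- rewrite (realize_single xb) [psi _]psimu tE; apply: boolp.funext => l.
  by rewrite /la_add /single; case: eqP; rewrite ?addr0.
- exact: finsupp_single.
- exact: (ml_finsupp sig_cfo h_max Lt).
Qed.

Theorem realize_isograded_iso :
  isograded_iso br br' L (coarse (regraded zeta br sig m psi)) L' (coarse Lc').
Proof.
exists realize, id; split=> //; first exact: realize_iso.
  by exists id.
exact: realize_coarse.
Qed.

Theorem regrading_chain :
  exists (p : nat) (comps : nat -> hdual h * 'rV[int]_n -> LA g n -> Prop),
    [/\ (forall x f, comps 0%N x f <-> Lc x f),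
        isograded_iso br br' L (coarse (comps p)) L' (coarse Lc') &
        (forall i, (i < p)%N ->
           (exists rho : 'rV[int]_n -> 'rV[int]_n,
              let S := gen_subgroup (supp_of (coarse (comps i))) in
              [/\ hom_on S rho,
                  (forall x y, S x -> S y -> rho x = rho y -> x = y) &
                  forall x f, comps i.+1 x f <-> regrade_rho (comps i) rho x f])
           \/
           (exists s : hdual h -> 'rV[int]_n,
              hom_on (in_Qh br (h := h)) s /\
              forall x f, comps i.+1 x f <-> regrade_s (comps i) s x f))].
Proof.
have [N [s2 [N0 s2_hom s2E]]] := clear_denominators.
pose e1 b : 'rV[int]_n := b.2 *+ N; pose e2 b := e1 b - s2 b.1.
have e1_hom : hom_on S e1 by move=> b d _ _; rewrite /e1 mulrnDl.
have e2_hom : hom_on S e2.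
  move=> b d Sb Sd; have Qb := S_in_Qh Sb; have Qd := S_in_Qh Sd.
  by rewrite /e2 e1_hom // s2_hom // opprD addrACA.
have Nq : N%:R != 0 :> rat by rewrite pnatr_eq0 -lt0n.
(* The relation is linear and invertible, so on the support subgroup [psi] and [e2] determine each
   other: this makes [rho] both well defined and injective. *)
have psi_e2 b : S b -> N%:R *: qrow m' (psi b) = qrow m (e2 b) *m PQ.
  move=> Sb; rewrite psiE // /psiQ scalemxAl; congr (_ *m _).
  by rewrite /twist_row /e2 qrowB qrowMn (s2E _ (S_in_Qh Sb)) scalerBr !scaler_nat.
have e2_psi b d : S b -> S d -> psi b = psi d -> e2 b = e2 d.
  move=> Sb Sd e; apply: (qrow_inj mq); apply: (can_inj (mulmxK PQu)).
  by rewrite -!psi_e2 // e.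
(* Off the image of [e2] the value of [rho] is a dummy 0. *)
have /boolp.choice[rho rhoE] : forall nu, exists l, forall b, S b -> e2 b = nu -> l = psi b.
  move=> nu; have [[b [Sb <-]]|nb] := boolp.pselect (exists b, S b /\ e2 b = nu).
    exists (psi b) => d Sd e; apply: (qrow_inj m'q); apply: (scalerI Nq).
    by rewrite !psi_e2 // e.
  by exists 0 => b Sb bnu; case: nb; exists b.
have {}rhoE b : S b -> rho (e2 b) = psi b by move=> Sb; apply: rhoE.
pose es i := match i with 0 => fun b => b.2 | 1 => e1 | 2 => e2 | _ => psi end.
exists 3, (fun i => regraded zeta br sig m (es i)); split.
- exact: (regraded_snd zeta brL).
- exact: realize_isograded_iso.
move=> [|[|[|//]]] _.
- left; exists (fun mu => mu *+ N); split.
  + by move=> x y _ _; rewrite mulrnDl.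
  + move=> x y _ _ /rowP e; apply/rowP => i; have := e i; rewrite !mulmxnE.
    exact: pmulrnI.
  + by apply: regrade_rho_regraded.
- by right; exists s2; split=> //; apply: regrade_s_regraded.
left; exists rho; split.
- move=> _ _ /(regraded_hom e2_hom)[b [Sb <-]] /(regraded_hom e2_hom)[d [Sd <-]].
  rewrite -e2_hom // !rhoE ?psi_hom_on //; exact: gen_subgroupD.
- move=> _ _ /(regraded_hom e2_hom)[b [Sb <-]] /(regraded_hom e2_hom)[d [Sd <-]].
  by rewrite !rhoE //; apply: e2_psi.
- by apply: regrade_rho_regraded => // b Sb; rewrite rhoE.
Qed.
End Psi.
End Realization.

(** A bihomogeneous vector is followed through the chain. Its root never changes, and each step
    alters its degree by [rho] or by subtracting [s] at the root, both additive on the relevant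
    subgroups; so the total degree map is additive. *)
Lemma regrading_degree (k : closedFieldType) (zeta : nat -> k) (g : vectType k)
  (br : g -> g -> g) (n : nat) (sig : 'I_n -> 'End(g)) (m : 'I_n -> nat) (h : {vspace g})
  (p : nat) (comps : nat -> hdual h * 'rV[int]_n -> LA g n -> Prop) :
  (forall x f, comps 0%N x f <-> ml_comp zeta br sig m x f) ->
  (forall i, (i < p)%N ->
     (exists rho : 'rV[int]_n -> 'rV[int]_n,
        let S := gen_subgroup (supp_of (coarse (comps i))) in
        [/\ hom_on S rho,
            (forall x y, S x -> S y -> rho x = rho y -> x = y) &
            forall x f, comps i.+1 x f <-> regrade_rho (comps i) rho x f])
     \/
     (exists s : hdual h -> 'rV[int]_n,
        hom_on (in_Qh br (h := h)) s /\
        forall x f, comps i.+1 x f <-> regrade_s (comps i) s x f)) ->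
  forall i, (i <= p)%N -> exists e : hdual h * 'rV[int]_n -> 'rV[int]_n,
    hom_on (gen_subgroup (supp_of (ml_comp zeta br sig m (h := h)))) e /\
    forall b x, bipiece zeta br sig m b x -> x != 0 -> comps i (b.1, e b) (single b.2 x).
Proof.
move=> comps0 step; elim=> [_|i IHi ip].
  exists (fun b => b.2); split=> // b x xb x0; apply/comps0/ml_compP; exists x => //.
have [e [e_hom eP]] := IHi (ltnW ip).
have eS := gen_supp_coarse e_hom eP.
have [[rho [rho_hom _ rhoP]]|[s [s_hom sP]]] := step i ip.
  exists (rho \o e); split=> [b d Sb Sd|b x xb x0]; first by rewrite /= e_hom // rho_hom //; apply: eS.
  apply/rhoP; left; exists (e b); split; first exact/eS/(S_bipiece xb x0).
  by split=> //; apply: (eP b x xb x0).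
exists (fun b => e b - s b.1); split=> [b d Sb Sd|b x xb x0].
  have Qb := S_in_Qh Sb; have Qd := S_in_Qh Sd.
  by rewrite e_hom // s_hom // opprD addrACA.
by apply/sP; rewrite /regrade_s /= subrK; apply: (eP b x xb x0).
Qed.

Theorem theorem4p2p5
  (k : closedFieldType) (k_char0 : [pchar k] =i pred0)
  (zeta : nat -> k)
  (zeta_prim : forall N : nat, (0 < N)%N -> N.-primitive_root (zeta N))
  (zeta_compat : forall M N : nat, (0 < M)%N -> (0 < N)%N ->
                   zeta (M * N)%N ^+ M = zeta N)
  (n : nat)
  (g : vectType k) (br : g -> g -> g) (g_simple : is_simple_lie br)
  (sig : 'I_n -> 'End(g)) (m : 'I_n -> nat) (sig_cfo : cfo_tuple br sig m)
  (h : {vspace g}) (h_cartan : cartan_of_fixed br sig h)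
  (g' : vectType k) (br' : g' -> g' -> g') (g'_simple : is_simple_lie br')
  (sig' : 'I_n -> 'End(g')) (m' : 'I_n -> nat) (sig'_cfo : cfo_tuple br' sig' m')
  (h' : {vspace g'}) (h'_cartan : cartan_of_fixed br' sig' h') :
  let L := ml_alg zeta br sig m h in
  let Lc := ml_comp zeta br sig m (h := h) in
  let L' := ml_alg zeta br' sig' m' h' in
  let Lc' := ml_comp zeta br' sig' m' (h := h') in
  (* (a) *)
  let Ca := support_iso br br' L Lc L' Lc' in
  (* (b) *)
  let Cb :=
    exists (s : hdual h -> 'rV[rat]_n) (P : 'M[int]_n) (phi : 'Hom(g, g')),
      [/\ hom_on (in_Qh br (h := h)) s,
          P \in unitmx,
          bijective (fun x => phi x),
          (forall x y, phi (br x y) = br' (phi x) (phi y)) &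
          exists tau : 'I_n -> 'End(g),
            (forall i (al : hdual h) (x : g), in_Qh br al -> rootsp br al x ->
               tau i x = zeta_pow zeta (- (s al) 0 i) *: x) /\
            (forall j, sig' j =
               (phi \o tuple_powP (fun i => tau i \o sig i)%VF P j \o phi^-1)%VF)]
  in
  (* (c) *)
  let Cc :=
    exists (p : nat) (comps : nat -> hdual h * 'rV[int]_n -> LA g n -> Prop),
      [/\ (forall x f, comps 0%N x f <-> Lc x f),
          isograded_iso br br' L (coarse (comps p)) L' (coarse Lc') &
          (forall i, (i < p)%N ->
             (exists rho : 'rV[int]_n -> 'rV[int]_n,
                let S := gen_subgroup (supp_of (coarse (comps i))) in
                [/\ hom_on S rho,
                    (forall x y, S x -> S y -> rho x = rho y -> x = y) &
                    forall x f, comps i.+1 x f <-> regrade_rho (comps i) rho x f])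
             \/
             (exists s : hdual h -> 'rV[int]_n,
                hom_on (in_Qh br (h := h)) s /\
                forall x f, comps i.+1 x f <-> regrade_s (comps i) s x f))]
  in
  (Ca <-> Cb) /\ (Cb <-> Cc).
Proof.
move=> L Lc L' Lc' Ca Cb Cc.
have [brL _ _] := g_simple; have [br'L _ _] := g'_simple.
have h_max := cartan_maxtoral k_char0 brL g_simple sig_cfo h_cartan.
have h'_max := cartan_maxtoral k_char0 br'L g'_simple sig'_cfo h'_cartan.
(* Only the Z^n-degree of the image enters, so (a) and (c) can be treated alike. *)
have Cb_of Phi psi : lie_iso br br' L L' Phi -> hom_on (gen_subgroup (supp_of Lc)) psi ->
    (forall b x, bipiece zeta br sig m b x -> x != 0 ->
       forall mu, mu != psi b -> Phi (single b.2 x) mu = 0) -> Cb.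
  move=> PhiI psi_hom psi_supp.
  exact: (reconstruction k_char0 zeta_prim zeta_compat g_simple sig_cfo h_max
    g'_simple sig'_cfo h'_max PhiI psi_hom psi_supp).
have of_Cb : Cb -> Ca /\ Cc.
  move=> [s [P [phi [s_hom Pu phi_bij phi_br [tau [tauE sig'E]]]]]].
  have [phi1 [phi1_bij phi1_br phi1_h sig'_phi1]] := alignment k_char0 zeta_prim zeta_compat
    sig_cfo h_max g'_simple sig'_cfo h'_max s_hom Pu phi_bij phi_br tauE sig'E.
  have U_piece j b x (xb : bipiece zeta br sig m b x) :=
    twist_tuple k_char0 zeta_prim zeta_compat sig_cfo h_max P tauE j xb.
  have /boolp.choice[psi psiE] : forall b, exists l : 'rV[int]_n,
      gen_subgroup (supp_of Lc) b -> qrow m' l = psiQ m s P b.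
    move=> b; have [Sb|nSb] := boolp.pselect (gen_subgroup (supp_of Lc) b); last by exists 0.
    have [l lE] := psiQ_int zeta_prim zeta_compat sig'_cfo s_hom phi1_bij sig'_phi1 U_piece Sb.
    by exists l.
  have [sr [pr prP]] := root_projections h_max.
  split.
    exact: (realize_support_iso k_char0 zeta_prim zeta_compat g_simple sig_cfo h_max
      sig'_cfo h'_max s_hom Pu phi1_bij phi1_br phi1_h sig'_phi1 U_piece psiE prP).
  exact: (regrading_chain k_char0 zeta_prim zeta_compat g_simple sig_cfo h_max
    sig'_cfo h'_max s_hom Pu phi1_bij phi1_br phi1_h sig'_phi1 U_piece psiE prP).
split; split.
- move=> [Phi [psi [PhiI psi_hom _ _ psiP]]].
  (* The root coordinate of the degree map given by (a) is forgotten. *)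
  apply: (Cb_of Phi (fun b => (psi b).2) PhiI) => [b d Sb Sd|b x xb x0 mu mub].
    by rewrite psi_hom.
  have Lx : Lc b (single b.2 x) by apply/ml_compP; exists x.
  have := (psiP b (S_bipiece xb x0) (Phi (single b.2 x))).2.
  by case=> [|x0' _ _ _]; [exists (single b.2 x)|apply: x0'].
- by move=> /of_Cb[].
- by move=> /of_Cb[].
move=> [p [comps [comps0 [Phi [B [PhiI BD _ BP]]] step]]].
have [e [e_hom eP]] := regrading_degree comps0 step (leqnn p).
apply: (Cb_of Phi (B \o e) PhiI) => [b d Sb Sd|b x xb x0 mu mub].
  by rewrite /= e_hom // BD.
have := (BP (e b) (Phi (single b.2 x))).2; case.
  by exists (single b.2 x); split=> //; apply: coarse_in (eP b x xb x0).
move=> t [X [XP ->]]; rewrite big_seq big1 // => al als.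
by have [X0 _ _ _] := XP al als; apply: X0.
Qed.
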